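(* Let $p\colon[0,1]\to[1,\infty)$ be measurable and essentially bounded, $\overline p=\operatorname{ess\,sup} p$, and let $f\in L^{p(\cdot)}_{\mathrm{ODE}}[0,1]$. (i) Let $1=r_1<r_2<\dots<r_n=\overline p$. Then $$\frac{1}{2(1+ae)}\Big(\cdots\big(|||1_{p^{-1}(r_{n-1},r_n]}f|||_{r_{n-1}}\boxplus_{r_{n-2}}|||1_{p^{-1}(r_{n-2},r_{n-1}]}f|||_{r_{n-2}}\big)\boxplus_{r_{n-3}}\cdots\Big)\boxplus_{r_1}|||1_{p^{-1}[r_1,r_2]}f|||_{r_1}\ \le\ |||f|||_{p(\cdot)}$$ and $$|||f|||_{p(\cdot)}\ \le\ 2(1+ae)\Big(\cdots\big(|||1_{p^{-1}[r_1,r_2)}f|||_{r_2}\boxplus_{r_3}|||1_{p^{-1}[r_2,r_3)}f|||_{r_3}\big)\boxplus_{r_4}\cdots\Big)\boxplus_{r_n}|||1_{p^{-1}[r_{n-1},r_n]}f|||_{r_n}.$$ (ii) More generally, let $\Delta_1,\dots,\Delta_n$ be a measurable decomposition (partition) of $[0,1]$, and let $r_i=\operatorname{ess\,inf}_{\Delta_i}p$, $s_i=\operatorname{ess\,sup}_{\Delta_i}p$. Then $$\frac{1}{2(1+ae)}\Big(\cdots\big(|||1_{\Delta_1}f|||_{r_1}\boxplus_{r_2}|||1_{\Delta_2}f|||_{r_2}\big)\boxplus_{r_3}\cdots\Big)\boxplus_{r_n}|||1_{\Delta_n}f|||_{r_n}\le|||f|||_{p(\cdot)}$$ $$\le 2(1+ae)\Big(\cdots\big(|||1_{\Delta_1}f|||_{s_1}\boxplus_{s_2}|||1_{\Delta_2}f|||_{s_2}\big)\boxplus_{s_3}\cdots\Big)\boxplus_{s_n}|||1_{\Delta_n}f|||_{s_n}.$$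 (iii) With $\Delta_i,r_i,s_i$ as in (ii), $$\frac1{b_{\overline p}}\Big(\cdots\big(\|1_{\Delta_1}f\|_{p(\cdot)}\boxplus_{s_2}\|1_{\Delta_2}f\|_{p(\cdot)}\big)\boxplus_{s_3}\cdots\Big)\boxplus_{s_n}\|1_{\Delta_n}f\|_{p(\cdot)}\le\|f\|_{p(\cdot)}$$ $$\le b_{\overline p}\Big(\cdots\big(\|1_{\Delta_1}f\|_{p(\cdot)}\boxplus_{r_2}\|1_{\Delta_2}f\|_{p(\cdot)}\big)\boxplus_{r_3}\cdots\Big)\boxplus_{r_n}\|1_{\Delta_n}f\|_{p(\cdot)}.$$ (iv) With $\Delta_i,r_i,s_i$ as in (ii), $$\frac1{b_{\overline p}}\Big(\cdots\big(|||1_{\Delta_1}f|||_{p(\cdot)}\boxplus_{s_2}|||1_{\Delta_2}f|||_{p(\cdot)}\big)\boxplus_{s_3}\cdots\Big)\boxplus_{s_n}|||1_{\Delta_n}f|||_{p(\cdot)}\le|||f|||_{p(\cdot)}$$ $$\le b_{\overline p}\Big(\cdots\big(|||1_{\Delta_1}f|||_{p(\cdot)}\boxplus_{r_2}|||1_{\Delta_2}f|||_{p(\cdot)}\big)\boxplus_{r_3}\cdots\Big)\boxplus_{r_n}|||1_{\Delta_n}f|||_{p(\cdot)}.$$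
   Context: Operations: for $a,b\ge0$ and $1\le p<\infty$, $a\boxplus_p b=(a^p+b^p)^{1/p}$ (value $+\infty$ if a term is $+\infty$). Iterated expressions are bracketed from the left as displayed. $p^{-1}(r,s]=\{t: r<p(t)\le s\}$, and similarly for other intervals. Constants: $a\approx1.76$ is the solution of $a^a=e$. $b_1=1$, and for $1<q<\infty$, $b_q$ is the unique solution $b\in(1,2)$ of $b+b^{-q}=2$. Nakano norm: for measurable $p\colon[0,1]\to[1,\infty)$ and measurable $f\colon[0,1]\to\mathbb R$, $$|||f|||_{p(\cdot)}=\inf\Big\{\lambda>0:\int_0^1\frac1{p(t)}\frac{|f(t)|^{p(t)}}{\lambda^{p(t)}}\,dt\le1\Big\}$$ ($+\infty$ if no such $\lambda$ exists). For a constant $r\in[1,\infty)$, $|||f|||_r$ is this norm for the constant exponent $p(\cdot)=r$. ODE-determined norm: for $x_0>0$ let $\varphi_{x_0,f}$ be the (unique, if it exists) absolutely continuous non-decreasing function on $[0,1]$ with $\varphi(0)=x_0$ and $\varphi'(t)=\frac{|f(t)|^{p(t)}}{p(t)}\varphi(t)^{1-p(t)}$ for a.e. $t\in[0,1]$. If these exist for all $x_0>0$, let $\varphi_f(t)=\lim_{x_0\searrow0}\varphi_{x_0,f}(t)$. We say $\varphi_f$ exists if this limit is an absolutely continuous, non-decreasing function with $\varphi_f(0)=0$ satisfying the same differential equation a.e. (the right-hand side read as $0$ where $f(t)=0$). $L^{p(\cdot)}_{\mathrm{ODE}}[0,1]$ is the set of measurable $f\colon[0,1]\to\mathbb R$ for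 which $\varphi_f$ exists, and $\|f\|_{p(\cdot)}:=\varphi_f(1)$. If some $\Delta_i$ is a null set, the corresponding term vanishes and the values $r_i,s_i\in[1,\infty)$ are immaterial. *)

(* Defs.v *)
From HB Require Import structures.
From mathcomp Require Import all_boot all_order all_algebra.
From mathcomp Require Import all_classical all_reals all_analysis.
From mathcomp Require Import ess_sup_inf.

Set Implicit Arguments.
Unset Strict Implicit.
Unset Printing Implicit Defensive.

Import Order.TTheory GRing.Theory Num.Theory.
Import numFieldNormedType.Exports.

Local Open Scope classical_set_scope.
Local Open Scope ring_scope.

(* R with its Lebesgue (not only Borel) measurable sets, on which the completed
   Lebesgue measure is defined. *)
Definition lebesgueType (R : realType) : measurableType _ :=
  caratheodory_type ((@wlength R idfun)^*)%mu.

Notation leb := completed_lebesgue_measure.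

Definition I01 {R : realType} : set R := `[0, 1].

Lemma lebesgue_measurable_I01 (R : realType) :
  measurable (I01 : set (lebesgueType R)).
Proof.
apply: sub_caratheodory.
exact: (@measurable_itv R `[0, 1]).
Qed.

Section essential_bounds.
Context {R : realType}.

Definition ess_sup_on (D : set R)
    (mD : measurable (D : set (lebesgueType R))) (p : R -> R) : \bar R :=
  ess_sup (mrestr (@leb R) mD) (EFin \o p).

Definition ess_inf_on (D : set R)
    (mD : measurable (D : set (lebesgueType R))) (p : R -> R) : \bar R :=
  ess_inf (mrestr (@leb R) mD) (EFin \o p).

End essential_bounds.

Section iterated_sums.
Context {R : realType}.
Local Open Scope ereal_scope.

Definition boxplus (p : R) (x y : \bar R) : \bar R :=
  poweR (poweR x p + poweR y p) p^-1%R.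

(* [:: (_, x1); (p2, x2); ...; (pn, xn)] is sent to
   (...((x1 [+]_p2 x2) [+]_p3 x3) ...) [+]_pn xn;
   the exponent attached to the first term is not used. *)
Definition boxsum (s : seq (R * \bar R)) : \bar R :=
  if s is e0 :: s' then foldl (fun x e => boxplus e.1 x e.2) e0.2 s' else 0.

End iterated_sums.

(* For q > 1 the equation also has the root 1, excluded by 1 < b. *)
Definition is_b {R : realType} (q b : R) : Prop :=
  (q = 1 /\ b = 1) \/ [/\ 1 < q, 1 < b, b < 2 & b + b `^ (- q) = 2].

Section norms.
Context {R : realType}.
Implicit Types (p f phi : R -> R) (x t y : R).

Definition nakano_norm p f : \bar R :=
  ereal_inf [set l%:E | l in [set l : R | 0 < l /\
    (\int[@leb R]_(t in I01) ((p t)^-1 * (`|f t| `^ p t / l `^ p t))%:E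
      <= 1)%E]].

(* The n intervals [u i, v i] are non-overlapping: their interiors are
   disjoint. *)
Definition absolutely_continuous01 phi : Prop :=
  forall e : R, 0 < e -> exists2 d : R, 0 < d &
    forall (n : nat) (u v : 'I_n -> R),
      (forall i, 0 <= u i /\ u i <= v i /\ v i <= 1) ->
      trivIset [set: 'I_n] (fun i => `]u i, v i[%classic) ->
      \sum_(i < n) (v i - u i) < d ->
      \sum_(i < n) `|phi (v i) - phi (u i)| < e.

(* |f(t)|^p(t) / p(t) * y^(1-p(t)). As powR gives 0 `^ z = 0 for z <> 0, the
   infinite value at y = 0, p(t) > 1 is written explicitly. *)
Definition ode_rhs p f t y : \bar R :=
  if f t == 0 then 0%E
  else if (y == 0) && (1 < p t) then +oo%E
  else (`|f t| `^ p t / p t * y `^ (1 - p t))%:E.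

(* derivable and derive1 are two-sided, hence the restriction to the open
   interval; the endpoints form a null set. *)
Definition ode_solution p f (x0 : R) phi : Prop :=
  [/\ absolutely_continuous01 phi,
      {in I01 &, {homo phi : s t / s <= t}},
      phi 0 = x0 &
      {ae @leb R, forall t, 0 < t < 1 ->
        derivable phi t 1 /\ (derive1 phi t)%:E = ode_rhs p f t (phi t)}].

(* Solutions are functions on R of which only the values on [0, 1] matter. *)
Definition unique_ode_solution p f (x0 : R) phi : Prop :=
  ode_solution p f x0 phi /\
  forall psi, ode_solution p f x0 psi -> {in I01, psi =1 phi}.

(* [Phi x0] is the solution started at x0 > 0, and phi the limit as x0 \searrow 0. *)
Definition is_ode_phi p f phi : Prop :=
  [/\ exists2 Phi : R -> R -> R,
        forall x0, 0 < x0 -> unique_ode_solution p f x0 (Phi x0) &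
        forall t, I01 t -> Phi x0 t @[x0 --> 0^'+] --> phi t
    & ode_solution p f 0 phi].

Definition L_ode p : set (R -> R) :=
  [set f | measurable_fun (I01 : set (lebesgueType R)) f /\
    exists phi, is_ode_phi p f phi].

Definition ode_phi p f : R -> R := xget (cst 0) (is_ode_phi p f).

(* As L_ode p is closed under multiplication by indicators of measurable sets
   when p is essentially bounded, the value +oo never arises from such products
   of an f in L_ode p. *)
Definition ode_norm p f : \bar R :=
  if `[< L_ode p f >] then (ode_phi p f 1)%:E else +oo%E.

End norms.

(* Main.v *)
(* Two estimates on iterated sums carry the argument. Let M be the iterated sum
   of the x_i with exponents e_i. For l >= M,
     sum_i (x_i / l)^e_i / e_i <= M / l,
   because on [0, 1] the increments of y^e are at most e times those of y.
   Conversely, if that sum is at most 1 and all e_i <= q, then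
   M <= (2 - 1/q) l: at each step the antiderivative of min(1, y)^(q - 1) grows
   by at most (x_i / l)^e_i / e_i. By Bernoulli 2 - 1/q <= b_q, and
   4 <= 2 (1 + a e) since a >= 1.
   The Nakano norm is governed by the modular K(l), the integral of
   (|f| / l)^p / p, which is additive over partitions; if N is the norm and
   r <= p <= s on the support, then (N / l)^s <= K(l) <= (N / l)^r for l > N.
   This gives (iv), and (i), (ii) follow after comparing p with a constant
   exponent through Young's inequality, at the cost of a factor 2.
   For (iii), let phi and psi_i solve the equations of f and of its pieces,
   all started at the same x > 0. Then psi_i <= phi, so on the i-th piece the
   derivative of (psi_i / l)^e_i / e_i compares with that of phi / l where
   phi <= l (lower bound), resp. with that of the above antiderivative at
   phi / l (upper bound); then x tends to 0. The solutions for the pieces exist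
   because f is in L_ODE exactly when |f|^p / p is integrable. *)
Require Import Defs.
From HB Require Import structures.
From mathcomp Require Import all_boot all_order all_algebra.
From mathcomp Require Import all_classical all_reals all_analysis.
From mathcomp Require Import ess_sup_inf measurable_realfun.
From mathcomp Require Import ring lra.

Set Implicit Arguments.
Unset Strict Implicit.
Unset Printing Implicit Defensive.

Import Order.TTheory GRing.Theory Num.Theory.
Import numFieldNormedType.Exports.

Local Open Scope classical_set_scope.
Local Open Scope ring_scope.

(** * Iterated sums *)

(** Comparisons for the equation are made at starting values x > 0, since y^(1 - p) is singular at 0
    but bounded and Lipschitz above x. As it is antitone in y, a barrier argument gives comparison,
    and with it uniqueness, without any Lipschitz bound. The same antitonicity prevents a direct
    monotone iteration for existence: only the square of the integral map is monotone, and Gronwall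
    has to merge the two functions that the map may exchange. As x decreases to 0 the solutions
    decrease and the integrands increase, so monotone convergence yields the limit. The equation
    holds only almost everywhere, so the basic tool is that an absolutely continuous function with
    nonnegative derivative almost everywhere is nondecreasing. The number 2 - 1/q is the point at
    which y^q / q, continued beyond y = 1 with slope 1, reaches the value 1. Pieces of measure zero
    carry arbitrary exponents; therefore the estimates admit exponents above q at terms equal to
    0. *)

Section powR_inequalities.
Context {R : realType}.
Implicit Types x y q r s : R.

Lemma ge1_neq0 x : 1 <= x -> x != 0.
Proof. by move=> x1; rewrite gt_eqF// (lt_le_trans ltr01). Qed.

Lemma powR_le1 x r : 0 <= x -> x <= 1 -> 0 <= r -> x `^ r <= 1.
Proof.
move=> x0 x1 r0; have := @ge0_ler_powR R r r0 x 1; rewrite powR1.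
by apply; rewrite ?nnegrE.
Qed.

(** Young's inequality for the product of [x] and 1, with exponent [q] and its conjugate, gives x <=
    x^q / q + 1 - 1/q. *)
Lemma powR_bernoulli x q : 0 <= x -> 1 <= q -> 1 + q * (x - 1) <= x `^ q.
Proof.
move=> x0; rewrite le_eqVlt => /predU1P[<-|q1]; first by rewrite powRr1//; lra.
have q0 : 0 < q by lra.
have q1' : 0 < 1 - q^-1 by rewrite subr_gt0 invf_lt1.
have := @conjugate_powR R x 1 q (1 - q^-1)^-1 x0 ler01 q0.
rewrite invr_gt0 powR1 mulr1 mul1r invrK subrKC => /(_ q1' erefl).
rewrite -(ler_pM2l q0) mulrDr mulrCA divff ?gt_eqF// mulr1.
by rewrite mulrBr mulr1 divff ?gt_eqF//; lra.
Qed.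

Lemma powR_tangent x y q : 0 < x -> 0 <= y -> 1 <= q ->
  x `^ q + q * x `^ (q - 1) * (y - x) <= y `^ q.
Proof.
move=> x0 y0 q1; have yx0 : 0 <= y / x by rewrite divr_ge0// ltW.
have := powR_bernoulli yx0 q1.
have xq0 : 0 < x `^ q by exact: powR_gt0.
have e : x `^ q * (y / x) `^ q = y `^ q.
  by rewrite -powRM ?(ltW x0)// mulrC divfK ?gt_eqF.
rewrite -(ler_pM2l xq0) e; apply: le_trans.
have -> : x `^ (q - 1) = x `^ q / x.
  by rewrite powRB ?powRr1 ?(ltW x0)// (gt_eqF x0) implybT.
rewrite le_eqVlt; apply/orP; left; apply/eqP.
by field; rewrite gt_eqF.
Qed.

(** Convexity at the right end point: the tangent at [y] has slope r y^(r - 1) <= r. *)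
Lemma powR_incr_le x y r : 0 <= x -> x <= y -> y <= 1 -> 1 <= r ->
  y `^ r - x `^ r <= r * (y - x).
Proof.
move=> x0 xy y1 r1; have [y0|] := ltP 0 y; last first.
  move=> y0; have -> : x = y by apply: le_anti; rewrite xy/=; lra.
  by rewrite !subrr mulr0.
have := powR_tangent y0 x0 r1.
have : y `^ (r - 1) <= 1 by apply: powR_le1; lra.
have := powR_ge0 y (r - 1); move: (y `^ (r - 1)) => z z0 z1.
have : r * z * (y - x) <= r * 1 * (y - x).
  by rewrite ler_wpM2r ?ler_wpM2l//; lra.
by lra.
Qed.

(** This is [powR_incr_le] for x^s and y^s with exponent q / s >= 1. Division by the exponents is
    what makes the increments decrease in the exponent. *)
Lemma powR_incr_div_le x y s q : 0 <= x -> x <= y -> y <= 1 -> 1 <= s ->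
  s <= q -> (y `^ q - x `^ q) / q <= (y `^ s - x `^ s) / s.
Proof.
move=> x0 xy y1 s1 sq; have s0 : 0 < s by lra.
have q0 : 0 < q by lra.
have := @powR_incr_le (x `^ s) (y `^ s) (q / s).
rewrite -!powRrM (mulrC s) divfK ?gt_eqF//.
have H1 : x `^ s <= y `^ s by rewrite ge0_ler_powR ?nnegrE; lra.
have H2 : y `^ s <= 1 by apply: powR_le1; lra.
rewrite powR_ge0 H1 H2 ler_pdivlMr// mul1r sq => /(_ isT isT isT isT) H.
rewrite ler_pdivrMr// (le_trans H)// le_eqVlt; apply/orP; left; apply/eqP.
by field; rewrite gt_eqF.
Qed.

Lemma powR_incr_ge x y s : 1 <= x -> x <= y -> 1 <= s ->
  y - x <= (y `^ s - x `^ s) / s.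
Proof.
move=> x1 xy s1; rewrite ler_pdivlMr; last lra.
have := @powR_tangent x y s; rewrite s1 => /(_ ltac:(lra) ltac:(lra) isT).
have : 1 <= x `^ (s - 1) by have := @ler_powR R x x1 0 (s - 1); rewrite powRr0 subr_ge0; apply.
move: (x `^ (s - 1)) => z z1.
have : s * 1 * (y - x) <= s * z * (y - x).
  by rewrite ler_wpM2r ?ler_wpM2l//; lra.
by lra.
Qed.

(* The antiderivative of [y |-> min(1, y)^(q - 1)]. *)
Definition capped_powR q y := if y <= 1 then y `^ q / q else y - 1 + q^-1.

(** Below 1 the exponent [q] gives the smaller increments, above 1 the exponent 1 does; an interval
    around 1 is split there. *)
Lemma capped_powR_incr x y s q : 0 <= x -> x <= y -> 1 <= s -> s <= q ->
  capped_powR q y - capped_powR q x <= (y `^ s - x `^ s) / s.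
Proof.
move=> x0 xy s1 sq; rewrite /capped_powR.
case: (leP y 1) => y1; case: (leP x 1) => x1.
- by rewrite -mulrBl; exact: powR_incr_div_le.
- lra.
- have := @powR_incr_div_le x 1 s q x0 x1 (lexx _) s1 sq.
  have := @powR_incr_ge 1 y s (lexx _) (ltW y1) s1.
  by rewrite !powR1; lra.
- have := @powR_incr_ge x y s (ltW x1) xy s1.
  by lra.
Qed.

(** The value at 1 is 1/q and the slope beyond is 1, so the value 1 is reached at 2 - 1/q. *)
Lemma capped_powR_le1 y q : 1 <= q -> capped_powR q y <= 1 -> y <= 2 - q^-1.
Proof.
move=> q1; have : q^-1 <= 1 by rewrite invf_le1//; lra.
by rewrite /capped_powR; case: ifP; lra.
Qed.

(** Bernoulli gives b^r >= 1 + r (b - 1) >= r, since b >= 2 - 1/r. A dilation by [b] thus absorbs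
    the factor 1/e_i of the sums, which the bounds for modulars lack. *)
Lemma le_powR_base r q b : 1 <= r -> r <= q -> 2 - q^-1 <= b -> r <= b `^ r.
Proof.
move=> r1 rq qb; have r0 : 0 < r by lra.
have : q^-1 <= r^-1 by rewrite lef_pV2 ?posrE//; lra.
move=> qr; have rV1 : r^-1 <= 1 by rewrite invf_le1.
have b0 : 0 <= b by lra.
have /(_ r r1) := powR_bernoulli b0.
have : r * (2 - r^-1) <= r * b by rewrite ler_pM2l//; lra.
rewrite mulrBr divff ?gt_eqF//; lra.
Qed.

(** For q > 1 put u = b - 1. The equation reads (1 - u) b^q = 1, so (1 - u) (1 + q u) <= 1 by
    Bernoulli; dividing by u > 0, where the root 1 is excluded, gives u >= 1 - 1/q. *)
Lemma is_b_ge q b : is_b q b -> [/\ 1 <= q, 1 <= b & 2 - q^-1 <= b].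
Proof.
case=> [[-> ->]|[q1 b1 _ bE]]; first by rewrite invr1; split; lra.
have q0 : 0 < q by lra.
split; [lra|lra|].
have := @powR_bernoulli b q ltac:(lra) (ltW q1).
move: bE; rewrite powRN => bE.
have bq0 : 0 < b `^ q by rewrite powR_gt0//; lra.
have e : (2 - b) * b `^ q = 1 by rewrite -bE addrAC subrr add0r mulVf// gt_eqF.
have b2 : 0 < 2 - b by rewrite -bE addrAC subrr add0r invr_gt0.
move=> H; have {}H : (2 - b) * (1 + q * (b - 1)) <= 1.
  by rewrite -[leRHS]e ler_pM2l.
have : q - 1 <= q * (b - 1).
  have b10 : 0 < b - 1 by lra.
  rewrite -(ler_pM2l b10); nra.
rewrite -(ler_pM2l (_ : 0 < q^-1)) ?invr_gt0// mulrA mulVf ?gt_eqF// mul1r.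
rewrite mulrBr mulVf ?gt_eqF//; lra.
Qed.

(** Bernoulli's inequality for x^r with exponent p / r; a term -1/p on the right is dropped. *)
Lemma powR_young x r p : 0 <= x -> 1 <= r -> r <= p ->
  x `^ r / r <= x `^ p / p + r^-1.
Proof.
move=> x0 r1 rp; have r0 : 0 < r by lra.
have p0 : 0 < p by lra.
have := @powR_bernoulli (x `^ r) (p / r) (powR_ge0 _ _).
rewrite -powRrM (mulrC r) divfK ?gt_eqF// ler_pdivlMr// mul1r => /(_ rp).
move=> H; have {}H : (1 + p / r * (x `^ r - 1)) / p <= x `^ p / p.
  by rewrite ler_pM2r// invr_gt0.
have : 0 < p^-1 by rewrite invr_gt0.
suff : (1 + p / r * (x `^ r - 1)) / p = p^-1 + x `^ r / r - r^-1 by move: H; lra.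
by field; rewrite !gt_eqF.
Qed.

End powR_inequalities.

(** * Iterated sums and telescoping *)

Section boxsum_theory.
Context {R : realType}.
Implicit Types (x y l q : R).

Definition rbox (p x y : R) : R := (x `^ p + y `^ p) `^ p^-1.

Lemma rbox_ge0 p x y : 0 <= rbox p x y. Proof. exact: powR_ge0. Qed.

Lemma rbox_powR p x y : 1 <= p -> rbox p x y `^ p = x `^ p + y `^ p.
Proof.
move=> p1; rewrite -powRrM mulVf ?ge1_neq0//.
by rewrite powRr1// addr_ge0// powR_ge0.
Qed.

Lemma rbox_ge p x y : 1 <= p -> 0 <= x -> x <= rbox p x y.
Proof.
move=> p1 x0; have p0 : 0 < p by lra.
rewrite -[leLHS]powRr1// -(mulfV (ge1_neq0 p1)) powRrM.
by rewrite ge0_ler_powR ?nnegrE ?invr_ge0 ?addr_ge0 ?powR_ge0 ?lerDl ?powR_ge0// ltW.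
Qed.

Lemma rboxx0 p x : 1 <= p -> 0 <= x -> rbox p x 0 = x.
Proof.
move=> p1 x0; rewrite /rbox powR0 ?ge1_neq0//.
by rewrite addr0 -powRrM mulfV ?powRr1// ge1_neq0.
Qed.

Lemma boxplus_ge0 p (x y : \bar R) : (0 <= boxplus p x y)%E.
Proof. exact: poweR_ge0. Qed.

Lemma boxplus_pinfty p (x y : \bar R) : 1 <= p -> (0 <= x)%E -> (0 <= y)%E ->
  x = +oo%E \/ y = +oo%E -> boxplus p x y = +oo%E.
Proof.
move=> p1 x0 y0; have p0 : p != 0 by exact: ge1_neq0.
rewrite /boxplus; case=> ->; rewrite poweRyr//.
- by rewrite addye ?poweRyr ?invr_eq0// gt_eqF// (lt_le_trans _ (poweR_ge0 _ _)).
- by rewrite addey ?poweRyr ?invr_eq0// gt_eqF// (lt_le_trans _ (poweR_ge0 _ _)).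
Qed.

Lemma boxplus0e p (x : \bar R) : 1 <= p -> (0 <= x)%E -> boxplus p 0%E x = x.
Proof.
move=> p1; have p0 : p != 0 by exact: ge1_neq0.
rewrite /boxplus poweR0r// add0e -poweRrM mulfV//; case: x => [x x0| |]//=.
- by rewrite powRr1.
- by move=> _; rewrite oner_eq0.
Qed.

Variable T : eqType.
Implicit Types (J : seq T) (e : T -> R) (N : T -> \bar R).

Let box e N J (acc : \bar R) := foldl (fun (z : \bar R) (d : R * \bar R) => boxplus d.1 z d.2) (acc : \bar R)
  [seq (e i, N i) | i <- J].

(** As 0 is neutral, the fold may start from 0 and use the first exponent as well; inductions then
    run over a fold with an arbitrary accumulator. *)
Lemma boxsum_foldl e N J : {in J, forall i, 1 <= e i} ->
  {in J, forall i, (0 <= N i)%E} ->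
  boxsum [seq (e i, N i) | i <- J] = box e N J 0%E.
Proof.
case: J => [|j J] e1 N0 //=; rewrite /box/= boxplus0e//.
  by apply: e1; rewrite mem_head.
by apply: N0; rewrite mem_head.
Qed.

Let box_pinfty e N J acc : {in J, forall i, 1 <= e i} ->
  {in J, forall i, (0 <= N i)%E} -> (0 <= acc)%E ->
  acc = +oo%E \/ (exists2 i, i \in J & N i = +oo%E) -> box e N J acc = +oo%E.
Proof.
elim: J acc => [|j J IH] acc e1 N0 acc0.
  by move=> [|[]]//.
move=> H; rewrite /box/=; apply: IH.
- by move=> i iJ; apply: e1; rewrite in_cons iJ orbT.
- by move=> i iJ; apply: N0; rewrite in_cons iJ orbT.
- exact: boxplus_ge0.
have e1j := e1 j (mem_head _ _); have N0j := N0 j (mem_head _ _).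
case: H => [H|[i]]; first by left; apply: boxplus_pinfty => //; left.
rewrite in_cons => /predU1P[->|iJ] Ni; last by right; exists i.
by left; apply: boxplus_pinfty => //; right.
Qed.

Lemma boxsum_pinfty e N J : {in J, forall i, 1 <= e i} ->
  {in J, forall i, (0 <= N i)%E} -> (exists2 i, i \in J & N i = +oo%E) ->
  boxsum [seq (e i, N i) | i <- J] = +oo%E.
Proof.
by move=> e1 N0 H; rewrite boxsum_foldl//; apply: box_pinfty => //; right.
Qed.

Variable x : T -> R.
Hypothesis x0 : forall i, 0 <= x i.

Let rboxs e J acc := foldl (fun a i => rbox (e i) a (x i)) acc J.

Lemma boxsum_EFin e J : {in J, forall i, 1 <= e i} ->
  boxsum [seq (e i, (x i)%:E) | i <- J] = (rboxs e J 0)%:E.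
Proof.
move=> e1; rewrite boxsum_foldl//; last by move=> i _; rewrite lee_fin.
suff H (a : R) : box e (fun i => (x i)%:E) J a%:E = (rboxs e J a)%:E by exact: H.
by rewrite /box /rboxs; elim: J {e1} a => //= j J IH a; rewrite IH.
Qed.

Let rboxs_ge e J (acc : R) : {in J, forall i, 1 <= e i} -> 0 <= acc ->
  acc <= rboxs e J acc.
Proof.
elim: J acc => //= j J IH acc e1 acc0.
apply: (@le_trans _ _ (rbox (e j) acc (x j))).
  by apply: rbox_ge => //; apply: e1; rewrite mem_head.
by apply: IH; rewrite ?rbox_ge0// => i iJ; apply: e1; rewrite in_cons iJ orbT.
Qed.

Lemma boxsum_real e J : {in J, forall i, 1 <= e i} ->
  exists M : R, boxsum [seq (e i, (x i)%:E) | i <- J] = M%:E /\ 0 <= M.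
Proof. by move=> e1; exists (rboxs e J 0); rewrite boxsum_EFin// rboxs_ge. Qed.

Lemma sum_le_boxsum e J l : {in J, forall i, 1 <= e i} -> 0 < l ->
  (boxsum [seq (e i, (x i)%:E) | i <- J] <= l%:E)%E ->
  (((\sum_(i <- J) (x i / l) `^ e i / e i) * l)%:E
     <= boxsum [seq (e i, (x i)%:E) | i <- J])%E.
Proof.
move=> e1 l0; rewrite boxsum_EFin// !lee_fin -ler_pdivlMr//.
(* For an arbitrary accumulator the bound telescopes: each term is at most the increment of the
   partial sums divided by [l]. *)
suff H (acc : R) : 0 <= acc -> rboxs e J acc <= l ->
    \sum_(i <- J) (x i / l) `^ e i / e i <= (rboxs e J acc - acc) / l.
  by move=> /(H 0 (lexx _)); rewrite subr0.
elim: J acc e1 => [|j J IH] acc e1 acc0; first by rewrite big_nil/= subrr mul0r.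
rewrite big_cons/= => H.
have e1j := e1 j (mem_head _ _).
have {}e1 : {in J, forall i, 1 <= e i}.
  by move=> i iJ; apply: e1; rewrite in_cons iJ orbT.
have a0 := rbox_ge0 (e j) acc (x j).
have := IH _ e1 a0 H.
suff : (x j / l) `^ e j / e j <= (rbox (e j) acc (x j) - acc) / l.
  by rewrite !mulrBl; lra.
have il0 : 0 <= l^-1 by rewrite invr_ge0 ltW.
have := @powR_incr_le _ (acc / l) (rbox (e j) acc (x j) / l) (e j).
rewrite mulr_ge0// ler_wpM2r ?rbox_ge// => /(_ isT isT) {}IH.
(* Partial sums only grow, so all of them stay below [l], and [powR_incr_le] is applied within
   [0, 1]. *)
have H1 : rbox (e j) acc (x j) / l <= 1.
  rewrite ler_pdivrMr// mul1r (le_trans _ H)//.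
  exact: (rboxs_ge e1 a0).
move: (IH H1 e1j); rewrite !powRM// rbox_powR// -!mulrBl addrAC subrr add0r.
move=> {}IH; rewrite ler_pdivrMr; last lra.
by rewrite [leRHS]mulrC.
Qed.

(** A zero term leaves the iterated sum unchanged whatever its exponent, hence the alternative to
    [e i <= q]; it serves the pieces of measure zero. *)
Lemma boxsum_le_sum e J l q : {in J, forall i, 1 <= e i} ->
  {in J, forall i, x i = 0 \/ e i <= q} -> 0 < l -> 1 <= q ->
  \sum_(i <- J) (x i / l) `^ e i / e i <= 1 ->
  (boxsum [seq (e i, (x i)%:E) | i <- J] <= ((2 - q^-1) * l)%:E)%E.
Proof.
move=> e1 eq l0 q1 H; rewrite boxsum_EFin// lee_fin -ler_pdivrMr//.
apply: capped_powR_le1 => //; apply: le_trans H.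
suff H (acc : R) : 0 <= acc -> capped_powR q (rboxs e J acc / l) -
    capped_powR q (acc / l) <= \sum_(i <- J) (x i / l) `^ e i / e i.
  have := H 0 (lexx _); rewrite mul0r {2}/capped_powR ler01 powR0 ?ge1_neq0//.
  by rewrite mul0r subr0.
elim: J acc e1 eq => [|j J IH] acc e1 eq acc0; first by rewrite big_nil/= subrr.
rewrite big_cons/=.
have e1j := e1 j (mem_head _ _).
have eqj := eq j (mem_head _ _).
have {}e1 : {in J, forall i, 1 <= e i}.
  by move=> i iJ; apply: e1; rewrite in_cons iJ orbT.
have {}eq : {in J, forall i, x i = 0 \/ e i <= q}.
  by move=> i iJ; apply: eq; rewrite in_cons iJ orbT.
have a0 := rbox_ge0 (e j) acc (x j).
have := IH _ e1 eq a0.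
suff : capped_powR q (rbox (e j) acc (x j) / l) - capped_powR q (acc / l) <=
    (x j / l) `^ e j / e j by lra.
have il0 : 0 <= l^-1 by rewrite invr_ge0 ltW.
case: eqj => [->|ejq].
  by rewrite rboxx0// mul0r powR0 ?mul0r ?subrr// gt_eqF//; lra.
have := @capped_powR_incr _ (acc / l) (rbox (e j) acc (x j) / l) (e j) q.
rewrite mulr_ge0// ler_wpM2r ?rbox_ge// e1j ejq => /(_ isT isT isT isT).
by rewrite !powRM// rbox_powR// -!mulrBl addrAC subrr add0r.
Qed.

End boxsum_theory.

(** * Absolutely continuous functions *)

Section lebesgue_null_sets.
Context {R : realType}.

Lemma lebesgue_measurableP (A : set R) : measurable (A : set (lebesgueType R)) ->
  exists B N : set R, [/\ measurable B, measurable N, lebesgue_measure N = 0%E,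
    B `<=` A & A `<=` B `|` N].
Proof.
move=> mA; have := @completed_caratheodory_measurable R.
rewrite g_sigma_completed_algebra_genE => /seteqP[_ /(_ A mA)].
move=> [B mB [N [N' [mN' N'0 NN']]] BNA].
exists B, N'; split => //.
- by rewrite -BNA; exact: subsetUl.
- by rewrite -BNA; exact: setUS.
Qed.

(** Outer regularity concerns Borel sets, so the null set is first enclosed in a Borel null set. *)
Lemma negligible_open_cover (N : set R) (e : R) : (@leb R).-negligible N ->
  0 < e -> exists U : set R, [/\ open U, N `<=` U & (lebesgue_measure U < e%:E)%E].
Proof.
move=> [A [mA A0 NA]] e0.
have [B [N' [mB mN' N'0 BA ABN]]] := lebesgue_measurableP mA.
have mF : measurable (B `|` N' : set R) by exact: measurableU.
have F0 : lebesgue_measure (B `|` N' : set R) = 0%E.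
  have : (lebesgue_measure (B `|` N' : set R) <=
      lebesgue_measure B + lebesgue_measure N')%E by exact: measureU2.
  rewrite N'0 adde0 => H; apply/eqP; rewrite -measure_le0 (le_trans H)// -A0.
  exact: (@le_outer_measure R _ (wlength idfun)^*%mu).
have Foo : (lebesgue_measure (B `|` N' : set R) < +oo)%E by rewrite F0 ltry.
have [U [oU FU muU]] := @lebesgue_regularity_outer R _ _ mF Foo e0.
exists U; split => //.
  by apply: subset_trans NA _; apply: subset_trans ABN _.
rewrite -(setDKU FU).
have : (lebesgue_measure (U `\` (B `|` N') `|` (B `|` N') : set R) <=
    lebesgue_measure (U `\` (B `|` N')) + lebesgue_measure (B `|` N' : set R))%E.
  by apply: measureU2 => //; apply: measurableD => //; exact: open_measurable.
by rewrite F0 adde0 => /le_lt_trans; apply.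
Qed.

Lemma negligible_set1 (x : R) : (@leb R).-negligible [set x].
Proof.
exists [set x]; split => //.
  by apply: sub_caratheodory; exact: (@measurable_set1 R).
by rewrite -[LHS]/(lebesgue_measure [set x]) lebesgue_measure_set1.
Qed.

End lebesgue_null_sets.

Section absolute_continuity.
Context {R : realType}.
Implicit Types (h g phi : R -> R) (c d s t : R).

Lemma ac01_dominated phi h L : absolutely_continuous01 phi ->
  (forall s t, I01 s -> I01 t -> `|h s - h t| <= L * `|phi s - phi t|) ->
  absolutely_continuous01 h.
Proof.
move=> acphi hphi e e0.
have L0 : 0 < `|L| + 1 by rewrite ltr_wpDl.
have [d d0 Hd] := acphi (e / (`|L| + 1)) (divr_gt0 e0 L0).
exists d => // n u v uv tuv sd; have := Hd n u v uv tuv sd.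
rewrite ltr_pdivlMr// mulr_suml; apply: le_lt_trans.
apply: ler_sum => i _; have [u0 [uiv v1]] := uv i.
apply: le_trans (hphi _ _ _ _) _.
- by rewrite /I01/= in_itv/= v1 (le_trans u0).
- by rewrite /I01/= in_itv/= u0 (le_trans uiv).
rewrite mulrC ler_wpM2l// (le_trans (ler_norm _))// lerDl//.
Qed.

Lemma ac01D h g : absolutely_continuous01 h -> absolutely_continuous01 g ->
  absolutely_continuous01 (h \+ g).
Proof.
move=> ach acg e e0; have e20 : 0 < e / 2 by rewrite divr_gt0.
have [d1 d10 H1] := ach _ e20; have [d2 d20 H2] := acg _ e20.
exists (Num.min d1 d2); first by rewrite lt_min d10.
move=> n u v uv tuv; rewrite lt_min => /andP[s1 s2].
have := ltrD (H1 _ _ _ uv tuv s1) (H2 _ _ _ uv tuv s2).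
rewrite -splitr -big_split/=; apply: le_lt_trans.
apply: ler_sum => i _; apply: le_trans (ler_normD _ _).
by rewrite opprD addrACA.
Qed.

Lemma ac01Z k h : absolutely_continuous01 h ->
  absolutely_continuous01 (fun t => k * h t).
Proof.
move=> ach; apply: (@ac01_dominated h _ `|k|) => // s t _ _.
by rewrite -mulrBr normrM.
Qed.

Lemma ac01_cst k : absolutely_continuous01 (cst k : R -> R).
Proof.
move=> e e0; exists 1 => // n u v _ _ _.
by rewrite big1// => i _; rewrite subrr normr0.
Qed.

Lemma ac01B h g : absolutely_continuous01 h -> absolutely_continuous01 g ->
  absolutely_continuous01 (h \- g).
Proof.
move=> ach acg; have := ac01D ach (ac01Z (-1) acg).
by congr absolutely_continuous01; apply/funext => t/=; rewrite mulN1r.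
Qed.

Lemma ac01_sum (T : eqType) (J : seq T) (h : T -> R -> R) :
  {in J, forall i, absolutely_continuous01 (h i)} ->
  absolutely_continuous01 (fun t => \sum_(i <- J) h i t).
Proof.
elim: J => [_|j J IH H].
  have := ac01_cst 0; congr absolutely_continuous01; apply/funext => t.
  by rewrite big_nil.
have H1 : absolutely_continuous01 (h j) by apply: H; rewrite mem_head.
have H2 : absolutely_continuous01 (fun t => \sum_(i <- J) h i t).
  by apply: IH => i iJ; apply: H; rewrite in_cons iJ orbT.
have := ac01D H1 H2; congr absolutely_continuous01; apply/funext => t/=.
by rewrite big_cons.
Qed.

Lemma ac01_uniform h (e : R) : absolutely_continuous01 h -> 0 < e ->
  exists2 d, 0 < d & forall s t, I01 s -> I01 t -> `|s - t| < d ->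
    `|h s - h t| < e.
Proof.
move=> ach e0; have [d d0 Hd] := ach _ e0; exists d => // s t.
wlog st : s t / s <= t.
  move=> H s01 t01; case/orP: (le_total s t) => st; first exact: H.
  by rewrite (distrC s) (distrC (h s)); exact: H.
rewrite /I01/= !in_itv/= => /andP[s0 s1] /andP[t0 t1] dst.
have := Hd 1%N (fun=> s) (fun=> t); rewrite !big_ord1 [in X in _ -> X]distrC; apply.
- by move=> _; split.
- by move=> i j _ _ _; rewrite (ord1 i) (ord1 j).
- by rewrite distrC ger0_norm ?subr_ge0 in dst.
Qed.

(** Both sides of [t] are needed because a creeping step starts to the left of the point and ends to
    its right. *)
Lemma derive1_ge0_locally h t e : derivable h t 1 -> 0 <= derive1 h t -> 0 < e ->
  exists2 d, 0 < d & forall s, `|s - t| < d ->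
    (t <= s -> - (e * (s - t)) <= h s - h t) /\
    (s <= t -> - (e * (t - s)) <= h t - h s).
Proof.
move=> dh; rewrite derive1E /derive => Dh e0.
have /cvgrPdist_lt/(_ e e0) := dh.
rewrite near_withinE => /nbhs_ballP[d /= d0 Hd]; exists d => // s std.
have [->|sNt] := eqVneq s t; first by rewrite !subrr mulr0 oppr0.
have := Hd (s - t); rewrite /ball/= sub0r normrN => /(_ std).
rewrite subr_eq0 => /(_ sNt); rewrite /GRing.scale/= mulr1 subrK.
move: Dh; set D := lim _ => D0 H.
have {}H : - e < (s - t)^-1 * (h s - h t).
  by move: H; rewrite ltr_norml => /andP[_]; lra.
split=> [ts|st].
- have st0 : 0 < s - t by rewrite subr_gt0 lt_neqAle eq_sym sNt.
  have := ltW H; rewrite -(ler_pM2l st0) mulrA divff ?gt_eqF// mul1r; lra.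
- have st0 : 0 < t - s by rewrite subr_gt0 lt_neqAle sNt.
  have := ltW H; rewrite -(ler_pM2l st0) -(opprB t s) invrN mulNr !mulrN mulrA.
  by rewrite divff ?gt_eqF// mul1r; lra.
Qed.

(* Creeping along [c, d]: a point outside the small open set U moves forward
   because of the derivative, a point of U by charging the oscillation of h to
   an interval contained in U. *)
Section creeping.
Variables (h : R -> R) (c d e : R) (U : set R).
Hypotheses (cd : c <= d) (oU : open U) (e0 : 0 < e).
Hypothesis hU : forall t, c <= t <= d -> ~ U t ->
  derivable h t 1 /\ 0 <= derive1 h t.

(** The charged intervals are listed from left to right, so that order replaces disjointness, and
    they are given by functions on [nat], so that a new interval only changes the value at [n]. *)
Let reach t := exists n (u v : nat -> R),
  [/\ forall i, (i < n)%N -> [/\ c <= u i, u i <= v i, v i <= t &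
        `]u i, v i[ `<=` U],
      forall i j, (i < j < n)%N -> v i <= u j &
      - (e * (t - c)) - \sum_(i < n) `|h (v i) - h (u i)| <= h t - h c].

Let reach_start : reach c.
Proof.
by exists 0%N, (fun=> 0), (fun=> 0); split; rewrite // big_ord0 !subrr; lra.
Qed.

(** A whole neighbourhood of [t] is crossed at once: with [s] before and [s'] after the supremum of
    the reachable points, that supremum can only be [d]. *)
Let reach_step t : c <= t <= d -> exists2 r, 0 < r & forall s s',
  c <= s -> s <= t -> t <= s' -> t - s < r -> s' - t < r -> reach s -> reach s'.
Proof.
move=> tcd; have [Ut|/(hU tcd)[dh Dh]] := pselect (U t).
  have /nbhs_ballP[r /= r0 rU] : nbhs t U by exact: open_nbhs_nbhs.
  exists r => // s s' cs st ts' sr s'r [n [u [v [H1 H2 H3]]]].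
  exists n.+1, (fun i => if i == n then s else u i),
    (fun i => if i == n then s' else v i); split.
  - move=> i; rewrite ltnS leq_eqVlt => /predU1P[->|ni].
      rewrite eqxx; split=> //; first lra.
      move=> x/=; rewrite in_itv/= => /andP[sx xs']; apply: rU.
      by rewrite /ball/= ltr_norml; apply/andP; split; lra.
    rewrite (ltn_eqF ni); have [? ? ? ?] := H1 _ ni; split=> //; lra.
  - move=> i j; rewrite ltnS => /andP[ij]; rewrite leq_eqVlt => /predU1P[jE|jn].
      rewrite jE in ij *; rewrite eqxx (ltn_eqF ij); have [_ _ vs _] := H1 i ij.
      exact: vs.
    have ni : (i < n)%N by exact: ltn_trans jn.
    rewrite (ltn_eqF ni) (ltn_eqF jn); apply: H2; rewrite ij jn//.
  - rewrite big_ord_recr/= eqxx.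
    under eq_bigr => i _ do rewrite (ltn_eqF (ltn_ord i)).
    have : 0 <= e * (s' - s).
      by apply: mulr_ge0; [exact: ltW|rewrite subr_ge0 (le_trans st)].
    have := ler_norm (- (h s' - h s)); rewrite normrN.
    by move: H3; lra.
have [r r0 Hr] := derive1_ge0_locally dh Dh e0.
exists r => // s s' cs st ts' sr s'r [n [u [v [H1 H2 H3]]]].
exists n, u, v; split => //.
  by move=> i ni; have [? ? ? ?] := H1 _ ni; split => //; lra.
have [+ _] : _ := Hr s' ltac:(by rewrite ger0_norm; lra).
have [_ +] : _ := Hr s ltac:(by rewrite ler0_norm; lra).
by move=> /(_ st) + /(_ ts'); move: H3; lra.
Qed.

Let reach_end : reach d.
Proof.
pose S := [set t | c <= t <= d /\ reach t].
have Sc : S c by split=> //; rewrite lexx.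
have hS : has_sup S by split; [exists c|exists d => t [] /andP[]].
have cS : c <= sup S by apply: ub_le_sup => //; case: hS.
have Sd : sup S <= d by apply: ge_sup; [exists c|move=> t [] /andP[]].
have [r r0 Hr] := reach_step (introT andP (conj cS Sd)).
have [s [/andP[cs sd] rs] sS] := sup_adherent r0 hS.
have sS' : s <= sup S.
  by apply: ub_le_sup; [case: hS|split => //; rewrite cs].
pose s' := Num.min d (sup S + r / 2).
have Ss' : sup S <= s' by rewrite le_min Sd/=; lra.
have s'r : s' <= sup S + r / 2 by rewrite ge_min lexx orbT.
have rs' : reach s' by apply: (Hr s s') => //; lra.
have s'd : s' <= d by rewrite ge_min lexx.
have : s' <= sup S.
  apply: ub_le_sup; first by case: hS.
  by split => //; apply/andP; split => //; lra.
have [dS|Sd' s'S] := leP d (sup S + r / 2).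
  by move: rs'; rewrite /s' (min_idPl dS).
by exfalso; move: s'S; rewrite /s' (min_idPr (ltW Sd')); lra.
Qed.

Lemma creeping_bound : exists n (u v : nat -> R),
  [/\ forall i, (i < n)%N -> [/\ c <= u i, u i <= v i, v i <= d &
        `]u i, v i[ `<=` U],
      forall i j, (i < j < n)%N -> v i <= u j &
      - (e * (d - c)) - \sum_(i < n) `|h (v i) - h (u i)| <= h d - h c].
Proof. exact: reach_end. Qed.

End creeping.

Lemma disjoint_sum_lt (n : nat) (u v : nat -> R) (U : set R) (r : R) :
  (forall i, (i < n)%N -> u i <= v i /\ `]u i, v i[ `<=` U) ->
  trivIset [set: 'I_n] (fun i : 'I_n => `]u i, v i[%classic) ->
  open U -> (lebesgue_measure U < r%:E)%E ->
  \sum_(i < n) (v i - u i) < r.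
Proof.
move=> uv tuv oU Ur; rewrite -lte_fin; apply: le_lt_trans Ur.
rewrite -sumEFin.
have mI (k : 'I_n) : measurable (`]u k, v k[%classic : set R) by exact: measurable_itv.
have mU : measurable (\big[setU/set0]_(i < n) `]u i, v i[%classic : set R).
  exact: bigsetU_measurable.
rewrite (eq_bigr (fun i : 'I_n => lebesgue_measure (`]u i, v i[%classic : set R))).
  have := measure_semi_additive_ord (@lebesgue_measure R) mI tuv mU.
  move=> /= <-; apply: le_measure; rewrite ?inE//; first exact: open_measurable.
  apply: (big_ind (fun A => A `<=` U)) => // [A B AU BU|i _].
    by rewrite subUset.
  by have [] := uv i (ltn_ord i).
move=> i _; rewrite lebesgue_measure_itv/= lte_fin -EFinB.
have [uvi _] := uv i (ltn_ord i).
by case: ltP => // vu; rewrite (le_anti (introT andP (conj uvi vu))) subrr.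
Qed.

(** The exceptional null set lies in an open set of measure below the [r] that absolute continuity
    assigns to [e]. The oscillations charged to that set total less than [e], and elsewhere [h]
    falls by at most e (d - c). *)
Lemma ac01_derive_ge0 h c d : absolutely_continuous01 h ->
  0 <= c -> c <= d -> d <= 1 ->
  {ae @leb R, forall t, c < t < d -> derivable h t 1 /\ 0 <= derive1 h t} ->
  h c <= h d.
Proof.
move=> ach c0 cd d1 aeh; rewrite -subr_ge0.
suff H e : 0 < e -> - (e * 2) <= h d - h c.
  rewrite leNgt; apply/negP => hdc.
  by have := H ((h c - h d) / 4) ltac:(lra); lra.
move=> e0; have [r r0 Hr] := ach _ e0.
(* The end points join the exceptional set because creeping needs information on the closed
   interval. *)
have nN : (@leb R).-negligible
    (~` [set t | c < t < d -> derivable h t 1 /\ 0 <= derive1 h t] `|`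
     [set c] `|` [set d]).
  by apply: negligibleU; [apply: negligibleU => //|]; exact: negligible_set1.
have [U [oU NU muU]] := negligible_open_cover nN r0.
have hU t : c <= t <= d -> ~ U t -> derivable h t 1 /\ 0 <= derive1 h t.
  move=> /andP[ct td] Ut; apply: contrapT => Ht; apply: Ut; apply: NU.
  have [->|tc] := eqVneq t c; first by left; right.
  have [->|td'] := eqVneq t d; first by right.
  left; left => /= H; apply/Ht/H.
  by rewrite !lt_neqAle eq_sym tc ct td' td.
have [n [u [v [H1 H2 H3]]]] := creeping_bound cd oU e0 hU.
have tuv : trivIset [set: 'I_n] (fun i : 'I_n => `]u i, v i[%classic).
  apply/trivIsetP => i j _ _ ij.
  wlog ltij : i j ij / (i < j)%N.
    move=> W; have := ij; rewrite -val_eqE/= neq_ltn => /orP[|] ltij; first exact: W.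
    by rewrite setIC; apply: W => //; rewrite eq_sym.
  have vu : v i <= u j by apply: H2; rewrite ltij/=.
  apply/seteqP; split => // x [/=]; rewrite !in_itv/= => /andP[_ xv] /andP[ux _].
  by have := lt_trans (lt_le_trans xv vu) ux; rewrite ltxx.
have sumlt : \sum_(i < n) (v i - u i) < r.
  by apply: (disjoint_sum_lt _ tuv oU muU) => i /H1[].
have := Hr n (fun i => u i) (fun i => v i) _ tuv sumlt.
have uv01 (i : 'I_n) : 0 <= u i /\ u i <= v i /\ v i <= 1.
  by have [cu uv vd _] := H1 i (ltn_ord i); split; [|split] => //; lra.
move=> /(_ uv01) sume.
have : e * (d - c) <= e * 1 by rewrite ler_pM2l//; lra.
by lra.
Qed.

End absolute_continuity.

(** * Borel representatives of Lebesgue measurable functions *)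

Section borel_version.
Context {R : realType}.
Local Notation mu := (@lebesgue_measure R).
Local Notation Leb := (lebesgueType R).

Lemma measurable_leb (A : set R) : measurable A -> measurable (A : set Leb).
Proof. by move=> mA; apply: sub_caratheodory. Qed.

Lemma measurable_fun_leb d (T : measurableType d) (D : set R) (g : R -> T) :
  measurable D -> measurable_fun D g -> measurable_fun (D : set Leb) g.
Proof. by move=> mD mg _ B mB; apply: measurable_leb; exact: mg. Qed.

Lemma ae_leb (P : R -> Prop) :
  {ae mu, forall t, P t} -> {ae @leb R, forall t, P t}.
Proof.
by move=> [A [mA A0 PA]]; exists A; split => //; exact: measurable_leb.
Qed.

#[global] Instance ae_leb_filter : Filter (almost_everywhere (@leb R)) :=
  ae_filter_ringOfSetsType (@leb R).

Lemma ae_leb_neq (t : R) : {ae @leb R, forall s, s <> t}.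
Proof.
have [A [mA A0 tA]] := negligible_set1 t.
by exists A; split => // s /= /contrapT; exact: tA.
Qed.

(** The measure on Borel sets is the image of its completion under the identity. *)
Lemma integral_leb (D : set R) (f : R -> \bar R) : measurable D ->
  measurable_fun D f -> (forall t, 0 <= f t)%E ->
  (\int[@leb R]_(t in D) f t = \int[mu]_(t in D) f t)%E.
Proof.
move=> mD mf f0; have midl : measurable_fun [set: Leb] (idfun : Leb -> measurableTypeR R).
  by apply: measurable_fun_leb => //; exact: measurable_id.
have := @ge0_integral_pushforward _ _ Leb (measurableTypeR R) R idfun midl
  (@leb R) D f mD mf (fun t _ => f0 t).
by move=> <-.
Qed.

(** Each set {g > q}, q rational, is Borel up to a null set. The supremum of the functions q 1_B
    over its Borel parts B cannot exceed [g], and off the null sets no rational fits strictly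
    between the two. *)
Lemma borel_minorant (g : R -> R) : measurable_fun [set: Leb] g ->
  (forall t, 0 <= g t) ->
  exists k : R -> R, [/\ measurable_fun [set: R] k,
    forall t, 0 <= k t <= g t & {ae @leb R, forall t, k t = g t}].
Proof.
move=> mg g0.
(* Absolute values of the rationals, so that the functions q 1_B are nonnegative; codes that decode
   to nothing give 0. *)
pose q n : R := `|ratr (odflt 0 (@unpickle rat n))|.
pose A n : set R := g @^-1` `]q n, +oo[.
have mA n : measurable (A n : set Leb).
  by rewrite -[X in measurable X]setTI; apply: mg => //; exact: measurable_itv.
have /choice[BN BNP] : forall n, exists BN : set R * set R,
    [/\ measurable BN.1, measurable BN.2, mu BN.2 = 0%E, BN.1 `<=` A n &
      A n `<=` BN.1 `|` BN.2].
  by move=> n; have [B [N H]] := lebesgue_measurableP (mA n); exists (B, N).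
pose K n t : \bar R := (\1_(BN n).1 t * q n)%:E.
pose S t : \bar R := esups (K ^~ t) 0.
have mS : measurable_fun [set: R] S.
  apply: measurable_fun_esups => n; apply/measurable_EFinP.
  apply: measurable_funM => //; apply: measurable_indic.
  by have [] := BNP n.
have K0 n t : (0 <= K n t)%E by rewrite lee_fin mulr_ge0// /q.
have Kg n t : (K n t <= (g t)%:E)%E.
  rewrite lee_fin indicE; have [Bt|Bt] := boolP (t \in (BN n).1).
    have [_ _ _ BA _] := BNP n; rewrite mul1r.
    by have /BA := set_mem Bt; rewrite /A/= in_itv/= andbT => /ltW.
  by rewrite mul0r.
have SK n t : (K n t <= S t)%E by apply: ereal_sup_ubound; exists n.
have S0 t : (0 <= S t)%E by apply: le_trans (SK 0%N t).
have Sg t : (S t <= (g t)%:E)%E.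
  by apply: ge_ereal_sup => _ [n _ <-].
have Sfin t : (fine (S t))%:E = S t.
  by rewrite fineK// ge0_fin_numE// (le_lt_trans (Sg t))// ltry.
exists (fine \o S); split.
- by apply: measurableT_comp => //; exact: fine_measurable.
- by move=> t; rewrite -!lee_fin/= Sfin S0 Sg.
- have : {ae mu, forall t, forall n, ~ (BN n).2 t}.
    apply: ae_foralln => n; have [_ mN N0 _ _] := BNP n.
    by exists (BN n).2; split => // t /= /contrapT.
  move=> /ae_leb; apply: filterS => t Nt; apply/eqP.
  rewrite -eqe/= Sfin eq_le Sg/= leNgt; apply/negP => Slt.
  have Stg : fine (S t) < g t by rewrite -lte_fin Sfin.
  have [r] := rat_in_itvoo Stg; rewrite in_itv/= => /andP[Sr rg].
  have r0 : 0 <= (ratr r : R).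
    by apply: le_trans (ltW Sr); rewrite -lee_fin Sfin.
  have qr : q (pickle r) = ratr r by rewrite /q pickleK/= ger0_norm.
  have [_ _ _ _ AB] := BNP (pickle r).
  have : A (pickle r) t by rewrite /A/= in_itv/= andbT qr.
  move=> /AB[Bt|/(Nt (pickle r))//].
  have := SK (pickle r) t; rewrite /K indicE mem_set// mul1r qr.
  by rewrite leNgt -Sfin lte_fin Sr.
Qed.

End borel_version.

(** * Indefinite integrals *)

Lemma is_derive_derive1 {R : realType} (F : R -> R) (t a : R) :
  derivable F t 1 -> derive1 F t = a -> is_derive t 1 F a.
Proof. by move=> dF <-; apply: DeriveDef => //; rewrite derive1E. Qed.

(** Integration starts at -oo, the form in which the fundamental theorem is applied; wherever this
    is used for the equation, the integrand vanishes off [0, 1]. *)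
HB.lock Definition primitive {R : realType} (g : R -> R) (t : R) : R :=
  fine (\int[@leb R]_(s in (`]-oo, t]%classic : set (lebesgueType R))) (g s)%:E)%E.

Section indefinite_integral.
Context {R : realType}.
Local Notation mu := (@lebesgue_measure R).
Local Notation Leb := (lebesgueType R).

Let leD01 (u v : R) (k : R -> R) : measurable_fun [set: R] k ->
  (forall t, 0 <= k t) ->
  (\int[mu]_(t in `]-oo, v]) (k t)%:E < +oo)%E -> u <= v ->
  (\int[mu]_(t in `]-oo, v]) (k t)%:E =
   \int[mu]_(t in `]-oo, u]) (k t)%:E + \int[mu]_(t in `]u, v[) (k t)%:E)%E.
Proof.
move=> mk k0 koo uv.
have mk' (D : set R) : measurable_fun D (EFin \o k).
  by apply: measurable_funTS; exact/measurable_EFinP.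
have -> : `]-oo, v]%classic = `]-oo, u] `|` `]u, v] :> set R.
  by rewrite -itv_bndbnd_setU.
rewrite ge0_integral_setU//=; last 3 first.
- exact: mk'.
- by move=> *; rewrite lee_fin.
- apply/disj_setPRL => z/=; rewrite !in_itv/= => /andP[uz _] zu.
  by have := lt_le_trans uz zu; rewrite ltxx.
by rewrite -[X in (_ + X = _)%E](integral_itv_bndo_bndc (f := EFin \o k)).
Qed.

Section borel.
Variable k : R -> R.
Hypotheses (mk : measurable_fun [set: R] k) (k0 : forall t, 0 <= k t).
Hypothesis koo : (\int[mu]_t (k t)%:E < +oo)%E.
Let F t := fine (\int[mu]_(s in `]-oo, t]) (k s)%:E)%E.

Let mk' (D : set R) : measurable_fun D (EFin \o k).
Proof. by apply: measurable_funTS; exact/measurable_EFinP. Qed.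

Let kitv (D : set R) : measurable D -> (\int[mu]_(s in D) (k s)%:E < +oo)%E.
Proof.
move=> mD; apply: le_lt_trans koo; apply: ge0_subset_integral => //.
- exact: mk'.
- by move=> *; rewrite lee_fin.
Qed.

Let kfin (D : set R) : measurable D ->
  (fine (\int[mu]_(s in D) (k s)%:E))%:E = (\int[mu]_(s in D) (k s)%:E)%E.
Proof.
move=> mD; rewrite fineK// ge0_fin_numE ?kitv//.
by apply: integral_ge0 => *; rewrite lee_fin.
Qed.

Let FB u v : u <= v -> (F v - F u)%:E = (\int[mu]_(s in `]u, v[) (k s)%:E)%E.
Proof.
move=> uv; rewrite EFinB /F !kfin//.
rewrite (leD01 mk k0 _ uv); last by apply: kitv.
by rewrite addeAC subee ?add0e// -kfin.
Qed.

Lemma indefinite_borel_derive :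
  {ae mu, forall t, derivable F t 1 /\ derive1 F t = k t}.
Proof.
have ik : mu.-integrable [set: R] (EFin \o k).
  apply/integrableP; split; first exact: mk'.
  by under eq_integral => t _ do rewrite /= ger0_norm//.
apply: (@FTC1Ny R k).
- by move=> y; apply: integrableS ik.
- exact: open_integrable_locally openT ik.
Qed.

(** Truncation at height n: the excess over it has integral below e / 2, and the truncated part
    contributes at most n + 1 times the total length of the intervals. *)
Lemma indefinite_borel_ac : absolutely_continuous01 F.
Proof.
move=> e e0.
pose kn (n : nat) t := Num.min (k t) n%:R.
have kn0 n t : 0 <= kn n t by rewrite le_min k0/=.
have mkn n : measurable_fun [set: R] (kn n) by exact: measurable_minr.
have mkn' n (D : set R) : measurable_fun D (EFin \o kn n).
  by apply: measurable_funTS; exact/measurable_EFinP.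
have mkd n (D : set R) : measurable_fun D (fun t => (k t - kn n t)%:E).
  by apply: measurable_funTS; apply/measurable_EFinP; exact: measurable_funB.
have kd0 n t : 0 <= k t - kn n t by rewrite subr_ge0 ge_min lexx.
have cvg : (\int[mu]_t (kn n t)%:E @[n --> \oo] --> \int[mu]_t (k t)%:E)%E.
  have := @cvg_monotone_convergence _ (measurableTypeR R) R mu setT measurableT
    (fun n t => (kn n t)%:E).
  have -> : (fun x : R => lim ((kn n x)%:E @[n --> \oo])%E) = (EFin \o k).
    apply/funext => t/=; apply: cvg_lim => //; apply: cvg_near_cst.
    near=> n; congr EFin; rewrite /kn; apply: min_idPl.
    near: n; exact: nbhs_infty_ger.
  apply => //.
  - by move=> n; exact: mkn'.
  - by move=> n t _; rewrite lee_fin.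
  - by move=> t _ m n mn; rewrite lee_fin /kn le_min2// ler_nat.
have kE n : (\int[mu]_t (k t)%:E =
    \int[mu]_t (kn n t)%:E + \int[mu]_t (k t - kn n t)%:E)%E.
  rewrite -ge0_integralD//=; first by apply: eq_integral => t _; rewrite -EFinD subrKC.
  all: try by move=> *; rewrite lee_fin.
  - exact: mkn'.
  - exact: mkd.
have [n Hn] : exists n, (\int[mu]_t (k t - kn n t)%:E < (e / 2)%:E)%E.
  (* Otherwise the truncated integrals would all stay e / 2 below their finite limit. *)
  apply: contrapT => /forallNP H.
  have kf : (\int[mu]_t (k t)%:E)%E \is a fin_num by rewrite -kfin.
  have : ((\int[mu]_t (k t)%:E) <= (\int[mu]_t (k t)%:E) - (e / 2)%:E)%E.
    rewrite -{1}(cvg_lim _ cvg)//; apply: lime_le; first by apply/cvg_ex; eexists; exact: cvg.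
    apply: nearW => n; rewrite leeBrDr// (kE n) leeD2l//.
    by rewrite leNgt; apply/negP; exact: H.
  rewrite -(fineK kf) -EFinB lee_fin.
  by have : 0 < e / 2; [rewrite divr_gt0|lra].
(* The successor avoids a division by 0. *)
exists (e / 2 / n.+1%:R); first by rewrite !divr_gt0.
move=> m u v uv tuv sumlt.
rewrite -lte_fin -sumEFin.
pose I (i : 'I_m) := `]u i, v i[%classic : set R.
have mI i : (measurable (I i : set (measurableTypeR R))) by exact: measurable_itv.
have FE i : (`|F (v i) - F (u i)|%:E <=
    \int[mu]_(t in I i) (k t - kn n t)%:E + (n.+1%:R * (v i - u i))%:E)%E.
  have [_ [uvi _]] := uv i.
  have FB0 : 0 <= F (v i) - F (u i).
    by rewrite -lee_fin FB//; apply: integral_ge0 => *; rewrite lee_fin.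
  rewrite ger0_norm// FB//.
  have -> : (\int[mu]_(s in I i) (k s)%:E = \int[mu]_(s in I i) (k s - kn n s)%:E
     + \int[mu]_(s in I i) (kn n s)%:E)%E.
    rewrite -ge0_integralD//=; first by apply: eq_integral => t _; rewrite -EFinD subrK.
    all: try by move=> *; rewrite lee_fin.
    - exact: mkd.
    - exact: mkn'.
  rewrite leeD2l//.
  have : (\int[mu]_(s in I i) (kn n s)%:E <= \int[mu]_(s in I i) (cst n.+1%:R%:E s))%E.
    apply: ge0_le_integral => //.
    - by move=> *; rewrite lee_fin.
    - exact: mkn'.
    - by move=> t _; rewrite lee_fin /kn ge_min ler_nat leqnSn orbT.
  move=> /le_trans; apply; rewrite integral_cst; last exact: measurable_itv.
  have muI : mu (I i) = (v i - u i)%:E.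
    rewrite /I lebesgue_measure_itv/= lte_fin -EFinB.
    by case: ltP => // vu; rewrite (le_anti (introT andP (conj uvi vu))) subrr.
  by rewrite -[X in (_ * X <= _)%E]/(mu (I i)) muI.
apply: (@le_lt_trans _ _ (\sum_(i < m) (\int[mu]_(t in I i) (k t - kn n t)%:E +
    (n.+1%:R * (v i - u i))%:E))%E).
  by apply: lee_sum => i _.
rewrite big_split/= -ge0_integral_bigsetU//=; last 4 first.
- exact: index_enum_uniq.
- by apply: sub_trivIset tuv.
- exact: mkd.
- by move=> *; rewrite lee_fin.
rewrite sumEFin -mulr_sumr [in ltRHS](splitr e) EFinD lte_leD//.
- apply: le_lt_trans Hn; apply: ge0_subset_integral => //.
  + by apply: bigsetU_measurable => i _; exact: measurable_itv.
  + exact: mkd.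
  + by move=> *; rewrite lee_fin.
- by rewrite lee_fin mulrC -ler_pdivlMr// ltW.
Unshelve. all: by end_near. Qed.

End borel.

Variable g : R -> R.
Hypotheses (mg : measurable_fun [set: Leb] g) (g0 : forall t, 0 <= g t).
Hypothesis goo : (\int[@leb R]_(t in [set: Leb]) (g t)%:E < +oo)%E.

Let mgE (D : set R) : measurable_fun (D : set Leb) (EFin \o g).
Proof. by apply: measurable_funTS; exact/measurable_EFinP. Qed.

Lemma primitive_EFin t :
  (primitive g t)%:E = (\int[@leb R]_(s in (`]-oo, t]%classic : set Leb)) (g s)%:E)%E.
Proof.
rewrite primitive.unlock fineK// ge0_fin_numE; last first.
  by apply: integral_ge0 => *; rewrite lee_fin.
apply: le_lt_trans goo; apply: ge0_subset_integral => //.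
- by apply: measurable_leb; exact: measurable_itv.
- by move=> *; rewrite lee_fin.
Qed.

Lemma primitive_nondecreasing : {homo primitive g : s t / s <= t}.
Proof.
move=> s t st; rewrite -lee_fin !primitive_EFin.
apply: ge0_subset_integral.
- by apply: measurable_leb; exact: measurable_itv.
- by apply: measurable_leb; exact: measurable_itv.
- exact: mgE.
- by move=> *; rewrite lee_fin.
- by apply: subset_itvl; rewrite bnd_simp.
Qed.

Lemma primitive_eq0 t : (forall s, s < t -> g s = 0) -> primitive g t = 0.
Proof.
move=> gt0; rewrite primitive.unlock (_ : integral _ _ _ = 0%E)//.
have mD : measurable (`]-oo, t]%classic : set Leb).
  by apply: measurable_leb; exact: measurable_itv.
rewrite (ge0_ae_eq_integral (g := cst 0%E)) ?integral0//.
- by move=> *; rewrite lee_fin.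
- move: (ae_leb_neq t); apply: filterS => s st; rewrite /= in_itv/= => sle.
  by rewrite gt0// lt_neqAle sle andbT; apply/eqP.
Qed.

Let borelE : exists k : R -> R, [/\ measurable_fun [set: R] k,
   forall t, 0 <= k t, (\int[mu]_t (k t)%:E < +oo)%E,
   {ae @leb R, forall t, k t = g t} &
   primitive g = fun t => fine (\int[mu]_(s in `]-oo, t]) (k s)%:E)%E].
Proof.
have [k [mk kg aek]] := borel_minorant mg g0.
have k0 t : 0 <= k t by have /andP[] := kg t.
have mkE (D : set R) : measurable_fun D (EFin \o k).
  by apply: measurable_funTS; exact/measurable_EFinP.
have kE (D : set R) : measurable D ->
    (\int[@leb R]_(s in (D : set Leb)) (g s)%:E = \int[mu]_(s in D) (k s)%:E)%E.
  move=> mD; rewrite -(integral_leb mD (mkE D)); last by move=> t; rewrite lee_fin.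
  apply: ge0_ae_eq_integral.
  - exact: measurable_leb.
  - exact: mgE.
  - exact: measurable_fun_leb.
  - by move=> *; rewrite lee_fin.
  - by move=> *; rewrite lee_fin.
  - by move: aek; apply: filterS => t /= ->.
exists k; split => //; first by rewrite -kE.
by apply/funext => t; rewrite primitive.unlock kE.
Qed.

Lemma primitive_ac : absolutely_continuous01 (primitive g).
Proof.
have [k [mk k0 koo _ ->]] := borelE; exact: indefinite_borel_ac.
Qed.

Lemma primitive_derive : {ae @leb R, forall t,
  derivable (primitive g) t 1 /\ derive1 (primitive g) t = g t}.
Proof.
have [k [mk k0 koo kg ->]] := borelE.
have := ae_leb (indefinite_borel_derive mk k0 koo).
by move: kg; apply: filterS2 => t <-.
Qed.

End indefinite_integral.

(** * Comparison and existence for the differential equation *)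

Section barrier.
Context {R : realType}.
Implicit Types (h phi : R -> R) (s t : R).

Lemma in01 t : 0 <= t -> t <= 1 -> I01 t.
Proof. by move=> t0 t1; rewrite /I01/= in_itv/= t0. Qed.

(** After the last time at which h >= 0 the function is negative, hence nondecreasing by the
    hypothesis, so it cannot have fallen below 0. *)
Lemma ac01_barrier h : absolutely_continuous01 h -> 0 <= h 0 ->
  {ae @leb R, forall t, 0 < t < 1 -> h t < 0 ->
    derivable h t 1 /\ 0 <= derive1 h t} ->
  forall t, I01 t -> 0 <= h t.
Proof.
move=> ach h0 aeh t1; rewrite {1}/I01/= in_itv/= => /andP[t10 t11].
rewrite leNgt; apply/negP => ht1.
pose S := [set s | 0 <= s <= t1 /\ 0 <= h s].
have S0 : S 0 by split=> //; rewrite lexx.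
have hS : has_sup S by split; [exists 0|exists t1 => s [] /andP[]].
have cS : 0 <= sup S by apply: ub_le_sup => //; case: hS.
have Sd : sup S <= t1 by apply: ge_sup; [exists 0|move=> s [] /andP[]].
have hsup : 0 <= h (sup S).
  rewrite leNgt; apply/negP => hlt; have e0 : 0 < - h (sup S) by lra.
  have [r r0 Hr] := ac01_uniform ach e0.
  have [s [/andP[s0 st1] hs] sS] := sup_adherent r0 hS.
  have sS' : s <= sup S by apply: ub_le_sup; [case: hS|split => //; rewrite s0].
  have := Hr s (sup S) ltac:(apply: in01; lra) ltac:(apply: in01; lra).
  rewrite ler0_norm; last lra.
  move=> /(_ ltac:(lra)); rewrite ltr_norml => /andP[_]; lra.
have : h (sup S) <= h t1.
  apply: ac01_derive_ge0 => //.
  move: aeh; apply: filterS => t Ht /andP[St tt1]; apply: Ht.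
    by apply/andP; split; lra.
  rewrite ltNge; apply/negP => ht; have : t <= sup S.
    by apply: ub_le_sup; [case: hS|split => //; apply/andP; split; lra].
  lra.
lra.
Qed.

(** By the mean value theorem [G] is Lipschitz on the range of [phi]. *)
Lemma ac01_comp phi (G dG : R -> R) (m M L : R) : absolutely_continuous01 phi ->
  (forall t, I01 t -> m <= phi t <= M) ->
  (forall x, m <= x <= M -> is_derive x 1 G (dG x) /\ `|dG x| <= L) ->
  absolutely_continuous01 (G \o phi).
Proof.
move=> acphi phimM GL; apply: (@ac01_dominated _ phi _ L) => // s t s01 t01/=.
wlog st : s t s01 t01 / phi s <= phi t.
  move=> H; case/orP: (le_total (phi s) (phi t)) => st; first exact: H.
  by rewrite (distrC (phi s)) (distrC (G _)); exact: H.
have /andP[ms _] := phimM _ s01; have /andP[_ tM] := phimM _ t01.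
have H x : x \in `[phi s, phi t] -> is_derive x 1 G (dG x) /\ `|dG x| <= L.
  by rewrite in_itv/= => /andP[sx xt]; apply: GL; apply/andP; split; lra.
have [||c cst E] := @MVT_segment R G dG (phi s) (phi t) st.
- by move=> x xst; have [] := H x (subset_itv_oo_cc xst).
- apply: derivable_within_continuous => x xst.
  by have [D _] := H x xst; exact: ex_derive.
rewrite distrC E normrM (distrC (phi s)) ler_wpM2r//.
by have [] := H c cst.
Qed.

End barrier.

Section powR_negative_exponent.
Context {R : realType}.
Implicit Types u v p : R.

Lemma powR_anti u v p : 0 < u -> u <= v -> 1 <= p ->
  v `^ (1 - p) <= u `^ (1 - p).
Proof.
move=> u0 uv p1; have v0 : 0 < v by lra.
rewrite -(opprB p) !powRN lef_pV2 ?posrE ?powR_gt0//.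
by apply: ge0_ler_powR; rewrite ?nnegrE ?subr_ge0// ltW.
Qed.

(** The power (v / u)^(1 - p) is the exponential of (1 - p) ln(v / u), hence at least 1 + (1 - p)
    ln(v / u), and ln(v / u) <= v / u - 1. *)
Lemma powR_anti_lip u v p : 0 < u -> u <= v -> 1 <= p ->
  u `^ (1 - p) - v `^ (1 - p) <= (p - 1) * (u `^ (1 - p) * ((v - u) / u)).
Proof.
move=> u0 uv p1; have v0 : 0 < v by lra.
have vu0 : 0 < v / u by rewrite divr_gt0.
have -> : v `^ (1 - p) = u `^ (1 - p) * (v / u) `^ (1 - p).
  by rewrite -powRM ?(ltW u0) ?(ltW vu0)// mulrC divfK ?gt_eqF.
have ln_le : ln (v / u) <= (v - u) / u.
  have := expR_ge1Dx (ln (v / u)); rewrite lnK ?posrE//.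
  by rewrite mulrBl divff ?gt_eqF//; lra.
have H : 1 + (1 - p) * ln (v / u) <= (v / u) `^ (1 - p).
  by rewrite /powR gt_eqF// expR_ge1Dx.
have u1p : 0 <= u `^ (1 - p) by exact: powR_ge0.
rewrite mulrCA -{1}(mulr1 (u `^ _)) -mulrBr ler_wpM2l//.
have : (p - 1) * ln (v / u) <= (p - 1) * ((v - u) / u).
  by rewrite ler_wpM2l// subr_ge0.
by lra.
Qed.

End powR_negative_exponent.

(** * Comparison of solutions *)

Section ode_comparison.
Context {R : realType}.
Implicit Types (p f phi : R -> R) (x t : R).

(** The factor of the right-hand side that does not depend on y; taken at f / l it is also the
    integrand of the Nakano modular. *)
Definition ode_weight p f t : R := `|f t| `^ p t / p t.

Lemma ode_rhs_weight p f t y : 1 <= p t -> 0 < y ->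
  ode_rhs p f t y = (ode_weight p f t * y `^ (1 - p t))%:E.
Proof.
move=> p1 y0; rewrite /ode_rhs /ode_weight (gt_eqF y0)/=.
have [->|//] := eqVneq (f t) 0; rewrite normr0 powR0 ?ge1_neq0//.
by rewrite !mul0r.
Qed.

Lemma ode_weight_ge0 p f t : 1 <= p t -> 0 <= ode_weight p f t.
Proof. by move=> p1; rewrite divr_ge0 ?powR_ge0// (le_trans ler01). Qed.

Lemma ode_weight_eq0 p f t : 1 <= p t -> (ode_weight p f t == 0) = (f t == 0).
Proof.
move=> p1; rewrite /ode_weight mulf_eq0 invr_eq0 (negbTE (ge1_neq0 p1)) orbF.
by rewrite powR_eq0 normr_eq0 ge1_neq0// andbT.
Qed.

Lemma ode_solution_ge p f x phi : ode_solution p f x phi ->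
  forall t, I01 t -> x <= phi t <= phi 1.
Proof.
move=> [_ mphi <- _] t t01.
move: (t01); rewrite {1}/I01/= in_itv/= => /andP[t0 t1].
by apply/andP; split; apply: mphi => //; rewrite inE//; apply: in01.
Qed.

Lemma ode_solution_derive p f x phi : (forall t, I01 t -> 1 <= p t) ->
  0 < x -> ode_solution p f x phi ->
  {ae @leb R, forall t, 0 < t < 1 ->
    is_derive t 1 phi (ode_weight p f t * phi t `^ (1 - p t))}.
Proof.
move=> p1 x0 sol; have [_ _ _ aed] := sol.
move: aed; apply: filterS => t + t01 => /(_ t01)[dphi].
have t01' : I01 t by move: t01 => /andP[? ?]; apply: in01; lra.
have /andP[xphi _] := ode_solution_ge sol t01'.
rewrite ode_rhs_weight ?p1//; last lra.
by move=> [E]; apply: DeriveDef => //; rewrite -derive1E.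
Qed.

(** Where phi2 < phi1, the antitone factor y^(1 - p) is the larger one for phi2, so phi2 - phi1 has
    nonnegative derivative there and the barrier applies. For equal data this is uniqueness. *)
Lemma ode_solution_le p f1 f2 x1 x2 phi1 phi2 :
  (forall t, I01 t -> 1 <= p t) -> 0 < x1 -> x1 <= x2 ->
  ode_solution p f1 x1 phi1 -> ode_solution p f2 x2 phi2 ->
  (forall t, `|f1 t| <= `|f2 t|) -> forall t, I01 t -> phi1 t <= phi2 t.
Proof.
move=> p1 x10 x12 sol1 sol2 f12 t t01; rewrite -subr_ge0.
have [ac1 _ phi10 _] := sol1; have [ac2 _ phi20 _] := sol2.
apply: (@ac01_barrier R (phi2 \- phi1)) => //; first exact: ac01B.
  by rewrite /= phi10 phi20 subr_ge0.
have x20 : 0 < x2 by lra.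
have := ode_solution_derive p1 x10 sol1; have := ode_solution_derive p1 x20 sol2.
apply: filterS2 => {t01}s + + s01 => /(_ s01) D2 /(_ s01) D1 /=.
rewrite subr_lt0 => phi21.
have s01' : I01 s by move: s01 => /andP[? ?]; apply: in01; lra.
have D := is_deriveB D2 D1.
split; first exact: ex_derive.
rewrite derive1E; case: D => _ ->; rewrite subr_ge0.
have /andP[phi1s _] := ode_solution_ge sol1 s01'.
have /andP[phi2s _] := ode_solution_ge sol2 s01'.
have ps := p1 _ s01'.
apply: ler_pM; rewrite ?ode_weight_ge0 ?powR_ge0//.
  rewrite ler_wpM2r ?invr_ge0//; first lra.
  by rewrite ge0_ler_powR ?nnegrE//; lra.
by apply: powR_anti => //; lra.
Qed.

Lemma ode_solution_ae p f p' f' x phi :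
  {ae @leb R, forall t, 0 < t < 1 -> p t = p' t /\ f t = f' t} ->
  ode_solution p f x phi -> ode_solution p' f' x phi.
Proof.
move=> aeE [acp mphi phi0 aed]; split => //.
move: aeE aed; apply: filterS2 => t E + t01 => /(_ t01)[dphi Dphi].
by have [pE fE] := E t01; split => //; rewrite Dphi /ode_rhs pE fE.
Qed.

Lemma ae_sym01 p f p' f' :
  {ae @leb R, forall t, 0 < t < 1 -> p t = p' t /\ f t = f' t} ->
  {ae @leb R, forall t, 0 < t < 1 -> p' t = p t /\ f' t = f t}.
Proof. by apply: filterS => t + t01 => /(_ t01)[-> ->]. Qed.

Lemma is_ode_phi_ae p f p' f' phi :
  {ae @leb R, forall t, 0 < t < 1 -> p t = p' t /\ f t = f' t} ->
  is_ode_phi p f phi -> is_ode_phi p' f' phi.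
Proof.
move=> E [[Phi sol lim] sol0]; split; last exact: ode_solution_ae sol0.
exists Phi => // x x0; have [solx uni] := sol _ x0.
split; first exact: ode_solution_ae solx.
by move=> psi H; apply: uni; exact: (ode_solution_ae (ae_sym01 E)).
Qed.

End ode_comparison.

Section measurability.
Context {R : realType}.

Lemma measurable_powR2 d (T : measurableType d) (g e : T -> R) :
  measurable_fun [set: T] g -> measurable_fun [set: T] e ->
  measurable_fun [set: T] (fun t => g t `^ e t).
Proof.
move=> mg me; rewrite /powR; apply: measurable_fun_ifT.
- by apply: measurable_fun_eqr => //; exact: measurable_cst.
- have -> : (fun t => (e t == 0)%:R) = (fun t => if e t == 0 then 1 else 0) :> (T -> R).
    by apply/funext => t; case: eqP.
  apply: measurable_fun_ifT; [|exact: measurable_cst|exact: measurable_cst].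
  by apply: measurable_fun_eqr => //; exact: measurable_cst.
- apply: (measurableT_comp (@measurable_expR R)); apply: measurable_funM; first exact: me.
  exact: (measurableT_comp (@measurable_ln R)).
Qed.

Lemma measurable_invr d (T : measurableType d) (g : T -> R) :
  (forall t, 0 < g t) -> measurable_fun [set: T] g ->
  measurable_fun [set: T] (fun t => (g t)^-1).
Proof.
move=> g0 mg; have -> : (fun t => (g t)^-1) = (fun t => g t `^ (-1)).
  by apply/funext => t; rewrite powR_inv1// ltW.
apply: measurable_powR2; [exact: mg|exact: measurable_cst].
Qed.

End measurability.

Section antitone_square.
Context {R : realType} (adm : set (R -> R)) (T : (R -> R) -> R -> R) (x : R).
Hypothesis admP : forall psi, adm psi <->
  {homo psi : s t / s <= t >-> s <= t} /\ forall t, x <= psi t.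
Hypothesis admT : forall psi, adm psi -> adm (T psi).
Hypothesis antiT : forall psi1 psi2, adm psi1 -> adm psi2 ->
  (forall t, psi1 t <= psi2 t) -> forall t, T psi2 t <= T psi1 t.

(* Knaster-Tarski for the monotone map T \o T. *)
Lemma antitone_square_fixpoint : exists al be, [/\ adm al, adm be,
  T al = be, T be = al & forall t, be t <= al t].
Proof.
have adm_cst : adm (cst x) by apply/admP; split.
have adm_ge psi t : adm psi -> x <= psi t by move=> /admP[].
pose A := [set psi | adm psi /\ forall t, psi t <= T (T psi) t].
pose al t := sup [set psi t | psi in A].
have Ax : A (cst x).
  by split => // t; apply: adm_ge; do 2 apply: admT.
(* As [cst x] is the least admissible function, [T (cst x)] dominates the whole range of [T]. *)
have Aub t : has_ubound [set psi t | psi in A].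
  exists (T (cst x) t) => _ [psi [apsi psiT] <-].
  apply: le_trans (psiT t) _; apply: antiT => //; first exact: admT.
  by move=> s; apply: adm_ge; exact: admT.
have Ale psi t : A psi -> psi t <= al t.
  by move=> Apsi; apply: ub_le_sup => //; exists psi.
have alle t M : (forall psi, A psi -> psi t <= M) -> al t <= M.
  move=> H; apply: ge_sup; first by exists (cst x t), (cst x).
  by move=> _ [psi Apsi <-]; exact: H.
have aal : adm al.
  apply/admP; split=> [s t st|t]; last exact: (Ale (cst x)).
  apply: alle => psi Apsi; apply: le_trans (Ale psi t Apsi).
  by have [/admP[mpsi _] _] := Apsi; exact: mpsi.
have alT t : al t <= T (T al) t.
  apply: alle => psi Apsi; have [apsi psiT] := Apsi.
  apply: le_trans (psiT t) _; apply: antiT; [exact: admT|exact: admT|].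
  by apply: antiT => // s; exact: Ale.
have aTT : adm (T (T al)) by do 2 apply: admT.
have ATT : A (T (T al)).
  split => //; apply: antiT => //; [exact: admT|exact: admT|exact: antiT].
have TTal : T (T al) = al.
  by apply/funext => t; apply/le_anti; rewrite alT andbT; exact: Ale.
exists al, (T al); split => //; first exact: admT.
(* [T al] is fixed by the square as well, so it belongs to [A] and lies below the supremum. *)
by move=> t; apply: Ale; split; [exact: admT|rewrite TTal].
Qed.

End antitone_square.

HB.lock Definition ode_integrand {R : realType} (p f psi : R -> R) (t : R) : R :=
  ode_weight p f t * psi t `^ (1 - p t).

Lemma ode_integrandE {R : realType} (p f psi : R -> R) t :
  ode_integrand p f psi t = ode_weight p f t * psi t `^ (1 - p t).
Proof. by rewrite ode_integrand.unlock. Qed.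

(** * Solutions with positive starting value *)

Section ode_existence.
Context {R : realType}.
Local Notation Leb := (lebesgueType R).
Variables (p f : R -> R) (q : R).
Hypotheses (mp : measurable_fun [set: Leb] p) (mf : measurable_fun [set: Leb] f).
Hypotheses (p1 : forall t, 1 <= p t) (pq : forall t, p t <= q).
Hypothesis f01 : forall t, ~ I01 t -> f t = 0.

Let w := ode_weight p f.
Hypothesis woo : (\int[@leb R]_(t in [set: Leb]) (w t)%:E < +oo)%E.

Let w0 t : 0 <= w t. Proof. exact: ode_weight_ge0. Qed.

Lemma ode_weight_out t : ~ I01 t -> ode_weight p f t = 0.
Proof. by move=> t01; apply/eqP; rewrite ode_weight_eq0// f01. Qed.

Lemma measurable_ode_weight : measurable_fun [set: Leb] w.
Proof.
apply: (@measurable_funM _ Leb R setT (fun t => `|f t| `^ p t) (fun t => (p t)^-1)).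
  by apply: measurable_powR2; [exact: (measurableT_comp (@normr_measurable R setT) mf)|exact: mp].
by apply: measurable_invr; [move=> t; exact: lt_le_trans ltr01 (p1 t)|exact: mp].
Qed.
Let mw := measurable_ode_weight.

Section fixed_start.
Variable x : R.
Hypothesis x0 : 0 < x.

(** A base at most 1, so that 1 - p >= -q yields the bound m^(1 - p) <= m^(-q), uniform in t. *)
Let m := Num.min 1 x.
Let m0 : 0 < m. Proof. by rewrite lt_min ltr01. Qed.
Let m1 : m <= 1. Proof. by rewrite ge_min lexx. Qed.
Let mx : m <= x. Proof. by rewrite ge_min lexx orbT. Qed.

(* On functions bounded below by x this is antitone; its fixed points solve the
   equation. *)
Local Notation ode_integrand := (ode_integrand p f).
Definition ode_map psi t := x + primitive (ode_integrand psi) t.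

(** Monotonicity makes [psi] measurable and, unlike measurability, survives the arbitrary suprema of
    the fixed point argument; the lower bound keeps psi^(1 - p) bounded. *)
Definition admissible (psi : R -> R) :=
  {homo psi : s t / s <= t >-> s <= t} /\ forall t, x <= psi t.

Lemma ode_integrand_ge0 psi t : 0 <= ode_integrand psi t.
Proof. by rewrite ode_integrandE mulr_ge0 ?powR_ge0. Qed.

Let powR_le_m psi t : x <= psi t -> psi t `^ (1 - p t) <= m `^ (- q).
Proof.
move=> xpsi; apply: (@le_trans _ _ (m `^ (1 - p t))).
  by apply: powR_anti => //; exact: le_trans xpsi.
by apply: ger_powR; [rewrite m0|have := pq t; lra].
Qed.

Lemma measurable_ode_integrand psi : admissible psi ->
  measurable_fun [set: Leb] (ode_integrand psi).
Proof.
move=> [mpsi _]; rewrite ode_integrand.unlock; apply: measurable_funM; [exact: mw|apply: measurable_powR2].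
- apply: measurable_fun_leb; first exact: measurableT.
  apply: nondecreasing_measurable; first exact: measurableT.
  by move=> s t; exact: mpsi.
- by apply: measurable_funB; [exact: measurable_cst|exact: mp].
Qed.

Lemma ode_integrand_lty psi : admissible psi ->
  (\int[@leb R]_(t in [set: Leb]) (ode_integrand psi t)%:E < +oo)%E.
Proof.
move=> apsi; have [_ xpsi] := apsi.
apply: (@le_lt_trans _ _ (\int[@leb R]_(t in [set: Leb]) ((m `^ (- q))%:E * (w t)%:E))%E).
  apply: ge0_le_integral; first exact: measurableT.
  - by move=> t _; rewrite lee_fin ode_integrand_ge0.
  - by apply/measurable_EFinP; exact: measurable_ode_integrand.
  - by apply/measurable_EFinP; apply: measurable_funM; [exact: measurable_cst|exact: mw].
  - move=> t _; rewrite -EFinM lee_fin [leRHS]mulrC ode_integrandE.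
    by apply: ler_wpM2l; [exact: w0|exact: powR_le_m].
rewrite ge0_integralZl.
- by apply: lte_mul_pinfty => //; rewrite lee_fin powR_ge0.
- exact: measurableT.
- by apply/measurable_EFinP; exact: mw.
- by move=> t _; rewrite lee_fin w0.
- by rewrite lee_fin powR_ge0.
Qed.

Let prim psi : admissible psi -> forall t, (primitive (ode_integrand psi) t)%:E =
  (\int[@leb R]_(s in (`]-oo, t]%classic : set Leb)) (ode_integrand psi s)%:E)%E.
Proof.
move=> apsi t; apply: primitive_EFin.
- exact: measurable_ode_integrand.
- exact: ode_integrand_ge0.
- exact: ode_integrand_lty.
Qed.

Lemma ode_integrand_out psi t : ~ I01 t -> ode_integrand psi t = 0.
Proof. by move=> t01; rewrite ode_integrandE ode_weight_out// mul0r. Qed.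

Lemma ode_map_admissible psi : admissible psi -> admissible (ode_map psi).
Proof.
move=> apsi; split => [s t st|t].
  rewrite lerD2l; apply: primitive_nondecreasing st.
  - exact: measurable_ode_integrand.
  - exact: ode_integrand_ge0.
  - exact: ode_integrand_lty.
rewrite lerDl -lee_fin (prim apsi); apply: integral_ge0 => s _.
by rewrite lee_fin ode_integrand_ge0.
Qed.

Lemma ode_map_antitone psi1 psi2 : admissible psi1 -> admissible psi2 ->
  (forall t, psi1 t <= psi2 t) -> forall t, ode_map psi2 t <= ode_map psi1 t.
Proof.
move=> a1 a2 psi12 t; rewrite /ode_map lerD2l -lee_fin (prim a1) (prim a2).
apply: ge0_le_integral.
- by apply: measurable_leb; exact: measurable_itv.
- by move=> s _; rewrite lee_fin ode_integrand_ge0.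
- by apply: measurable_funTS; apply/measurable_EFinP; exact: measurable_ode_integrand.
- by apply: measurable_funTS; apply/measurable_EFinP; exact: measurable_ode_integrand.
move=> s _; rewrite lee_fin !ode_integrandE; apply: ler_wpM2l; first exact: w0.
have [_ /(_ s) x1] := a1; have [_ /(_ s) x2] := a2; have := psi12 s; have := p1 s.
by move=> ps x12; apply: powR_anti => //; exact: lt_le_trans x1.
Qed.

(** A Lipschitz constant of y^(1 - p t) on [x, +oo[, uniform in [t]. *)
Let L := q * (m `^ (- q) / x).

Let L0 : 0 <= L.
Proof.
by rewrite mulr_ge0 ?divr_ge0 ?powR_ge0 ?(ltW x0)//; have := p1 0; have := pq 0; lra.
Qed.

Let powR_lip u v t : x <= u -> u <= v ->
  u `^ (1 - p t) - v `^ (1 - p t) <= L * (v - u).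
Proof.
move=> xu uv; have u0 : 0 < u by exact: lt_le_trans xu.
apply: le_trans (powR_anti_lip u0 uv (p1 t)) _.
rewrite /L -mulrA; apply: ler_pM.
- by rewrite subr_ge0.
- by rewrite mulr_ge0 ?divr_ge0 ?powR_ge0 ?subr_ge0// ltW.
- by have := pq t; lra.
rewrite -mulrA; apply: ler_pM; rewrite ?powR_ge0 ?divr_ge0 ?subr_ge0 ?(ltW u0)//.
  exact: (powR_le_m (psi := cst u)).
by rewrite mulrC ler_wpM2r ?subr_ge0// lef_pV2.
Qed.

Let W := primitive w.

Lemma ode_map0 psi : admissible psi -> ode_map psi 0 = x.
Proof.
move=> apsi; rewrite /ode_map primitive_eq0 ?addr0//.
- exact: measurable_ode_integrand.
- exact: ode_integrand_ge0.
- by move=> s s0; apply: ode_integrand_out; rewrite /I01/= in_itv/= leNgt s0.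
Qed.

Lemma ode_map_ac psi : admissible psi -> absolutely_continuous01 (ode_map psi).
Proof.
move=> apsi; apply: (@ac01D _ (cst x)); first exact: ac01_cst.
apply: primitive_ac.
- exact: measurable_ode_integrand.
- exact: ode_integrand_ge0.
- exact: ode_integrand_lty.
Qed.

Lemma ode_map_derive psi : admissible psi -> {ae @leb R, forall t : R,
  is_derive t 1 (ode_map psi) (ode_integrand psi t)}.
Proof.
move=> apsi; have := primitive_derive (measurable_ode_integrand apsi)
  (ode_integrand_ge0 psi) (ode_integrand_lty apsi).
apply: filterS => t [D E].
have D1 : is_derive t 1 (primitive (ode_integrand psi)) (ode_integrand psi t).
  exact: is_derive_derive1.
have := is_deriveD (is_derive_cst x t 1) D1; rewrite add0r.
by congr is_derive; apply/funext.
Qed.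

(* Gronwall, in the form: ln(al - be + e) - L W is nonincreasing. *)
Lemma ode_map_fixpoint : exists2 al, admissible al & forall t, ode_map al t = al t.
Proof.
have [al [be [aal abe beE alE beal]]] := antitone_square_fixpoint
  (fun=> iff_refl _) ode_map_admissible ode_map_antitone.
have al0 : al 0 = x by rewrite -alE ode_map0.
have be0 : be 0 = x by rewrite -beE ode_map0.
have acal : absolutely_continuous01 al.
  by rewrite -alE; exact: ode_map_ac.
have acbe : absolutely_continuous01 be.
  by rewrite -beE; exact: ode_map_ac.
have Dal : {ae @leb R, forall t : R, is_derive t 1 al (ode_integrand be t)}.
  by have := ode_map_derive abe; rewrite alE.
have Dbe : {ae @leb R, forall t : R, is_derive t 1 be (ode_integrand al t)}.
  by have := ode_map_derive aal; rewrite beE.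
have W0 : W 0 = 0.
  by rewrite /W primitive_eq0// => s s0; rewrite /w ode_weight_out// /I01/= in_itv/= leNgt s0.
(* The other inequality is known, and equality on [0, 1] is enough because the weight vanishes
   elsewhere. *)
suff H t : I01 t -> al t <= be t.
  exists al; first exact: aal.
  suff E : ode_integrand al = ode_integrand be.
    by move=> t; rewrite -[in RHS]alE /ode_map E.
  apply/funext => s; rewrite !ode_integrandE.
  have [s01|s01] := pselect (I01 s); last by rewrite ode_weight_out// !mul0r.
  by have -> : al s = be s by apply/le_anti; rewrite (H s s01) beal.
move=> t01.
(* The difference vanishes at 0, so [e] is added to give it a logarithm. Below, [e] is chosen so
   that the right-hand side is half of a supposedly positive difference. *)
suff He (e : R) : 0 < e -> al t - be t + e <= e * expR (L * W t).
  rewrite -subr_le0 leNgt; apply/negP => d0.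
  have E0 : 0 < expR (L * W t) by exact: expR_gt0.
  have := He ((al t - be t) / (2 * expR (L * W t))) ltac:(rewrite divr_gt0//; lra).
  have -> : (al t - be t) / (2 * expR (L * W t)) * expR (L * W t) = (al t - be t) / 2.
    by field; rewrite gt_eqF.
  have : 0 < (al t - be t) / (2 * expR (L * W t)) by rewrite divr_gt0//; lra.
  by lra.
move=> e0.
pose d s := al s - be s + e.
have d0 s : 0 < d s by rewrite /d; have := beal s; lra.
pose h s := L * W s - ln (d s).
have acd : absolutely_continuous01 d.
  by apply: (ac01D (ac01B acal acbe)); exact: ac01_cst.
have ach : absolutely_continuous01 h.
  apply: ac01B; first by apply: ac01Z; exact: primitive_ac.
  apply: (ac01_comp (G := @ln R) (dG := fun y => y^-1) (m := e)
    (M := al 1 - x + e) (L := e^-1) acd).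
    move=> s; rewrite /I01/= in_itv/= => /andP[s0 s1]; rewrite /d.
    have := beal s; have [_ /(_ s)] := abe; have [/(_ _ _ s1) + _] := aal.
    by move=> *; apply/andP; split; lra.
  move=> y /andP[ey _]; have y0 : 0 < y by lra.
  split; first exact: is_derive1_ln.
  by rewrite ger0_norm ?invr_ge0 ?(ltW y0)// lef_pV2.
have Dh : {ae @leb R, forall s, 0 < s < t -> derivable h s 1 /\ 0 <= derive1 h s}.
  have := primitive_derive mw w0 woo.
  move: Dal Dbe; apply: filterS3 => s Da Db [DW EW] _.
  have D1 : is_derive s 1 d (ode_integrand be s - ode_integrand al s).
    rewrite -[X in is_derive _ _ _ X]addr0.
    exact: (is_deriveD (is_deriveB Da Db)).
  have Dln := is_derive1_ln (d0 s).
  have D2 := is_derive1_comp Dln D1.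
  have D3 : is_derive s 1 W (w s) by exact: is_derive_derive1.
  have D4 := is_deriveB (is_deriveZ L D3) D2.
  split; first exact: ex_derive.
  rewrite derive1E; case: D4 => _ ->; rewrite subr_ge0.
  have [_ /(_ s) xbe] := abe.
  have := powR_lip s xbe (beal s) => lip.
  rewrite ler_pdivrMl ?d0// !ode_integrandE -mulrBr.
  apply: (@le_trans _ _ (w s * (L * (al s - be s)))); first exact: ler_wpM2l.
  rewrite (_ : d s * _ = w s * (L * d s)); last by rewrite mulrC -mulrA mulrCA mulrA.
  apply: ler_wpM2l => //; apply: ler_wpM2l => //.
  by rewrite lerDl ltW.
have t01' := t01; rewrite /I01/= in_itv/= in t01'; move/andP : t01' => [t0 t1].
have := ac01_derive_ge0 ach (lexx 0) t0 t1 Dh.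
rewrite /h W0 mulr0 /d al0 be0 subrr !add0r => H.
rewrite -ler_ln ?posrE ?mulr_gt0 ?expR_gt0//; last exact: d0.
by rewrite lnM ?posrE ?expR_gt0// expRK; move: H; rewrite /d; lra.
Qed.

End fixed_start.

Lemma ode_solution_exists (x : R) : 0 < x -> exists phi : R -> R,
  [/\ ode_solution p f x phi, {homo phi : s t / s <= t >-> s <= t},
      forall t, x <= phi t,
      measurable_fun [set: Leb] (ode_integrand p f phi) &
      forall t, (phi t)%:E = (x%:E + \int[@leb R]_(s in (`]-oo, t]%classic : set Leb))
        (ode_integrand p f phi s)%:E)%E].
Proof.
move=> x0; have [al aal alE] := ode_map_fixpoint x0.
have alE' : ode_map x al = al by apply/funext.
have [mal xal] := aal.
exists al; split => //.
- split.
  + by rewrite -alE'; exact: ode_map_ac x0 _ aal.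
  + by move=> s t _ _; exact: mal.
  + by rewrite -alE' (ode_map0 aal).
  + have := ode_map_derive x0 aal; rewrite alE'.
    apply: filterS => t [D E] _; split => //.
    rewrite derive1E E ode_integrandE ode_rhs_weight//.
    exact: lt_le_trans (xal t).
- exact: measurable_ode_integrand aal.
- move=> t; rewrite -{1}alE' /ode_map EFinD; congr (_ + _)%E.
  apply: primitive_EFin.
  + exact: measurable_ode_integrand aal.
  + exact: ode_integrand_ge0.
  + exact: ode_integrand_lty aal.
Qed.

End ode_existence.

(** * The limit of the solutions as the starting value tends to 0 *)

Section ode_limit.
Context {R : realType}.
Local Notation Leb := (lebesgueType R).
Variables (p f : R -> R) (q : R).
Hypotheses (mp : measurable_fun [set: Leb] p) (mf : measurable_fun [set: Leb] f).
Hypotheses (p1 : forall t, 1 <= p t) (pq : forall t, p t <= q).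
Hypothesis f01 : forall t, ~ I01 t -> f t = 0.
Hypothesis woo : (\int[@leb R]_(t in [set: Leb]) (ode_weight p f t)%:E < +oo)%E.

(** Only l = 0 with f nonzero is delicate: for p > 1 the value +oo in [ode_rhs] is the limit of the
    right-hand sides, and for p = 1 nothing depends on y. *)
Lemma ode_rhs_cvg (y : nat -> R) (l s : R) : (forall n, 0 < y n) ->
  y n @[n --> \oo] --> l ->
  (ode_rhs p f s (y n) @[n --> \oo] --> ode_rhs p f s l)%E.
Proof.
move=> y0 yl; have l0 : 0 <= l.
  rewrite -(cvg_lim _ yl)//; apply: limr_ge; first by apply/cvg_ex; exists l.
  by apply: nearW => n; exact: ltW.
have yE n : ode_rhs p f s (y n) = (ode_weight p f s * y n `^ (1 - p s))%:E.
  exact: ode_rhs_weight.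
under eq_fun do rewrite yE.
have [fs|fs] := eqVneq (f s) 0.
  have w0 : ode_weight p f s = 0 by apply/eqP; rewrite ode_weight_eq0// fs.
  rewrite /ode_rhs fs eqxx; under eq_fun do rewrite w0 mul0r.
  exact: cvg_cst.
have w0 : 0 < ode_weight p f s.
  by rewrite lt_neqAle ode_weight_ge0// andbT eq_sym ode_weight_eq0.
have [lE|ln0] := eqVneq l 0; last first.
  have lgt0 : 0 < l by rewrite lt_neqAle eq_sym ln0.
  rewrite ode_rhs_weight//; apply: cvg_EFin; first by near=> n.
  have cont : {for l, continuous (fun x : R => x `^ (1 - p s))}.
    apply: differentiable_continuous.
    by apply/derivable1_diffP; have [] := is_derive1_powR (1 - p s) lgt0.
  by apply: cvgM; [exact: cvg_cst|exact: (cvg_comp _ _ yl cont)].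
rewrite lE /ode_rhs (negbTE fs) eqxx/=; case: ltP => ps.
  have ps0 : 0 < p s - 1 by rewrite subr_gt0.
  apply/cvgeyPge => A.
  have H : y n `^ (p s - 1) @[n --> \oo] --> 0.
    have /cvg_at_rightP := powR_cvg0 ps0; apply; split => //.
    by rewrite -lE.
  (* Once y^(p - 1) is below this bound, the right-hand side is at least max(A, 1). *)
  have A0 : 0 < ode_weight p f s / Num.max A 1.
    by rewrite divr_gt0// lt_max ltr01 orbT.
  move/cvgrPdist_le : H => /(_ _ A0); apply: filterS => n.
  rewrite sub0r normrN ger0_norm ?powR_ge0// => H.
  rewrite lee_fin -(opprB (p s)) powRN ler_pdivlMr ?powR_gt0//.
  have M0 : 0 < Num.max A 1 by rewrite lt_max ltr01 orbT.
  move: H; rewrite ler_pdivlMr// mulrC; apply: le_trans.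
  by rewrite ler_wpM2r ?powR_ge0// le_max lexx.
have ps1 : p s = 1 by apply/le_anti; rewrite ps p1.
rewrite ps1 subrr powRr0 mulr1 /ode_weight ps1.
by under eq_fun do rewrite powRr0 mulr1; exact: cvg_cst.
Unshelve. all: by end_near. Qed.

(** As x decreases, the integrands increase, so monotone convergence turns the integral equations
    into one for the infimum [phi0]. Its finiteness makes [E] integrable, hence finite almost
    everywhere even though [E] may be +oo where phi0 = 0; differentiating the integral gives the
    equation. *)
Lemma is_ode_phi_exists : exists phi, is_ode_phi p f phi.
Proof.
have p1' t : I01 t -> 1 <= p t by [].
have /choice[Phi PhiP] : forall x : R, exists phi : R -> R, 0 < x ->
  [/\ ode_solution p f x phi, {homo phi : s t / s <= t >-> s <= t},
      forall t, x <= phi t,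
      measurable_fun [set: Leb] (ode_integrand p f phi) &
      forall t, (phi t)%:E = (x%:E + \int[@leb R]_(s in (`]-oo, t]%classic : set Leb))
        (ode_integrand p f phi s)%:E)%E].
  move=> x; have [x0|] := ltP 0 x; last by exists (cst 0).
  by have [phi H] := ode_solution_exists mp mf p1 pq f01 woo x0; exists phi.
have Phi_le x y t : 0 < x -> x <= y -> I01 t -> Phi x t <= Phi y t.
  move=> x0 xy t01; have y0 : 0 < y by lra.
  have [solx _ _ _ _] := PhiP _ x0; have [soly _ _ _ _] := PhiP _ y0.
  exact: (ode_solution_le p1' x0 xy solx soly).
pose phi0 t := inf [set Phi x t | x in [set x | 0 < x]].
have lb0 t : lbound [set Phi x t | x in [set x | 0 < x]] 0.
  by move=> _ [x /= x0 <-]; have [_ _ /(_ t) xPhi _ _] := PhiP _ x0; lra.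
have hinf t : has_inf [set Phi x t | x in [set x | 0 < x]].
  by split; [exists (Phi 1 t), 1 => //=|exists 0; exact: lb0].
have phi0_ge0 t : 0 <= phi0 t.
  by apply: lb_le_inf; [case: (hinf t)|exact: lb0].
have phi0_le x t : 0 < x -> phi0 t <= Phi x t.
  by move=> x0; apply: ge_inf; [case: (hinf t)|exists x].
have Phi_cvg t : I01 t -> Phi x t @[x --> 0^'+] --> phi0 t.
  move=> t01; apply/cvgrPdist_lt => e e0.
  have [_ [x /= x0 <-] xe] := inf_adherent e0 (hinf t).
  near=> y; have y0 : 0 < y by near: y; exact: nbhs_right_gt.
  have yx : y <= x by near: y; exact: nbhs_right_le.
  have := Phi_le _ _ _ y0 yx t01; have := phi0_le _ t y0.
  rewrite -/(phi0 t) in xe.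
  by move=> H1 H2; rewrite distrC ger0_norm ?subr_ge0//; lra.
pose a n : R := n.+1%:R^-1.
have a0 n : 0 < a n by rewrite invr_gt0.
have acvg : a n @[n --> \oo] --> 0 by exact: cvg_harmonic.
have Phia_cvg t : I01 t -> Phi (a n) t @[n --> \oo] --> phi0 t.
  by move=> /Phi_cvg/cvg_at_rightP; apply; split.
have Phia0 n t : 0 < Phi (a n) t.
  by have [_ _ /(_ t) H _ _] := PhiP _ (a0 n); exact: lt_le_trans H.
pose g n s := (ode_integrand p f (Phi (a n)) s)%:E.
pose E s := ode_rhs p f s (phi0 s).
have g_rhs n s : g n s = ode_rhs p f s (Phi (a n) s).
  by rewrite ode_rhs_weight// /g ode_integrandE.
have E_out s : ~ I01 s -> E s = 0%E.
  by move=> s01; rewrite /E /ode_rhs f01// eqxx.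
have gE s : (g n s @[n --> \oo] --> E s)%E.
  have [s01|s01] := pselect (I01 s).
    by under eq_fun do rewrite g_rhs; apply: ode_rhs_cvg; last exact: Phia_cvg.
  rewrite E_out//; under eq_fun do rewrite g_rhs /ode_rhs f01// eqxx.
  exact: cvg_cst.
have g0 n s : (0 <= g n s)%E by rewrite lee_fin; exact: ode_integrand_ge0.
have mg n : measurable_fun [set: Leb] (g n).
  by apply/measurable_EFinP; have [] := PhiP _ (a0 n).
have ndg s : {homo g^~ s : n m / (n <= m)%N >-> (n <= m)%E}.
  move=> n m nm; have [s01|s01] := pselect (I01 s); last first.
    by rewrite !g_rhs /ode_rhs f01// eqxx.
  rewrite lee_fin !ode_integrandE; apply: ler_wpM2l; first exact: ode_weight_ge0.
  apply: powR_anti => //; apply: Phi_le => //.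
  by rewrite lef_pV2 ?posrE// ler_nat.
have limg s : limn (g^~ s) = E s by apply/cvg_lim => //; exact: gE.
have E0 s : (0 <= E s)%E.
  by rewrite -limg; apply: lime_ge; [apply/cvg_ex; eexists; exact: gE|exact: nearW].
have mE : measurable_fun [set: Leb] E.
  by apply: (@emeasurable_fun_cvg _ Leb R setT g E mg) => s _; exact: gE.
have phi0E t : I01 t ->
    ((phi0 t)%:E = \int[@leb R]_(s in (`]-oo, t]%classic : set Leb)) E s)%E.
  move=> t01; have mD : measurable (`]-oo, t]%classic : set Leb).
    by apply: measurable_leb; exact: measurable_itv.
  have := @cvg_monotone_convergence _ Leb R (@leb R) _ mD g
    (fun n => measurable_funTS (mg n)) (fun n s _ => g0 n s) (fun s _ => ndg s).
  have -> : (fun s : Leb => limn (g^~ s)) = E by apply/funext.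
  have -> : (fun n => \int[@leb R]_(s in (`]-oo, t]%classic : set Leb)) g n s)%E =
      (fun n => (Phi (a n) t - a n)%:E).
    apply/funext => n; have [_ _ _ _ /(_ t) H] := PhiP _ (a0 n).
    by rewrite EFinB H addeAC subee// add0e.
  move=> H; apply/esym; apply: (cvg_unique _ H) => //.
  apply: cvg_EFin; first by near=> n.
  by rewrite -[phi0 t]subr0; apply: cvgB; [exact: Phia_cvg|exact: acvg].
have ET : (\int[@leb R]_(s in [set: Leb]) E s = (phi0 1)%:E)%E.
  rewrite phi0E; last by apply: in01.
  rewrite [RHS]integral_mkcond; apply: eq_integral => s _.
  rewrite patchE; case: ifPn => // /negP s1; apply: E_out => s01; apply: s1.
  by rewrite inE/=; move: s01; rewrite /I01/= !in_itv/= => /andP[].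
have iE : (@leb R).-integrable [set: Leb] E.
  apply/integrableP; split => //.
  by under eq_integral do rewrite gee0_abs//; rewrite ET ltry.
have aeE : {ae @leb R, forall s, E s \is a fin_num}.
  by have := integrable_ae measurableT iE; apply: filterS => s; apply.
pose e s := fine (E s).
have e0 s : 0 <= e s by rewrite fine_ge0.
have me : measurable_fun [set: Leb] e.
  by apply: measurableT_comp mE; exact: fine_measurable.
have eE (D : set Leb) : measurable D ->
    (\int[@leb R]_(s in D) (e s)%:E = \int[@leb R]_(s in D) E s)%E.
  move=> mD; apply: ge0_ae_eq_integral; first exact: mD.
  - by apply: measurable_funTS; apply/measurable_EFinP; exact: me.
  - exact: measurable_funTS mE.
  - by move=> s _; rewrite lee_fin.
  - by move=> s _; exact: E0.
  - by move: aeE; apply: filterS => s fE _; rewrite fineK.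
have eoo : (\int[@leb R]_(s in [set: Leb]) (e s)%:E < +oo)%E.
  by rewrite eE// ET ltry.
have phiE t : I01 t -> primitive e t = phi0 t.
  move=> t01; apply: EFin_inj; rewrite primitive_EFin// phi0E// eE//.
  by apply: measurable_leb; exact: measurable_itv.
exists (primitive e); split.
  exists Phi => [x x0|t t01]; last by rewrite phiE//; exact: Phi_cvg.
  have [solx _ _ _ _] := PhiP _ x0; split => // psi solpsi t; rewrite inE => t01.
  by apply/le_anti; rewrite (ode_solution_le p1' x0 (lexx x) solpsi solx)//
    (ode_solution_le p1' x0 (lexx x) solx solpsi).
split.
- exact: primitive_ac.
- by move=> s t _ _; apply: primitive_nondecreasing.
- apply: primitive_eq0 => // s s0; rewrite /e E_out//.
  by rewrite /I01/= in_itv/= leNgt s0.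
- have := primitive_derive me e0 eoo; move: aeE.
  apply: filterS2 => t fE [D ->] t01; split => //.
  rewrite phiE; last by move/andP : t01 => [? ?]; apply: in01; lra.
  by rewrite /e fineK.
Unshelve. all: by end_near. Qed.

End ode_limit.

(** * Decompositions in the ODE norm *)

Section ode_decomposition.
Context {R : realType}.
Implicit Types (h phi : R -> R) (t l : R).

Lemma ae_leb_in (T : eqType) (J : seq T) (P : T -> R -> Prop) :
  {in J, forall i, {ae @leb R, forall t, P i t}} ->
  {ae @leb R, forall t, {in J, forall i, P i t}}.
Proof.
elim: J => [_|j J IH H]; first by apply: filterS filterT => t _ i.
have H1 := H j (mem_head _ _).
have H2 : {ae @leb R, forall t, {in J, forall i, P i t}}.
  by apply: IH => i iJ; apply: H; rewrite in_cons iJ orbT.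
by move: H1 H2; apply: filterS2 => t Pj PJ i; rewrite in_cons => /predU1P[->//|/PJ].
Qed.

Lemma ac01_ivt h (v : R) : absolutely_continuous01 h -> h 0 <= v -> v <= h 1 ->
  exists2 t, I01 t & h t = v.
Proof.
move=> ach h0v vh1.
have cont : {within `[0, 1], continuous h}.
  apply/subspace_continuousP => t t01; apply/cvgrPdist_lt => e e0.
  have [d d0 Hd] := ac01_uniform ach e0.
  rewrite near_withinE; apply/nbhs_ballP; exists d => //= s ts s01.
  exact: Hd.
have [|t t01 <-] := IVT (ler01 : (0 : R) <= 1) cont (v := v).
  by rewrite ge_min le_max h0v vh1 orbT.
by exists t.
Qed.

Lemma is_derive_powR_div phi t dphi l r : 0 < l -> 1 <= r -> 0 < phi t ->
  is_derive t 1 phi dphi ->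
  is_derive t 1 (fun s => (phi s / l) `^ r / r) ((phi t / l) `^ (r - 1) * (dphi / l)).
Proof.
move=> l0 r1 phi0 D.
have D1 : is_derive t 1 (fun s => phi s / l) (dphi / l).
  have := is_deriveZ l^-1 D; rewrite /GRing.scale/= (mulrC _ dphi).
  by congr is_derive; apply/funext => s /=; rewrite /GRing.scale/= mulrC.
have pos : 0 < phi t / l by rewrite divr_gt0.
have D2 := @is_derive1_comp _ (fun y => y `^ r) (fun s => phi s / l) t _ _
  (is_derive1_powR r pos) D1.
have := is_deriveZ r^-1 D2; rewrite /GRing.scale/= -mulrA mulKf ?ge1_neq0//.
by congr is_derive; apply/funext => s /=; rewrite /GRing.scale/= mulrC.
Qed.

Lemma ac01_powR_div phi x l r : absolutely_continuous01 phi -> 0 < x -> 0 < l ->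
  1 <= r -> (forall t, I01 t -> x <= phi t <= phi 1) ->
  absolutely_continuous01 (fun s => (phi s / l) `^ r / r).
Proof.
move=> acphi x0 l0 r1 xphi.
pose dG y := (y / l) `^ (r - 1) * (1 / l).
have E : (fun s => (phi s / l) `^ r / r) = (fun y => (y / l) `^ r / r) \o phi by [].
rewrite E; apply: (ac01_comp (dG := dG) (m := x) (M := phi 1)
  (L := (phi 1 / l) `^ (r - 1) * (1 / l)) acphi xphi) => y /andP[xy yM].
have y0 : 0 < y by lra.
split; first exact: (is_derive_powR_div l0 r1 y0 (is_derive_id y 1)).
have il0 : 0 <= 1 / l by rewrite divr_ge0// ltW.
rewrite /dG ger0_norm ?mulr_ge0 ?powR_ge0//.
apply: ler_wpM2r => //.
have phi10 : 0 <= phi 1 by lra.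
apply: ge0_ler_powR; rewrite ?nnegrE ?subr_ge0 ?divr_ge0 ?(ltW y0) ?(ltW l0)//.
by rewrite ler_pM2r// invr_gt0.
by rewrite invr_ge0 ltW.
Qed.

Variable T : eqType.
Variables (J : seq T) (D : T -> set R) (p f : R -> R).
Hypothesis uJ : uniq J.
Hypothesis p1 : forall t, I01 t -> 1 <= p t.
Hypothesis cover : forall t, I01 t -> exists2 j, j \in J & D j t.
Hypothesis disj : forall i j t, i \in J -> j \in J -> D i t -> D j t -> i = j.

Variables (x l : R) (phi : R -> R) (psi : T -> R -> R) (e : T -> R).
Hypotheses (x0 : 0 < x) (l0 : 0 < l).
Hypothesis sol : ode_solution p f x phi.
Hypothesis soli : forall i, ode_solution p (\1_(D i) \* f) x (psi i).
Hypothesis e1 : {in J, forall i, 1 <= e i}.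

Let S t := \sum_(i <- J) (psi i t / l) `^ e i / e i.

Let psi_ge i t : I01 t -> x <= psi i t <= psi i 1.
Proof. exact: ode_solution_ge (soli i) _. Qed.

Let phi_ge t : I01 t -> x <= phi t <= phi 1.
Proof. exact: ode_solution_ge sol _. Qed.

Let psi_le i t : I01 t -> psi i t <= phi t.
Proof.
apply: (ode_solution_le p1 x0 (lexx x) (soli i) sol) => s.
rewrite /= indicE; case: (s \in D i); rewrite ?mul1r// mul0r normr0//.
Qed.

Let acS : absolutely_continuous01 S.
Proof.
apply: ac01_sum => i iJ; have [aci _ _ _] := soli i.
by apply: (ac01_powR_div aci x0 l0); [exact: e1|exact: psi_ge].
Qed.

Let S0 : S 0 = \sum_(i <- J) (x / l) `^ e i / e i.
Proof. by apply: eq_bigr => i _; have [_ _ -> _] := soli i. Qed.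

(** Only the piece containing t moves: the weights of all others vanish at t. *)
Let Sderive : {ae @leb R, forall t, 0 < t < 1 -> exists2 j, j \in J & D j t /\
  is_derive t 1 S (ode_weight p f t / l *
    ((psi j t / l) `^ (e j - 1) * psi j t `^ (1 - p t)))}.
Proof.
have : {ae @leb R, forall t, {in J, forall i, 0 < t < 1 ->
    is_derive t 1 (psi i) (ode_weight p (\1_(D i) \* f) t * psi i t `^ (1 - p t))}}.
  by apply: ae_leb_in => i _; exact: (ode_solution_derive p1 x0 (soli i)).
apply: filterS => t Dt t01.
have t01' : I01 t by move/andP : t01 => [? ?]; apply: in01; lra.
have {}Dt i : i \in J -> is_derive t 1 (psi i)
    (ode_weight p (\1_(D i) \* f) t * psi i t `^ (1 - p t)).
  by move=> iJ; exact: Dt.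
have [j jJ Djt] := cover t01'; exists j => //; split => //.
have psi0 i : 0 < psi i t by have /andP[+ _] := psi_ge i t01'; exact: lt_le_trans.
pose dS i := (psi i t / l) `^ (e i - 1) *
  ((ode_weight p (\1_(D i) \* f) t * psi i t `^ (1 - p t)) / l).
have DS : is_derive t 1 S (\sum_(i <- J) dS i).
  have Di i : i \in J -> is_derive t 1 (fun s => (psi i s / l) `^ e i / e i) (dS i).
    by move=> iJ; apply: (is_derive_powR_div l0 (e1 iJ) (psi0 i)); exact: Dt.
  rewrite /S; elim: (J) Di => [|i K IH] Di.
    rewrite big_nil; have := is_derive_cst (0 : R) t (1 : R).
    by congr is_derive; apply/funext => s; rewrite big_nil.
  have := is_deriveD (Di i (mem_head _ _)) (IH (fun k kK => Di k (mem_behead (s := i :: K) kK))).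
  by rewrite big_cons; congr is_derive; apply/funext => s; rewrite big_cons.
have -> // : ode_weight p f t / l * ((psi j t / l) `^ (e j - 1) * psi j t `^ (1 - p t)) =
  \sum_(i <- J) dS i.
have pt1 := p1 t01'.
rewrite (bigD1_seq j)//= [X in _ = _ + X]big1_seq ?addr0; last first.
  move=> i /andP[ij iJ]; rewrite /dS (_ : ode_weight _ _ _ = 0) ?mul0r ?mulr0//.
  apply/eqP; rewrite ode_weight_eq0//= indicE memNset ?mul0r// => Dit.
  by move/eqP : ij; apply; exact: (disj iJ jJ Dit Djt).
have -> : ode_weight p f t = ode_weight p (\1_(D j) \* f) t.
  by rewrite /ode_weight/= indicE mem_set// mul1r.
by rewrite /dS; ring.
Qed.

Let phi_derive : {ae @leb R, forall t : R, 0 < t < 1 ->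
  is_derive t 1 (fun s => phi s / l) (ode_weight p f t / l * phi t `^ (1 - p t))}.
Proof.
have := ode_solution_derive p1 x0 sol; apply: filterS => t + t01 => /(_ t01) H.
have := is_deriveZ l^-1 H; rewrite /GRing.scale/= mulrA (mulrC l^-1).
by congr is_derive; apply/funext => s /=; rewrite /GRing.scale/= mulrC.
Qed.

Let ac_phi_div : absolutely_continuous01 (fun s => phi s / l).
Proof.
have [acphi _ _ _] := sol; have := ac01Z l^-1 acphi.
by congr absolutely_continuous01; apply/funext => s; rewrite mulrC.
Qed.

Let powR_scale y a : 0 < y -> y `^ a = l `^ a * (y / l) `^ a.
Proof.
move=> y0; rewrite -powRM ?divr_ge0 ?(ltW y0) ?(ltW l0)//.
by rewrite mulrC divfK ?gt_eqF.
Qed.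

(** With u = psi_j / l <= v = phi / l <= 1, the derivatives compare through u^(e_j - p) <= v^(e_j -
    p) <= v^(1 - p): first by p <= e_j, then by v <= 1 <= e_j. *)
Lemma ode_decomposition_lower :
  {in J, forall j, {ae @leb R, forall t, I01 t -> D j t -> p t <= e j}} ->
  phi 1 <= l ->
  S 1 <= 1 + \sum_(i <- J) (x / l) `^ e i / e i.
Proof.
move=> /ae_leb_in ple phi1.
have [_ _ phi00 _] := sol.
suff : phi 0 / l - S 0 <= phi 1 / l - S 1.
  rewrite S0 phi00; have : phi 1 / l <= 1 by rewrite ler_pdivrMr// mul1r.
  have xl0 : 0 < x / l by rewrite divr_gt0.
  by lra.
apply: (@ac01_derive_ge0 R ((fun s => phi s / l) \- S) 0 1); rewrite ?ler01//.
  exact: ac01B.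
move: phi_derive Sderive ple; apply: filterS3 => t Dphi DS ple t01.
have {}Dphi := Dphi t01; have {DS}[j jJ [Djt DS]] := DS t01.
have t01' : I01 t by move/andP : t01 => [? ?]; apply: in01; lra.
have {}ple := ple j jJ t01' Djt.
have DH := is_deriveB Dphi DS; split; first exact: ex_derive.
rewrite derive1E; case: DH => _ ->; rewrite -mulrBr.
apply: mulr_ge0; first by rewrite divr_ge0 ?ode_weight_ge0 ?p1// ltW.
have /andP[xpsi _] := psi_ge j t01'; have /andP[_ phit] := phi_ge t01'.
have psiphi := psi_le j t01'; have pt := p1 t01'.
have psi0 : 0 < psi j t by exact: lt_le_trans xpsi.
have phi0 : 0 < phi t by lra.
rewrite subr_ge0 (powR_scale _ phi0) (powR_scale _ psi0) mulrCA.
apply: ler_wpM2l; first exact: powR_ge0.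
have u0 : 0 < psi j t / l by rewrite divr_gt0.
have uv : psi j t / l <= phi t / l by rewrite ler_pM2r ?invr_gt0.
have v1 : phi t / l <= 1 by rewrite ler_pdivrMr// mul1r; lra.
rewrite -powRD ?(gt_eqF u0) ?implybT// addrA subrK.
apply: (@le_trans _ _ ((phi t / l) `^ (e j - p t))).
  by apply: ge0_ler_powR; rewrite ?nnegrE ?subr_ge0//; lra.
have v0 : 0 < phi t / l by lra.
by apply: ger_powR; [rewrite v0|have := e1 jJ; lra].
Qed.

(** With u = psi_j / l <= v = phi / l, e_j <= p gives u^(e_j - p) >= v^(e_j - p). While v <= 1 this
    is at least v^(q - p), which up to a common factor is the derivative of v^q / q; once v >= 1 it
    is at least v^(1 - p), which belongs to v itself. The term x / l in the hypothesis pays for the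
    starting value (x / l)^q / q. *)
Lemma ode_decomposition_upper (q : R) :
  {in J, forall j, {ae @leb R, forall t, I01 t -> D j t -> e j <= p t <= q}} ->
  1 <= q -> S 1 + x / l <= 1 -> phi 1 <= (2 - q^-1) * l.
Proof.
move=> /ae_leb_in ple q1 S1.
have q0 : 0 < q by lra.
have qV : q^-1 <= 1 by rewrite invf_le1.
have xl0 : 0 < x / l by rewrite divr_gt0.
have [acphi mphi phi00 _] := sol.
have S_ge0 t : 0 <= S t.
  by rewrite /S big_seq; apply: sumr_ge0 => i iJ; rewrite divr_ge0 ?powR_ge0// (le_trans _ (e1 iJ)).
rewrite -ler_pdivrMr//; have [phi1l|lphi1] := leP (phi 1) l.
  have : phi 1 / l <= 1 by rewrite ler_pdivrMr// mul1r.
  lra.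
have phi0l : phi 0 <= l.
  have : x / l <= 1 by have := S_ge0 1; lra.
  by rewrite phi00 ler_pdivrMr// mul1r.
(* A time at which [phi] takes the value [l]; it separates the two branches of the
   antiderivative. *)
have [t0 t001 phit0] := ac01_ivt acphi phi0l (ltW lphi1).
have /andP[t00 t01] : 0 <= t0 <= 1 by move: t001; rewrite /I01/= in_itv/=.
have Hcmp (u v r pt : R) : 0 < u -> u <= v -> 1 <= r -> r <= pt ->
    v `^ (r - pt) <= u `^ (r - pt).
  move=> u0 uv _ rpt; rewrite -(opprB pt) !powRN lef_pV2 ?posrE ?powR_gt0//; last lra.
  by apply: ge0_ler_powR; rewrite ?nnegrE ?subr_ge0//; lra.
have Hge t : I01 t -> {in J, forall j, D j t -> e j <= p t ->
    let u := psi j t / l in let v := phi t / l in [/\ 0 < u, u <= v &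
    (psi j t / l) `^ (e j - 1) * psi j t `^ (1 - p t) = l `^ (1 - p t) * u `^ (e j - p t)]}.
  move=> t01' j jJ Djt ejp /=.
  have /andP[xpsi _] := psi_ge j t01'; have psiphi := psi_le j t01'.
  have psi0 : 0 < psi j t by exact: lt_le_trans xpsi.
  have u0 : 0 < psi j t / l by rewrite divr_gt0.
  split => //; first by rewrite ler_pM2r ?invr_gt0.
  by rewrite (powR_scale _ psi0) mulrCA -powRD ?(gt_eqF u0) ?implybT// addrA subrK.
have step1 : S 0 - (phi 0 / l) `^ q / q <= S t0 - (phi t0 / l) `^ q / q.
  apply: (@ac01_derive_ge0 R (S \- (fun s => (phi s / l) `^ q / q)) 0 t0) => //.
    by apply: ac01B => //; apply: (ac01_powR_div acphi x0 l0 q1 phi_ge).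
  have Dphi := ode_solution_derive p1 x0 sol.
  move: Dphi Sderive ple; apply: filterS3 => t Dphi DS ple /andP[t_gt0 tt0].
  have t01'' : 0 < t < 1 by apply/andP; split; lra.
  have t01' : I01 t by apply: in01; lra.
  have {}Dphi := Dphi t01''; have {DS}[j jJ [Djt DS]] := DS t01''.
  have /andP[ejp pq] := ple j jJ t01' Djt.
  have [u0 uv E] := Hge t t01' j jJ Djt ejp.
  have /andP[xphi _] := phi_ge t01'; have phi0 : 0 < phi t by exact: lt_le_trans xphi.
  have DH := is_deriveB DS (is_derive_powR_div l0 q1 phi0 Dphi).
  split; first exact: ex_derive.
  rewrite derive1E; case: DH => _ ->.
  rewrite E (powR_scale _ phi0).
  set W := ode_weight p f t; set v := phi t / l; set u := psi j t / l.
  have v0 : 0 < v by rewrite divr_gt0.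
  have -> : v `^ (q - 1) * (W * (l `^ (1 - p t) * v `^ (1 - p t)) / l) =
      W / l * (l `^ (1 - p t) * v `^ (q - p t)).
    have -> : v `^ (q - p t) = v `^ (q - 1) * v `^ (1 - p t).
      by rewrite -powRD ?(gt_eqF v0) ?implybT// addrA subrK.
    by ring.
  rewrite -!mulrBr; apply: mulr_ge0.
    by rewrite divr_ge0 ?ode_weight_ge0 ?p1// ltW.
  apply: mulr_ge0; first exact: powR_ge0.
  rewrite subr_ge0; apply: (@le_trans _ _ (v `^ (e j - p t))); last first.
    by apply: Hcmp => //; exact: e1.
  have v1 : v <= 1.
    rewrite ler_pdivrMr// mul1r -phit0; apply: mphi; rewrite ?inE//; lra.
  by apply: ger_powR; [rewrite v0|lra].
have step2 : S t0 - phi t0 / l <= S 1 - phi 1 / l.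
  apply: (@ac01_derive_ge0 R (S \- (fun s => phi s / l)) t0 1) => //.
    exact: ac01B.
  move: phi_derive Sderive ple; apply: filterS3 => t Dphi DS ple /andP[t_gt0 tt0].
  have t01'' : 0 < t < 1 by apply/andP; split; lra.
  have t01' : I01 t by apply: in01; lra.
  have {}Dphi := Dphi t01''; have {DS}[j jJ [Djt DS]] := DS t01''.
  have /andP[ejp pq] := ple j jJ t01' Djt.
  have [u0 uv E] := Hge t t01' j jJ Djt ejp.
  have /andP[xphi _] := phi_ge t01'; have phi0 : 0 < phi t by exact: lt_le_trans xphi.
  have DH := is_deriveB DS Dphi.
  split; first exact: ex_derive.
  rewrite derive1E; case: DH => _ ->.
  rewrite E (powR_scale _ phi0) -!mulrBr; apply: mulr_ge0.
    by rewrite divr_ge0 ?ode_weight_ge0 ?p1// ltW.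
  apply: mulr_ge0; first exact: powR_ge0.
  have v1 : 1 <= phi t / l.
    rewrite ler_pdivlMr// mul1r -phit0; apply: mphi; rewrite ?inE//; lra.
  rewrite subr_ge0; apply: (@le_trans _ _ ((phi t / l) `^ (e j - p t))); last first.
    by apply: Hcmp => //; exact: e1.
  by apply: ler_powR => //; have := e1 jJ; lra.
have xq : (x / l) `^ q / q <= x / l.
  have xl1 : x / l <= 1 by have := S_ge0 1; lra.
  rewrite ler_pdivrMr//; apply: (@le_trans _ _ (x / l)).
    by apply: ge1r_powR => //; rewrite xl0.
  by rewrite ler_peMr// ltW.
move: step1 step2; rewrite phit0 phi00 divff ?gt_eqF// powR1 mul1r.
by have := S_ge0 0; lra.
Qed.

End ode_decomposition.

(** * Integrability as a criterion for membership in L_ODE *)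

Section L_ode_characterization.
Context {R : realType}.
Local Notation Leb := (lebesgueType R).
Local Notation mI01 := (@lebesgue_measurable_I01 R).
Variables (p : R -> R) (q : R).
Hypotheses (q1 : 1 <= q) (p1 : forall t, I01 t -> 1 <= p t).
Hypothesis mp : measurable_fun (I01 : set Leb) p.
Hypothesis pq : {ae @leb R, forall t, I01 t -> p t <= q}.

Let mrestr (f : R -> R) : measurable_fun (I01 : set Leb) f ->
  measurable_fun [set: Leb] (f \_ I01).
Proof. by have [H _] := measurable_restrictT (f : Leb -> R) mI01. Qed.

(** Existence was shown for exponents between 1 and q at every point of the line, whereas [p] is
    bounded only almost everywhere on [0, 1]; clamping provides such an exponent. *)
Let pn t := Num.max 1 (Num.min q ((p \_ I01) t)).

Let mpn : measurable_fun [set: Leb] pn.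
Proof.
apply: measurable_maxr; first exact: measurable_cst.
apply: measurable_minr; first exact: measurable_cst.
exact: mrestr.
Qed.

Let pn1 t : 1 <= pn t. Proof. by rewrite le_max lexx. Qed.

Let pnq t : pn t <= q. Proof. by rewrite ge_max q1 ge_min lexx. Qed.

Let pnE t : I01 t -> p t <= q -> pn t = p t.
Proof.
move=> t01 ptq; rewrite /pn patchE mem_set// (min_idPr ptq).
exact/max_idPr/p1.
Qed.

Lemma leb_I01 : leb (I01 : set R) = 1%E.
Proof.
rewrite -[LHS]/(lebesgue_measure `[0%R, 1%R]%classic) lebesgue_measure_itv/=.
by rewrite lte_fin ltr01 oppr0 adde0.
Qed.

Lemma aeI01 (P : R -> Prop) : {ae @leb R, forall t, I01 t -> P t} ->
  {ae @leb R, forall t, 0 < t < 1 -> P t}.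
Proof.
apply: filterS => t H /andP[t0 t1]; apply: H; apply: in01; exact: ltW.
Qed.

Let aepf (f : R -> R) : {ae @leb R, forall t, I01 t -> pn t = p t /\ (f \_ I01) t = f t}.
Proof.
move: pq; apply: filterS => t H t01; split; first by apply: pnE => //; exact: H.
by rewrite patchE mem_set.
Qed.

(* Unlike [pn], this exponent agrees with [p] everywhere on [0, 1]. *)
Let p' t := Num.max 1 ((p \_ I01) t).

Lemma measurable_ode_weight01 (f : R -> R) : measurable_fun (I01 : set Leb) f ->
  measurable_fun (I01 : set Leb) (ode_weight p f).
Proof.
move=> mf; apply: (@eq_measurable_fun _ _ Leb R _ (ode_weight p' (f \_ I01))).
  move=> t; rewrite inE => t01; rewrite /ode_weight /p' !patchE mem_set//.
  by rewrite (max_idPr (p1 t01)).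
apply: measurable_funTS; apply: measurable_ode_weight.
- apply: measurable_maxr; first exact: measurable_cst.
  exact: mrestr.
- exact: mrestr.
- by move=> t; rewrite le_max lexx.
Qed.

Let weight_normalized (f : R -> R) : measurable_fun (I01 : set Leb) f ->
  (\int[@leb R]_(t in [set: Leb]) (ode_weight pn (f \_ I01) t)%:E =
   \int[@leb R]_(t in (I01 : set Leb)) (ode_weight p f t)%:E)%E.
Proof.
move=> mf; transitivity
  (\int[@leb R]_(t in (I01 : set Leb)) (ode_weight pn (f \_ I01) t)%:E)%E.
  rewrite [RHS]integral_mkcond; apply: eq_integral => t _.
  rewrite [in RHS]patchE; case: ifPn => // /negP t01.
  rewrite (_ : ode_weight _ _ _ = 0)//; apply/eqP; rewrite ode_weight_eq0//.
  by rewrite patchE memNset// => H; apply: t01; rewrite inE.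
apply: ge0_ae_eq_integral.
- exact: mI01.
- apply: measurable_funTS; apply/measurable_EFinP; apply: measurable_ode_weight.
  + exact: mpn.
  + exact: mrestr.
  + exact: pn1.
- by apply/measurable_EFinP; exact: measurable_ode_weight01.
- by move=> t _; rewrite lee_fin ode_weight_ge0.
- by move=> t t01; rewrite lee_fin ode_weight_ge0// p1.
- move: (aepf f); apply: filterS => t + t01 => /(_ t01)[pE fE].
  by rewrite /ode_weight pE fE.
Qed.

Lemma integrable_L_ode (f : R -> R) : measurable_fun (I01 : set Leb) f ->
  (\int[@leb R]_(t in (I01 : set Leb)) (ode_weight p f t)%:E < +oo)%E ->
  exists phi, is_ode_phi p f phi.
Proof.
move=> mf woo.
have f01 t : ~ I01 t -> (f \_ I01) t = 0 by move=> t01; rewrite patchE memNset.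
have woo' := woo; rewrite -weight_normalized// in woo'.
have [phi H] := @is_ode_phi_exists R pn (f \_ I01) q mpn (mrestr mf) pn1 pnq f01 woo'.
by exists phi; apply: (is_ode_phi_ae _ H); apply: aeI01; exact: aepf.
Qed.

(** The solution started at 1 has values between 1 and phi(1), so its derivative is at least
    phi(1)^(1 - q) times the weight; hence the integral of the weight is controlled by phi(1). *)
Lemma L_ode_integrable f : L_ode p f ->
  (\int[@leb R]_(t in (I01 : set Leb)) (ode_weight p f t)%:E < +oo)%E.
Proof.
move=> [mf [phi0 [[Phi sol _] _]]].
have [[acphi mphi phi00 _] _] := sol 1 ltr01; have [sol1 _] := sol 1 ltr01.
set phi := Phi 1 in acphi mphi phi00 sol1.
pose c := phi 1 `^ (1 - q).
have phi11 : 1 <= phi 1 by have /andP[] := ode_solution_ge sol1 (in01 ler01 (lexx 1)).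
have c0 : 0 < c by apply: powR_gt0; exact: lt_le_trans phi11.
rewrite -weight_normalized//.
set w := ode_weight pn (f \_ I01).
have w0 t : 0 <= w t by exact: ode_weight_ge0.
have mw : measurable_fun [set: Leb] w by apply: measurable_ode_weight => //; exact: mrestr.
have w_out t : ~ I01 t -> w t = 0.
  by move=> t01; apply/eqP; rewrite ode_weight_eq0// patchE memNset.
(* Primitives are at hand only for integrable functions, which is what has to be shown for [w];
   hence a bound for truncations that is uniform in [n]. *)
pose wn (n : nat) t := Num.min (w t) n%:R.
have wn0 n t : 0 <= wn n t by rewrite le_min w0/=.
have mwn n : measurable_fun [set: Leb] (wn n).
  by apply: measurable_minr => //; exact: measurable_cst.
have wn_out n t : ~ I01 t -> wn n t = 0.
  by move=> t01; rewrite /wn w_out// min_l.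
have wnT n (t : R) : (1 <= t) -> (\int[@leb R]_(s in [set: Leb]) (wn n s)%:E =
   \int[@leb R]_(s in (`]-oo, t]%classic : set Leb)) (wn n s)%:E)%E.
  move=> t1; rewrite [RHS]integral_mkcond; apply: eq_integral => s _.
  rewrite [in RHS]patchE; case: ifPn => // /negP st.
  rewrite wn_out// /I01/= in_itv/= => /andP[_ s1]; apply: st.
  by rewrite inE/= in_itv/=; exact: le_trans t1.
have wnoo n : (\int[@leb R]_(s in [set: Leb]) (wn n s)%:E < +oo)%E.
  have -> : (\int[@leb R]_(s in [set: Leb]) (wn n s)%:E =
      \int[@leb R]_(s in (I01 : set Leb)) (wn n s)%:E)%E.
    rewrite [RHS]integral_mkcond; apply: eq_integral => s _.
    rewrite [in RHS]patchE; case: ifPn => // /negP st.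
    by rewrite wn_out// => H; apply: st; rewrite inE.
  apply: (@le_lt_trans _ _ (\int[@leb R]_(s in (I01 : set Leb)) (cst n%:R%:E s))%E).
    apply: ge0_le_integral; first exact: mI01.
    - by move=> s _; rewrite lee_fin.
    - by apply: measurable_funTS; apply/measurable_EFinP; exact: mwn.
    - exact: measurable_cst.
    - by move=> s _; rewrite lee_fin /wn ge_min lexx orbT.
  rewrite integral_cst; last exact: mI01.
  by rewrite -[X in (_ * X < _)%E]/(leb I01) leb_I01 mule1 ltry.
have bound n : (\int[@leb R]_(s in [set: Leb]) (wn n s)%:E <= (c^-1 * phi 1)%:E)%E.
  rewrite (wnT n 1 (lexx _)) -primitive_EFin// lee_fin.
  have F0 : primitive (wn n) 0 = 0.
    by apply: primitive_eq0 => // s s0; rewrite wn_out// /I01/= in_itv/= leNgt s0.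
  have acF := primitive_ac (mwn n) (wn0 n) (wnoo n).
  have DF := primitive_derive (mwn n) (wn0 n) (wnoo n).
  have : phi 0 - c * primitive (wn n) 0 <= phi 1 - c * primitive (wn n) 1.
    apply: (@ac01_derive_ge0 R (phi \- (fun t => c * primitive (wn n) t)) 0 1) => //.
      by apply: ac01B => //; exact: ac01Z.
    have Dphi := ode_solution_derive p1 ltr01 sol1.
    move: Dphi DF (aepf f); apply: filterS3 => t Dphi [DF EF] E t01.
    have t01' : I01 t by move/andP : t01 => [? ?]; apply: in01; exact: ltW.
    have {E}[pE fE] := E t01'; have {}Dphi := Dphi t01.
    have DF' := is_deriveZ c (is_derive_derive1 DF EF).
    have DH := is_deriveB Dphi DF'; split; first exact: ex_derive.
    rewrite derive1E; case: DH => _ ->; rewrite /GRing.scale/= subr_ge0.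
    have wE : w t = ode_weight p f t by rewrite /w /ode_weight pE fE.
    have /andP[phit1 phit] := ode_solution_ge sol1 t01'.
    rewrite mulrC; apply: ler_pM => //; first exact: ltW.
      by rewrite -wE /wn ge_min lexx.
    have := pnq t; rewrite pE => ptq.
    apply: (@le_trans _ _ (phi 1 `^ (1 - p t))).
      by apply: ler_powR => //; rewrite lerD2l lerN2.
    by apply: powR_anti => //; [exact: lt_le_trans phit1|exact: p1].
  rewrite F0 mulr0 subr0 phi00 => H.
  by rewrite mulrC ler_pdivlMr// mulrC; lra.
have cvg : (\int[@leb R]_(s in [set: Leb]) (wn n s)%:E @[n --> \oo] -->
    \int[@leb R]_(s in [set: Leb]) (w s)%:E)%E.
  have := @cvg_monotone_convergence _ Leb R (@leb R) setT measurableT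
    (fun n s => (wn n s)%:E).
  have -> : (fun s : Leb => limn (fun n => (wn n s)%:E)) = (EFin \o w).
    apply/funext => s; apply/cvg_lim => //; apply: cvg_near_cst.
    near=> n; congr EFin; rewrite /wn; apply: min_idPl.
    near: n; exact: nbhs_infty_ger.
  apply.
  - by move=> n; apply/measurable_EFinP; exact: mwn.
  - by move=> n s _; rewrite lee_fin.
  - by move=> s _ m n mn; rewrite lee_fin /wn le_min2// ler_nat.
rewrite -(cvg_lim _ cvg)//; apply: (@le_lt_trans _ _ (c^-1 * phi 1)%:E); last exact: ltry.
apply: lime_le; first by apply/cvg_ex; eexists; exact: cvg.
by apply: nearW => n; exact: bound.
Unshelve. all: by end_near. Qed.

End L_ode_characterization.

(** * Estimates for the ODE norm by letting the starting value tend to 0 *)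

Section ode_norm_theory.
Context {R : realType}.
Local Notation Leb := (lebesgueType R).
Local Notation mI01 := (@lebesgue_measurable_I01 R).

(** Differentiability of the power covers positive limits; at 0 the bound u^e <= u for u <= 1 takes
    over. *)
Lemma cvg_powR_ge1 {U : Type} (F : set_system U) {FF : ProperFilter F}
    (u : U -> R) (l e : R) : 1 <= e -> (\forall x \near F, 0 <= u x) ->
  u x @[x --> F] --> l -> u x `^ e @[x --> F] --> l `^ e.
Proof.
move=> e1 u0 ul.
have l0 : 0 <= l.
  by rewrite -(cvg_lim _ ul)//; apply: limr_ge => //; apply/cvg_ex; exists l.
have [lE|ln0] := eqVneq l 0; last first.
  have lgt0 : 0 < l by rewrite lt_neqAle eq_sym ln0.
  have cont : {for l, continuous (fun x : R => x `^ e)}.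
    apply: differentiable_continuous.
    by apply/derivable1_diffP; have [] := is_derive1_powR e lgt0.
  exact: (cvg_comp _ _ ul cont).
rewrite [X in _ --> X `^ _]lE powR0 ?ge1_neq0//.
have u1 : \forall x \near F, u x < 1 by apply: (cvgr_lt l) => //; rewrite lE ltr01.
have := ul; rewrite lE => ul0.
apply: (squeeze_cvgr (f := cst 0) (h := u)) => //; last exact: cvg_cst.
near=> x; have ux0 : 0 <= u x by near: x.
have ux1 : u x <= 1 by apply: ltW; near: x.
rewrite powR_ge0/=; have [->|ux] := eqVneq (u x) 0.
  by rewrite powR0 ?ge1_neq0.
by apply: ge1r_powR => //; rewrite lt_neqAle eq_sym ux ux0 ux1.
Unshelve. all: by end_near. Qed.

Variables (p : R -> R) (q : R).
Hypotheses (q1 : 1 <= q) (p1 : forall t, I01 t -> 1 <= p t).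
Hypothesis mp : measurable_fun (I01 : set Leb) p.
Hypothesis pq : {ae @leb R, forall t, I01 t -> p t <= q}.

Lemma ode_normP (f : R -> R) : L_ode p f -> exists (N : R) (Phi : R -> R -> R),
  [/\ ode_norm p f = N%:E, 0 <= N,
      forall x, 0 < x -> unique_ode_solution p f x (Phi x),
      forall x, 0 < x -> N <= Phi x 1 &
      Phi x 1 @[x --> 0^'+] --> N].
Proof.
move=> fL; have [mf /(xgetPex (cst 0))] := fL; rewrite -/(ode_phi p f).
move=> [[Phi sol lim] sol0].
have lim1 := lim 1 (in01 ler01 (lexx 1)).
exists (ode_phi p f 1), Phi; split => //.
- by rewrite /ode_norm asboolT.
- by have /andP[] := ode_solution_ge sol0 (in01 ler01 (lexx 1)).
- move=> x x0; rewrite -(cvg_lim _ lim1)//; apply: limr_le.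
    by apply/cvg_ex; eexists; exact: lim1.
  near=> y; have y0 : 0 < y by near: y; exact: nbhs_right_gt.
  have yx : y <= x by near: y; exact: nbhs_right_le.
  have [solx _] := sol _ x0; have [soly _] := sol _ y0.
  exact: (ode_solution_le p1 y0 yx soly solx (fun=> lexx _) (in01 ler01 (lexx 1))).
Unshelve. all: by end_near. Qed.

(** The constant x solves the equation, so by uniqueness it is the solution started at x. *)
Lemma ode_norm_null (f : R -> R) : L_ode p f ->
  {ae @leb R, forall t, I01 t -> f t = 0} -> ode_norm p f = 0%E.
Proof.
move=> fL f0; have [N [Phi [-> N0 sol NPhi _]]] := ode_normP fL.
congr EFin; apply/le_anti; rewrite N0 andbT.
apply/ler_addgt0Pr => x x0; rewrite add0r.
have [_ uni] := sol _ x0.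
have solx : ode_solution p f x (cst x).
  split => //; first exact: ac01_cst.
  move: (aeI01 f0); apply: filterS => t + t01 => /(_ t01) ft.
  by split; [exact: derivable_cst|rewrite derive1_cst /ode_rhs ft eqxx].
have I1 : (1 : R) \in I01 by rewrite inE; exact: (in01 ler01 (lexx 1)).
by apply: le_trans (NPhi _ x0) _; rewrite -(uni _ solx 1 I1).
Qed.

Lemma L_ode_indic (D : set R) (f : R -> R) : measurable (D : set Leb) ->
  L_ode p f -> L_ode p (\1_D \* f).
Proof.
move=> mD fL; have [mf _] := fL.
have mDf : measurable_fun (I01 : set Leb) (\1_D \* f).
  apply: (@measurable_funM _ Leb R); last exact: mf.
  exact: (@measurable_indic _ Leb R).
split; first exact: mDf.
apply: (integrable_L_ode q1 p1 mp pq mDf).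
apply: le_lt_trans (L_ode_integrable q1 p1 mp pq fL).
apply: ge0_le_integral.
- exact: mI01.
- by move=> t t01; rewrite lee_fin ode_weight_ge0// p1.
- apply/measurable_EFinP; exact: (measurable_ode_weight01 p1 mp mDf).
- apply/measurable_EFinP; exact: (measurable_ode_weight01 p1 mp mf).
move=> t t01; rewrite lee_fin ler_wpM2r ?invr_ge0 ?(le_trans ler01 (p1 t01))//.
apply: ge0_ler_powR; rewrite ?nnegrE// ?(le_trans ler01 (p1 t01))//=.
by rewrite indicE; case: (t \in D); rewrite ?mul1r// mul0r normr0.
Qed.

Section decomposition.
Variables (T : eqType) (J : seq T) (D : T -> set R) (f : R -> R) (e : T -> R).
Hypothesis uJ : uniq J.
Hypothesis mD : forall i, measurable (D i : set Leb).
Hypothesis cover : forall t, I01 t -> exists2 j, j \in J & D j t.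
Hypothesis disj : forall i j t, i \in J -> j \in J -> D i t -> D j t -> i = j.
Hypothesis fL : L_ode p f.
Hypothesis e1 : {in J, forall i, 1 <= e i}.

Let comp := fun i => ode_normP (L_ode_indic (mD i) fL).

Let cvg_terms (l : R) (N : T -> R) (Phi : T -> R -> R -> R) : 0 < l ->
  (forall i, 0 <= N i) -> (forall i x, 0 < x -> N i <= Phi i x 1) ->
  (forall i, Phi i x 1 @[x --> 0^'+] --> N i) ->
  \sum_(i <- J) (Phi i x 1 / l) `^ e i / e i @[x --> 0^'+] -->
    \sum_(i <- J) (N i / l) `^ e i / e i.
Proof.
move=> l0 N0 NPhi lim; rewrite big_seq; under eq_fun do rewrite big_seq.
apply: cvg_big => [|i iJ]; first exact: add_continuous.
apply: cvgM; last exact: cvg_cst.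
apply: cvg_powR_ge1; first exact: e1.
  near=> x; rewrite divr_ge0 ?(ltW l0)// (le_trans (N0 i))// NPhi//.
by apply: cvgM; [exact: lim|exact: cvg_cst].
Unshelve. all: by end_near. Qed.

Let cvg_x (l : R) : x / l @[x --> 0^'+] --> (0 : R).
Proof.
rewrite -[X in _ --> X](mul0r l^-1); apply: cvgM; last exact: cvg_cst.
exact: (cvg_at_right_filter (@cvg_id _ _)).
Qed.

Lemma ode_norm_le_boxsum :
  {in J, forall j, {ae @leb R, forall t, I01 t -> D j t -> e j <= p t}} ->
  (ode_norm p f <= (2 - q^-1)%:E *
    boxsum [seq (e i, ode_norm p (\1_(D i) \* f)%R) | i <- J])%E.
Proof.
move=> ep; have [N [Phi [NE N0 sol NPhi lim]]] := ode_normP fL.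
have /choice[Ni /choice[Phii H]] := comp.
have -> : [seq (e i, ode_norm p (\1_(D i) \* f)%R) | i <- J] =
    [seq (e i, (Ni i)%:E) | i <- J].
  by apply: eq_map => i; have [-> _ _ _ _] := H i.
have Ni0 i : 0 <= Ni i by have [] := H i.
have [M [ME M0]] := boxsum_real Ni0 e1.
rewrite NE ME -EFinM lee_fin mulrC.
have b0 : 0 < 2 - q^-1 by have : q^-1 <= 1 by [rewrite invf_le1// (lt_le_trans ltr01)]; lra.
rewrite -ler_pdivrMr//; apply/ler_addgt0Pr => d d0.
(* The strict inequality leaves room for the values of the solutions of the pieces, which exceed
   their limits, and for the term x / l. *)
set l := M + d; have Ml : M < l by rewrite ltrDl.
have l0 : 0 < l by exact: le_lt_trans Ml.
rewrite ler_pdivrMr// mulrC.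
have : \sum_(i <- J) (Phii i x 1 / l) `^ e i / e i + x / l @[x --> 0^'+] -->
    \sum_(i <- J) (Ni i / l) `^ e i / e i + 0.
  apply: cvgD (cvg_x l); apply: cvg_terms => // i; [move=> x x0|]; by have [_ _ _ +] := H i; auto.
have S1 : \sum_(i <- J) (Ni i / l) `^ e i / e i + 0 < 1.
  rewrite addr0; have := sum_le_boxsum Ni0 e1 l0; rewrite ME !lee_fin (ltW Ml) => /(_ isT).
  by rewrite -ler_pdivlMr// => /le_lt_trans; apply; rewrite ltr_pdivrMr// mul1r.
move=> /cvgr_lt /(_ _ S1) near1.
have [x [x0 Sx]] : exists x, 0 < x /\
    \sum_(i <- J) (Phii i x 1 / l) `^ e i / e i + x / l < 1.
  by apply: (@filter_ex _ (0 : R)^'+); apply: filterI near1; exact: nbhs_right_gt.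
apply: le_trans (NPhi _ x0) _.
have [solx _] := sol _ x0.
have soli i : ode_solution p (\1_(D i) \* f) x (Phii i x).
  by have [_ _ /(_ _ x0)[+ _] _ _] := H i.
apply: (ode_decomposition_upper uJ p1 cover disj x0 l0 solx soli e1 (q := q)) => //.
  move=> j jJ; move: pq (ep j jJ); apply: filterS2 => t H1 H2 t01 Djt.
  by rewrite H1// H2.
exact: ltW.
Qed.

Lemma boxsum_le_ode_norm :
  {in J, forall j, {ae @leb R, forall t, I01 t -> D j t -> p t <= e j}} ->
  {in J, forall i, ode_norm p (\1_(D i) \* f) = 0%E \/ e i <= q} ->
  (boxsum [seq (e i, ode_norm p (\1_(D i) \* f)%R) | i <- J] <=
    (2 - q^-1)%:E * ode_norm p f)%E.
Proof.
move=> pe eq; have [N [Phi [NE N0 sol NPhi lim]]] := ode_normP fL.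
have /choice[Ni /choice[Phii H]] := comp.
have -> : [seq (e i, ode_norm p (\1_(D i) \* f)%R) | i <- J] =
    [seq (e i, (Ni i)%:E) | i <- J].
  by apply: eq_map => i; have [-> _ _ _ _] := H i.
have {}eq : {in J, forall i, Ni i = 0 \/ e i <= q}.
  by move=> i /eq; have [-> _ _ _ _] := H i => -[[->]|]; [left|right].
have Ni0 i : 0 <= Ni i by have [] := H i.
have [M [ME M0]] := boxsum_real Ni0 e1.
rewrite NE ME -EFinM lee_fin.
have b0 : 0 < 2 - q^-1 by have : q^-1 <= 1 by [rewrite invf_le1// (lt_le_trans ltr01)]; lra.
rewrite mulrC -ler_pdivrMr//; apply/ler_addgt0Pr => d d0.
set l := N + d; have Nl : N < l by rewrite ltrDl.
have l0 : 0 < l by exact: le_lt_trans Nl.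
rewrite ler_pdivrMr// mulrC -lee_fin -ME.
apply: boxsum_le_sum => //.
(* The starting values of the pieces contribute an error that vanishes with x. *)
have lim1 : 1 + \sum_(i <- J) (x / l) `^ e i / e i @[x --> 0^'+] -->
    1 + \sum_(i <- J) ((0 : R) / l) `^ e i / e i.
  apply: cvgD; first exact: cvg_cst.
  apply: (@cvg_terms l (fun=> 0) (fun=> fun x => cst x)) => //.
    by move=> i x x0; exact: ltW.
  by move=> i /=; exact: (cvg_at_right_filter (@cvg_id _ _)).
have sum0 : 1 + \sum_(i <- J) ((0 : R) / l) `^ e i / e i = 1.
  rewrite big1_seq ?addr0// => i /andP[_ iJ].
  by rewrite mul0r powR0 ?mul0r// ge1_neq0// e1.
rewrite sum0 in lim1; rewrite -(cvg_lim _ lim1)//.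
apply: limr_ge; first by apply/cvg_ex; eexists; exact: lim1.
near=> x; have x0 : 0 < x by near: x; exact: nbhs_right_gt.
have Phil : Phi x 1 <= l.
  apply: ltW; near: x; exact: (cvgr_lt N).
have [solx _] := sol _ x0.
have soli i : ode_solution p (\1_(D i) \* f) x (Phii i x).
  by have [_ _ /(_ _ x0)[+ _] _ _] := H i.
apply: le_trans (ode_decomposition_lower uJ p1 cover disj x0 l0 solx soli e1 pe Phil).
rewrite big_seq [leRHS]big_seq; apply: ler_sum => i iJ.
have ei0 : 0 <= e i by rewrite (le_trans ler01)// e1.
have NP : Ni i <= Phii i x 1 by have [_ _ _ + _] := H i; apply.
rewrite ler_wpM2r ?invr_ge0//.
apply: ge0_ler_powR; rewrite ?nnegrE ?divr_ge0 ?(ltW l0)//.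
  exact: le_trans NP.
by rewrite ler_pM2r ?invr_gt0.
Unshelve. all: by end_near. Qed.

End decomposition.
End ode_norm_theory.

(** * Decompositions in the Nakano norm *)

HB.lock Definition nakano_modular {R : realType} (p g : R -> R) (l : R) : \bar R :=
  (\int[@leb R]_(t in (I01 : set (lebesgueType R)))
    (ode_weight p (fun s => g s / l)%R t)%:E)%E.

Section nakano_modular.
Context {R : realType}.
Local Notation Leb := (lebesgueType R).
Local Notation mI01 := (@lebesgue_measurable_I01 R).

Lemma nakano_modularE (p g : R -> R) l : 0 < l -> nakano_modular p g l =
  (\int[@leb R]_(t in I01) ((p t)^-1 * (`|g t| `^ p t / l `^ p t))%:E)%E.
Proof.
move=> l0; rewrite nakano_modular.unlock; apply: eq_integral => t _; congr EFin; rewrite /ode_weight mulrC.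
congr (_ * _); rewrite normrM normfV (gtr0_norm l0).
have lp0 : l `^ p t != 0 by rewrite gt_eqF// powR_gt0.
by apply: (mulIf lp0); rewrite divfK// -powRM ?divr_ge0 ?(ltW l0)// divfK// gt_eqF.
Qed.

Lemma nakano_norm_ge0 (p g : R -> R) : (0 <= nakano_norm p g)%E.
Proof.
by apply: le_ereal_inf_tmp => _ /= [l [l0 _] <-]; rewrite lee_fin ltW.
Qed.

Lemma nakano_norm_le (p g : R -> R) l : 0 < l -> (nakano_modular p g l <= 1)%E ->
  (nakano_norm p g <= l%:E)%E.
Proof.
move=> l0 H; apply: ereal_inf_lbound; exists l => //; split => //.
by rewrite -nakano_modularE.
Qed.

Lemma le_nakano_norm (p g : R -> R) y :
  (forall l, 0 < l -> (nakano_modular p g l <= 1)%E -> (y <= l%:E)%E) ->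
  (y <= nakano_norm p g)%E.
Proof.
move=> H; apply: le_ereal_inf_tmp => _ /= [l [l0 Hl] <-]; apply: H => //.
by rewrite nakano_modularE.
Qed.

Lemma nakano_norm_lt (p g : R -> R) (l : R) : (nakano_norm p g < l%:E)%E ->
  exists l', [/\ 0 < l', l' < l & (nakano_modular p g l' <= 1)%E].
Proof.
move=> /ereal_inf_lt[_ [l' [l'0 H] <-]] l'l; exists l'; split => //.
by rewrite nakano_modularE.
Qed.

Lemma le_integral01 (h1 h2 : R -> R) : measurable_fun (I01 : set Leb) h1 ->
  measurable_fun (I01 : set Leb) h2 -> (forall t, I01 t -> 0 <= h1 t) ->
  (forall t, I01 t -> 0 <= h2 t) ->
  {ae @leb R, forall t, I01 t -> h1 t <= h2 t} ->
  (\int[@leb R]_(t in (I01 : set Leb)) (h1 t)%:E <=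
   \int[@leb R]_(t in (I01 : set Leb)) (h2 t)%:E)%E.
Proof.
move=> mh1 mh2 h10 h20 h12; apply: ae_ge0_le_integral.
- exact: mI01.
- by move=> t t01; rewrite lee_fin h10.
- by apply/measurable_EFinP; exact: mh1.
- by move=> t t01; rewrite lee_fin h20.
- by apply/measurable_EFinP; exact: mh2.
- by apply: filterS h12 => t + t01 => /(_ t01) H; rewrite lee_fin.
Qed.

Lemma integral01_sum (T : Type) (J : seq T) (h : T -> R -> R) :
  (forall i, measurable_fun (I01 : set Leb) (h i)) ->
  (forall i t, I01 t -> 0 <= h i t) ->
  (\int[@leb R]_(t in (I01 : set Leb)) (\sum_(i <- J) h i t)%:E =
   \sum_(i <- J) \int[@leb R]_(t in (I01 : set Leb)) (h i t)%:E)%E.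
Proof.
move=> mh h0; rewrite -(@ge0_integral_sum _ Leb R (@leb R) _ mI01 T (fun i t => (h i t)%:E)).
- by apply: eq_integral => t _; rewrite sumEFin.
- by move=> i; apply/measurable_EFinP; exact: mh.
- by move=> i t t01; rewrite lee_fin h0.
Qed.

Section one_function.
Variables (p g : R -> R).
Hypothesis p1 : forall t, I01 t -> 1 <= p t.
Hypothesis mp : measurable_fun (I01 : set Leb) p.
Hypothesis mg : measurable_fun (I01 : set Leb) g.

Lemma measurable_modular l :
  measurable_fun (I01 : set Leb) (ode_weight p (fun s => g s / l)).
Proof.
apply: (measurable_ode_weight01 p1 mp).
apply: (@measurable_funM _ Leb R); [exact: mg|exact: measurable_cst].
Qed.

Lemma nakano_modular_ge0 l : (0 <= nakano_modular p g l)%E.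
Proof.
rewrite nakano_modular.unlock.
by apply: integral_ge0 => t t01; rewrite lee_fin ode_weight_ge0// p1.
Qed.

Lemma nakano_modular_scale (l1 l2 c : R) : 0 < l1 -> 0 < l2 -> 0 <= c ->
  {ae @leb R, forall t, I01 t -> g t != 0 -> (l2 / l1) `^ p t <= c} ->
  (nakano_modular p g l1 <= c%:E * nakano_modular p g l2)%E.
Proof.
move=> l10 l20 c0 H; rewrite nakano_modular.unlock -ge0_integralZl_EFin; last 4 first.
- exact: mI01.
- by move=> t t01; rewrite lee_fin ode_weight_ge0// p1.
- by apply/measurable_EFinP; exact: measurable_modular.
- exact: c0.
apply: (@le_integral01 _ (fun t => c * ode_weight p (fun s => g s / l2) t)).
- exact: measurable_modular.
- apply: (@measurable_funM _ Leb R); [exact: measurable_cst|exact: measurable_modular].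
- by move=> t t01; rewrite ode_weight_ge0// p1.
- by move=> t t01; rewrite mulr_ge0// ode_weight_ge0// p1.
apply: filterS H => t H t01; have pt := p1 t01.
have [g0|g0] := eqVneq (g t) 0.
  by rewrite /ode_weight g0 !mul0r normr0 powR0 ?ge1_neq0// mul0r mulr0.
rewrite /ode_weight mulrA ler_pM2r ?invr_gt0 ?(lt_le_trans ltr01)//.
have -> : g t / l1 = l2 / l1 * (g t / l2) by field; rewrite !gt_eqF.
rewrite normrM powRM// ger0_norm ?divr_ge0 ?(ltW l10) ?(ltW l20)//.
by rewrite ler_wpM2r ?powR_ge0//; exact: H.
Qed.

(** Some k close to N has modular at most 1, and passing from k to l multiplies the integrand by (k
    / l)^p <= (k / l)^r. The infimum need not be attained, so the bound is shown for m in ]N, l[ and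
    then m tends to N. *)
Lemma nakano_modular_le_powR (N r l : R) : nakano_norm p g = N%:E ->
  1 <= r -> {ae @leb R, forall t, I01 t -> g t != 0 -> r <= p t} ->
  N < l -> (nakano_modular p g l <= ((N / l) `^ r)%:E)%E.
Proof.
move=> NE r1 rp Nl.
have N0 : 0 <= N by rewrite -lee_fin -NE nakano_norm_ge0.
have l0 : 0 < l by exact: le_lt_trans Nl.
have H m : N < m -> m < l -> (nakano_modular p g l <= ((m / l) `^ r)%:E)%E.
  move=> Nm ml; have : (nakano_norm p g < m%:E)%E by rewrite NE lte_fin.
  move=> /nakano_norm_lt[k [k0 km k1]].
  have kl0 : 0 <= k / l by rewrite divr_ge0 ?(ltW k0) ?(ltW l0).
  have kl1 : k / l <= 1 by rewrite ler_pdivrMr// mul1r (ltW (lt_trans km ml)).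
  apply: (@le_trans _ _ (((k / l) `^ r)%:E * nakano_modular p g k)%E).
    apply: nakano_modular_scale => //; first exact: powR_ge0.
    apply: filterS rp => t + t01 gt => /(_ t01 gt) rp.
    by apply: ger_powR => //; rewrite kl1 divr_gt0.
  apply: (@le_trans _ _ ((k / l) `^ r)%:E).
    by rewrite -[leRHS]mule1 lee_wpmul2l// lee_fin powR_ge0.
  rewrite lee_fin ge0_ler_powR ?nnegrE ?(le_trans ler01 r1)//.
    by rewrite divr_ge0 ?(ltW l0)// (le_trans N0)// ltW.
  by rewrite ler_pM2r ?invr_gt0// ltW.
have modE : nakano_modular p g l = (fine (nakano_modular p g l))%:E.
  rewrite fineK// ge0_fin_numE ?nakano_modular_ge0//.
  have /H : N < (N + l) / 2 by rewrite ltr_pdivlMr//; lra.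
  by move=> /(_ ltac:(rewrite ltr_pdivrMr//; lra))/le_lt_trans; apply; exact: ltry.
rewrite modE lee_fin.
have lim : (m / l) `^ r @[m --> N^'+] --> (N / l) `^ r.
  apply: cvg_powR_ge1 => //.
    near=> m; rewrite divr_ge0 ?(ltW l0)// (le_trans N0)//.
  apply: cvgM; last exact: cvg_cst.
  exact: (cvg_at_right_filter (@cvg_id _ _)).
rewrite -(cvg_lim _ lim)//; apply: limr_ge.
  by apply/cvg_ex; eexists; exact: lim.
near=> m; rewrite -lee_fin -modE; apply: H; near: m.
  exact: nbhs_right_gt.
exact: nbhs_right_lt.
Unshelve. all: by end_near. Qed.

(** If the modular at l is at most some k in ]0, 1], then at m = l k^(1/s) it is at most 1, since (l
    / m)^p = k^(-p/s) <= 1/k. Hence N <= m, that is, (N / l)^s <= k. *)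
Lemma powR_le_nakano_modular (N s l : R) : nakano_norm p g = N%:E ->
  1 <= s -> {ae @leb R, forall t, I01 t -> g t != 0 -> p t <= s} ->
  0 < l -> (nakano_modular p g l <= 1)%E ->
  (((N / l) `^ s)%:E <= nakano_modular p g l)%E.
Proof.
move=> NE s1 ps l0 mod1.
have N0 : 0 <= N by rewrite -lee_fin -NE nakano_norm_ge0.
have s0 : 0 < s by exact: lt_le_trans s1.
have H (k : R) : 0 < k -> k <= 1 -> (nakano_modular p g l <= k%:E)%E ->
    (N / l) `^ s <= k.
  move=> k0 k1 modk; pose m := l * k `^ s^-1.
  have m0 : 0 < m by rewrite mulr_gt0// powR_gt0.
  have : (nakano_norm p g <= m%:E)%E.
    apply: (nakano_norm_le m0).
    apply: (@le_trans _ _ (k^-1%:E * nakano_modular p g l)%E).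
      apply: nakano_modular_scale => //; first by rewrite invr_ge0 ltW.
      apply: filterS ps => t + t01 gt => /(_ t01 gt) pts; have pt := p1 t01.
      have -> : l / m = k `^ (- s^-1).
        by rewrite powRN /m invfM mulrA divff ?mul1r// gt_eqF.
      rewrite -powRrM -(powR_inv1 (ltW k0)) mulNr.
      apply: ger_powR; first by rewrite k0.
      by rewrite lerN2 mulrC ler_pdivrMr// mul1r.
    by rewrite lee_pdivrMl// mule1.
  rewrite NE lee_fin /m => Nm.
  have -> : k = (k `^ s^-1) `^ s by rewrite -powRrM mulVf ?gt_eqF// powRr1// ltW.
  rewrite ge0_ler_powR ?nnegrE ?(ltW s0) ?powR_ge0 ?divr_ge0 ?(ltW l0)//.
  by rewrite ler_pdivrMr// mulrC.
have mod0 := nakano_modular_ge0 l.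
have modE : nakano_modular p g l = (fine (nakano_modular p g l))%:E.
  by rewrite fineK// ge0_fin_numE// (le_lt_trans mod1)// ltry.
move: mod0 mod1 H; rewrite modE; set X := fine _; rewrite !lee_fin => X0 X1 H.
(* The modular may be 0, so k is taken strictly between it and the power supposed to exceed it. *)
rewrite leNgt; apply/negP => XN.
have N1 : (N / l) `^ s <= 1 by apply: H.
have : (N / l) `^ s <= (X + (N / l) `^ s) / 2.
  by apply: H; [|lra|rewrite lee_fin; lra]; lra.
by lra.
Qed.

End one_function.
End nakano_modular.

(** * Finite sums and iterated sums with finite values *)

Section finite_sums.
Variables (R : realType) (T : eqType) (J : seq T).

Lemma term_le_sum (h : T -> R) i : i \in J -> {in J, forall j, 0 <= h j} ->
  h i <= \sum_(j <- J) h j.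
Proof.
move=> iJ h0; rewrite (perm_big _ (perm_to_rem iJ)) big_cons lerDl big_seq.
by apply: sumr_ge0 => j /mem_rem/h0.
Qed.

Lemma term_lee_sum (h : T -> \bar R) i : i \in J -> (forall j, 0 <= h j)%E ->
  (h i <= \sum_(j <- J) h j)%E.
Proof.
by move=> iJ h0; rewrite (perm_big _ (perm_to_rem iJ)) big_cons leeDl// sume_ge0.
Qed.

Lemma sum_disjoint_le (h : T -> R) (P : T -> Prop) (H : R) : uniq J ->
  {in J &, forall i j, P i -> P j -> i = j} ->
  {in J, forall i, ~ P i -> h i = 0} -> {in J, forall i, P i -> h i <= H} ->
  0 <= H -> \sum_(i <- J) h i <= H.
Proof.
move=> uJ disj h0 hH H0; case: (pselect (exists2 j, j \in J & P j)) => [[j jJ Pj]|nP].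
  rewrite (bigD1_seq j)//= big1_seq ?addr0; first exact: hH.
  by move=> i /andP[ij iJ]; apply: h0 => // Pi; move: ij; rewrite (disj i j)// eqxx.
by rewrite big1_seq// => i /andP[_ iJ]; apply: h0 => // Pi; apply: nP; exists i.
Qed.

(** The factor 1/e_i of [sum_le_boxsum] is removed by e_i <= c^e_i. The same inequality forces x_i <
    c l: otherwise the i-th term alone would reach 1. *)
Lemma boxsum_powR_le (x e : T -> R) (q c l M : R) : (forall i, 0 <= x i) ->
  {in J, forall i, 1 <= e i} -> {in J, forall i, x i = 0 \/ e i <= q} ->
  1 <= q -> 2 - q^-1 <= c ->
  boxsum [seq (e i, (x i)%:E) | i <- J] = M%:E -> 0 <= M -> M < l ->
  {in J, forall i, x i < c * l} /\ \sum_(i <- J) (x i / (c * l)) `^ e i <= 1.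
Proof.
move=> x0 e1 eq q1 qc ME M0 Ml.
have l0 : 0 < l by exact: le_lt_trans Ml.
have c1 : 1 <= c by have : q^-1 <= 1 by [rewrite invf_le1// (lt_le_trans ltr01)]; lra.
have c0 : 0 < c by exact: lt_le_trans c1.
have S1 : \sum_(i <- J) (x i / l) `^ e i / e i < 1.
  have := sum_le_boxsum x0 e1 l0; rewrite ME !lee_fin (ltW Ml) => /(_ isT).
  by rewrite -ler_pdivlMr// => /le_lt_trans; apply; rewrite ltr_pdivrMr// mul1r.
have e0 i : i \in J -> 0 < e i by move=> /e1; exact: lt_le_trans.
have term0 : {in J, forall i, 0 <= (x i / l) `^ e i / e i}.
  by move=> i iJ; rewrite divr_ge0 ?powR_ge0// ltW ?e0.
have ec i : i \in J -> e i <= q -> e i <= c `^ e i.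
  by move=> iJ eiq; apply: (le_powR_base (q := q)) => //; exact: e1.
split=> [i iJ|].
  case: (eq i iJ) => [->|eiq]; first by rewrite mulr_gt0.
  rewrite -ltr_pdivrMr// ltNge; apply/negP => cx.
  have : (x i / l) `^ e i / e i < 1 := le_lt_trans (term_le_sum iJ term0) S1.
  rewrite ltr_pdivrMr ?e0// mul1r ltNge => /negP; apply.
  apply: le_trans (ec i iJ eiq) _.
  by apply: ge0_ler_powR; rewrite ?nnegrE ?(ltW (e0 i iJ)) ?(ltW c0) ?divr_ge0 ?(ltW l0).
apply: le_trans (ltW S1); rewrite big_seq [leRHS]big_seq; apply: ler_sum => i iJ.
case: (eq i iJ) => [->|eiq]; first by rewrite !mul0r powR0 ?ge1_neq0 ?e1// mul0r.
have -> : x i / l = c * (x i / (c * l)) by field; rewrite !gt_eqF.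
set y := x i / (c * l).
have y0 : 0 <= y by rewrite divr_ge0 ?mulr_ge0 ?(ltW c0) ?(ltW l0).
rewrite powRM ?(ltW c0)// ler_pdivlMr ?e0// mulrC ler_wpM2r ?powR_ge0//.
exact: ec.
Qed.

Lemma boxsum_cases (e : T -> R) (N : T -> \bar R) : {in J, forall i, 1 <= e i} ->
  (forall i, 0 <= N i)%E ->
  boxsum [seq (e i, N i) | i <- J] = +oo%E \/
  exists (x : T -> R) (M : R), [/\ forall i, 0 <= x i,
    {in J, forall i, N i = (x i)%:E}, 0 <= M,
    boxsum [seq (e i, N i) | i <- J] = M%:E &
    boxsum [seq (e i, (x i)%:E) | i <- J] = M%:E].
Proof.
move=> e1 N0; case: (pselect (exists2 i, i \in J & N i = +oo%E)) => [H|H].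
  by left; apply: boxsum_pinfty => //.
right; exists (fun i => fine (N i)).
have x0 i : 0 <= fine (N i) by rewrite fine_ge0.
have xE : {in J, forall i, N i = (fine (N i))%:E}.
  move=> i iJ; rewrite fineK// ge0_fin_numE// lt_neqAle leey andbT.
  by apply/eqP => Ni; apply: H; exists i.
have [M [ME M0]] := boxsum_real x0 e1.
exists M; split => //; rewrite -ME; congr boxsum.
by apply/eq_in_map => i iJ; rewrite {1}xE.
Qed.

Lemma boxsum_ge0 (e : T -> R) (N : T -> \bar R) : {in J, forall i, 1 <= e i} ->
  (forall i, 0 <= N i)%E -> (0 <= boxsum [seq (e i, N i) | i <- J])%E.
Proof.
move=> e1 N0; have [->|[x [M [_ _ M0 -> _]]]] := boxsum_cases e1 N0; first exact: leey.
by rewrite lee_fin.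
Qed.

End finite_sums.

(** * Sums of modulars over the pieces *)

Section nakano_decomposition.
Context {R : realType}.
Local Notation Leb := (lebesgueType R).
Local Notation mI01 := (@lebesgue_measurable_I01 R).
Variables (T : eqType) (J : seq T).

Section family.
Variables (pp g : T -> R -> R) (e : T -> R) (q : R).
Hypotheses (pp1 : forall i t, I01 t -> 1 <= pp i t) (q1 : 1 <= q).
Hypothesis mpp : forall i, measurable_fun (I01 : set Leb) (pp i).
Hypothesis mg : forall i, measurable_fun (I01 : set Leb) (g i).
Hypothesis e1 : {in J, forall i, 1 <= e i}.
Hypothesis eq : {in J, forall i, nakano_norm (pp i) (g i) = 0%E \/ e i <= q}.

Lemma sum_nakano_modular_le1 (c l M : R) :
  {in J, forall i, {ae @leb R, forall t, I01 t -> g i t != 0 -> e i <= pp i t}} ->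
  2 - q^-1 <= c ->
  boxsum [seq (e i, nakano_norm (pp i) (g i)) | i <- J] = M%:E -> M < l ->
  (\sum_(i <- J) nakano_modular (pp i) (g i) (c * l) <= 1)%E.
Proof.
move=> ep qc ME Ml.
have [|[x [M' [x0 xE M0 ME' xM]]]] :=
    boxsum_cases (N := fun i => nakano_norm (pp i) (g i)) e1 (fun i => nakano_norm_ge0 _ _).
  by rewrite ME.
have {}ME' : M' = M by move: ME'; rewrite ME => -[].
rewrite ME' in M0 xM.
have eqx : {in J, forall i, x i = 0 \/ e i <= q}.
  by move=> i iJ; case: (eq iJ) => H; [left; move: (xE i iJ); rewrite H => -[]|right].
have [xl Sx] := boxsum_powR_le x0 e1 eqx q1 qc xM M0 Ml.
apply: (@le_trans _ _ (\sum_(i <- J) ((x i / (c * l)) `^ e i)%:E)%E).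
  rewrite big_seq [leRHS]big_seq; apply: lee_sum => i iJ.
  by apply: nakano_modular_le_powR => //; [exact: pp1|exact: xE|exact: e1|exact: ep|exact: xl].
by rewrite sumEFin lee_fin.
Qed.

Lemma boxsum_nakano_le (l : R) :
  {in J, forall i, {ae @leb R, forall t, I01 t -> g i t != 0 -> pp i t <= e i}} ->
  0 < l -> (\sum_(i <- J) nakano_modular (pp i) (g i) l <= 1)%E ->
  (boxsum [seq (e i, nakano_norm (pp i) (g i)) | i <- J] <= ((2 - q^-1) * l)%:E)%E.
Proof.
move=> pe l0 S1.
have mod1 i : i \in J -> (nakano_modular (pp i) (g i) l <= 1)%E.
  move=> iJ; apply: le_trans S1.
  by apply: (term_lee_sum iJ) => j; apply: nakano_modular_ge0; exact: pp1.
have xE : {in J, forall i, nakano_norm (pp i) (g i) = (fine (nakano_norm (pp i) (g i)))%:E}.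
  move=> i iJ; rewrite fineK// ge0_fin_numE ?nakano_norm_ge0//.
  by apply: le_lt_trans (nakano_norm_le l0 (mod1 i iJ)) _; rewrite ltry.
have -> : [seq (e i, nakano_norm (pp i) (g i)) | i <- J] =
    [seq (e i, (fine (nakano_norm (pp i) (g i)))%:E) | i <- J].
  by apply/eq_in_map => i iJ; rewrite {1}xE.
apply: boxsum_le_sum => //.
- by move=> i; rewrite fine_ge0// nakano_norm_ge0.
- by move=> i iJ; case: (eq iJ) => H; [left; rewrite H|right].
rewrite -lee_fin; apply: le_trans S1; rewrite -sumEFin big_seq [leRHS]big_seq.
apply: lee_sum => i iJ.
apply: (@le_trans _ _ ((fine (nakano_norm (pp i) (g i)) / l) `^ e i)%:E).
  have ei := e1 iJ; rewrite lee_fin ler_pdivrMr ?(lt_le_trans ltr01 ei)//.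
  by rewrite ler_peMr// powR_ge0.
apply: powR_le_nakano_modular => //; [exact: pp1|exact: xE|exact: e1|exact: pe|exact: mod1].
Qed.

End family.

Lemma le_boxsum_limit (y : \bar R) (c M : R) : 0 < c ->
  (forall l, M < l -> (y <= (c * l)%:E)%E) -> (y <= c%:E * M%:E)%E.
Proof.
move=> c0 H; apply/lee_addgt0Pr => d d0; rewrite -EFinM -EFinD.
have -> : c * M + d = c * (M + d / c) by rewrite mulrDr mulrC (mulrC c (d / c)) divfK ?gt_eqF.
by apply: H; rewrite ltrDl divr_gt0.
Qed.

Lemma integral01_affine (h : R -> R) (c : R) : 0 <= c ->
  measurable_fun (I01 : set Leb) h -> (forall t, I01 t -> 0 <= h t) ->
  (\int[@leb R]_(t in (I01 : set Leb)) (c * (h t + 1))%:E =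
   c%:E * (\int[@leb R]_(t in (I01 : set Leb)) (h t)%:E + 1))%E.
Proof.
move=> c0 mh h0.
have int1 : (\int[@leb R]_(t in (I01 : set Leb)) (cst 1%:E t) = 1)%E.
  rewrite integral_cst; last exact: mI01.
  by rewrite -[X in (_ * X)%E]/(leb I01) leb_I01 mule1.
have mh' : measurable_fun (I01 : set Leb) (EFin \o h) by apply/measurable_EFinP; exact: mh.
have m1 : measurable_fun (I01 : set Leb) (cst 1%:E : R -> \bar R) by exact: measurable_cst.
have h0' t : I01 t -> (0 <= (h t)%:E)%E by move=> t01; rewrite lee_fin h0.
have p1' t : I01 t -> (0 <= (cst 1%:E : R -> \bar R) t)%E by move=> _; rewrite lee_fin.
rewrite -[in RHS]int1 -(@ge0_integralD _ Leb R (@leb R) I01 mI01 _ _ h0' mh' p1' m1).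
rewrite -(@ge0_integralZl_EFin _ Leb R (@leb R) I01 mI01 (fun t => (h t)%:E + cst 1%:E t)%E).
- by apply: eq_integral => t _; rewrite EFinM EFinD.
- by move=> t t01; rewrite adde_ge0 ?lee_fin ?h0.
- exact: emeasurable_funD.
- exact: c0.
Qed.

Variables (p f : R -> R) (D : T -> set R) (e : T -> R).
Hypothesis p1 : forall t, I01 t -> 1 <= p t.
Hypothesis mp : measurable_fun (I01 : set Leb) p.
Hypothesis mf : measurable_fun (I01 : set Leb) f.
(** Measurability is asked of the trace on [0, 1] because the pieces cut out by the values of [p]
    are preimages under a function that is measurable there only. *)
Hypothesis mD : forall i, measurable (I01 `&` D i : set Leb).
Hypothesis e1 : forall i, 1 <= e i.

Let measurable_indic_f i : measurable_fun (I01 : set Leb) (\1_(D i) \* f).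
Proof.
apply: (@eq_measurable_fun _ _ Leb R _ (\1_(I01 `&` D i) \* f)).
  move=> t; rewrite inE => t01 /=; congr (_ * _); rewrite !indicE.
  congr ((_ : bool)%:R); apply/idP/idP; rewrite !inE; first by case.
  by split.
apply: (@measurable_funM _ Leb R); last exact: mf.
exact: (@measurable_indic _ Leb R).
Qed.

Let weight_in i l t (r : R -> R) : D i t ->
  ode_weight r (fun s => (\1_(D i) \* f) s / l) t = ode_weight r (fun s => f s / l) t.
Proof. by move=> Dt; rewrite /ode_weight/= indicE mem_set// mul1r. Qed.

Let weight_out i l t (r : R -> R) : 1 <= r t -> ~ D i t ->
  ode_weight r (fun s => (\1_(D i) \* f) s / l) t = 0.
Proof.
move=> rt Dt; apply/eqP; rewrite ode_weight_eq0//= indicE memNset//.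
by rewrite !mul0r.
Qed.

Let supp (P : T -> R -> Prop) : {in J, forall i, {ae @leb R, forall t, I01 t -> D i t -> P i t}} ->
  {in J, forall i, {ae @leb R, forall t, I01 t -> (\1_(D i) \* f) t != 0 -> P i t}}.
Proof.
move=> H i iJ; apply: filterS (H i iJ) => t + t01 ft; apply => //.
by apply: contrapT => Dt; move: ft; rewrite /= indicE memNset// mul0r eqxx.
Qed.

Let w0 (r : R -> R) g l t : (forall t, I01 t -> 1 <= r t) -> I01 t ->
  0 <= ode_weight r (fun s => g s / l) t.
Proof. by move=> r1 t01; rewrite ode_weight_ge0// r1. Qed.

Let mw i l := measurable_modular p1 mp (measurable_indic_f i) l.
Let e1c i (t : R) : I01 t -> 1 <= cst (e i) t. Proof. by move=> _; exact: e1. Qed.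
Let mec i : measurable_fun (I01 : set Leb) (cst (e i) : R -> R).
Proof. exact: measurable_cst. Qed.
Let mwc i l := measurable_modular (@e1c i) (mec i) (measurable_indic_f i) l.

Section upper.
(** Almost everywhere, because points where [p] exceeds its essential supremum lie in none of the
    pieces cut out by [p]. *)
Hypothesis cover : {ae @leb R, forall t, I01 t -> exists2 j, j \in J & D j t}.

Lemma nakano_norm_le_boxsum (q c : R) : 1 <= q -> 2 - q^-1 <= c ->
  {in J, forall i, {ae @leb R, forall t, I01 t -> D i t -> e i <= p t}} ->
  {in J, forall i, nakano_norm p (\1_(D i) \* f) = 0%E \/ e i <= q} ->
  (nakano_norm p f <=
    c%:E * boxsum [seq (e i, nakano_norm p (\1_(D i) \* f)%R) | i <- J])%E.
Proof.
move=> q1 qc ep eq.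
have c0 : 0 < c by have : q^-1 <= 1 by [rewrite invf_le1// (lt_le_trans ltr01)]; lra.
have [->|[_ [M [_ _ M0 ME _]]]] :=
    boxsum_cases (J := J) (fun i _ => e1 i) (fun i => nakano_norm_ge0 p (\1_(D i) \* f)).
  by rewrite gt0_muley ?lte_fin// leey.
rewrite ME; apply: le_boxsum_limit => // l Ml.
have cl0 : 0 < c * l by rewrite mulr_gt0// (le_lt_trans M0).
apply: (nakano_norm_le cl0).
have := sum_nakano_modular_le1 (pp := fun=> p) (fun _ => p1) q1 (fun=> mp)
  measurable_indic_f (fun i _ => e1 i) eq (supp ep) qc ME Ml.
apply: le_trans; rewrite nakano_modular.unlock -integral01_sum.
- apply: le_integral01.
  + exact: measurable_modular.
  + by apply: (@measurable_sum _ Leb R) => i; exact: mw.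
  + by move=> t; exact: w0.
  + by move=> t t01; apply: sumr_ge0 => i _; exact: w0.
  + apply: filterS cover => t + t01 => /(_ t01)[j jJ Dj].
    rewrite -(weight_in _ _ Dj).
    by apply: (term_le_sum (h := fun j => ode_weight p _ t) jJ) => i _; exact: w0.
- by move=> i; exact: mw.
- by move=> i t; exact: w0.
Qed.

(** The constant is 2 times 2. One factor bounds 2 - 1/q. For the other, Young's inequality bounds
    the modular for [p] by those for the constant exponents plus 1, hence by 2, and doubling the
    argument of a modular at least halves it. *)
Lemma nakano_norm_le_boxsum_cst (q : R) : 1 <= q ->
  {in J, forall i, {ae @leb R, forall t, I01 t -> D i t -> p t <= e i}} ->
  {in J, forall i, nakano_norm (cst (e i)) (\1_(D i) \* f) = 0%E \/ e i <= q} ->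
  (nakano_norm p f <=
    4%:E * boxsum [seq (e i, nakano_norm (cst (e i)) (\1_(D i) \* f)%R) | i <- J])%E.
Proof.
move=> q1 pe eq.
have qc : 2 - q^-1 <= 2 by rewrite lerBlDr lerDl invr_ge0 (le_trans ler01).
have [->|[_ [M [_ _ M0 ME _]]]] :=
    boxsum_cases (J := J) (fun i _ => e1 i) (fun i => nakano_norm_ge0 (cst (e i)) (\1_(D i) \* f)).
  by rewrite gt0_muley ?lte_fin// leey.
rewrite ME; apply: le_boxsum_limit => // l Ml.
have l0 : 0 < l by exact: le_lt_trans Ml.
have l40 : 0 < 4 * l by rewrite mulr_gt0.
apply: (nakano_norm_le l40).
have := sum_nakano_modular_le1 (pp := fun i => cst (e i)) e1c q1 mec
  measurable_indic_f (fun i _ => e1 i) eq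
  (fun i _ => aeW _ (fun t _ _ => lexx _)) qc ME Ml.
rewrite nakano_modular.unlock -integral01_sum; last 2 first.
- by move=> i; exact: mwc.
- by move=> i t; apply: w0; exact: e1c.
pose h t := \sum_(i <- J) ode_weight (cst (e i)) (fun s => (\1_(D i) \* f) s / (2 * l)) t.
have mh : measurable_fun (I01 : set Leb) h.
  by apply: (@measurable_sum _ Leb R) => i; exact: mwc.
have h0 t : I01 t -> 0 <= h t.
  by move=> t01; apply: sumr_ge0 => i _; apply: w0 t01; exact: e1c.
move=> h1; apply: (@le_trans _ _ (2^-1%:E * (\int[@leb R]_(t in (I01 : set Leb)) (h t)%:E + 1))%E).
  have c20 : 0 <= 2^-1 :> R by rewrite invr_ge0.
  rewrite -(integral01_affine c20 mh h0); apply: le_integral01.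
  - exact: measurable_modular.
  - apply: (@measurable_funM _ Leb R); first exact: measurable_cst.
    apply: (@measurable_funD _ Leb R); [exact: mh|exact: measurable_cst].
  - by move=> t; exact: w0.
  - by move=> t t01; rewrite mulr_ge0 ?invr_ge0// addr_ge0 ?h0.
  move: cover (ae_leb_in pe); apply: filterS2 => t + + t01.
  move=> /(_ t01)[j jJ Dj] /(_ j jJ t01 Dj) pej; have pt := p1 t01.
  have pt0 : 0 < p t by exact: lt_le_trans pt.
  apply: (@le_trans _ _ (2^-1 * ode_weight p (fun s => f s / (2 * l)) t)).
    rewrite /ode_weight mulrA ler_pM2r ?invr_gt0//.
    have -> : f t / (4 * l) = 2^-1 * (f t / (2 * l)) by field; rewrite gt_eqF.
    rewrite normrM powRM// ger0_norm ?invr_ge0// ler_wpM2r ?powR_ge0//.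
    by apply: ge1r_powR => //; rewrite invr_gt0 ltr0n/= invf_le1 ?ler1n.
  rewrite ler_pM2l ?invr_gt0//.
  apply: (@le_trans _ _ (ode_weight (cst (e j)) (fun s => f s / (2 * l)) t + 1)).
    rewrite /ode_weight; apply: le_trans (powR_young _ pt pej) _; first exact: normr_ge0.
    by rewrite lerD2l invf_le1.
  rewrite lerD2r -(weight_in _ _ Dj).
  apply: (term_le_sum (h := fun j => ode_weight (cst (e j)) _ t) jJ) => i _.
  by apply: w0 t01; exact: e1c.
rewrite lee_pdivrMl ?ltr0n// mule1; have -> : 2%:E = (1 + 1)%E :> \bar R by rewrite -EFinD.
by apply: leeD2r; exact: h1.
Qed.

End upper.

Section lower.
Hypothesis uJ : uniq J.
Hypothesis disj : forall i j t, i \in J -> j \in J -> D i t -> D j t -> i = j.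

Lemma boxsum_le_nakano_norm (q : R) : 1 <= q ->
  {in J, forall i, {ae @leb R, forall t, I01 t -> D i t -> p t <= e i}} ->
  {in J, forall i, nakano_norm p (\1_(D i) \* f) = 0%E \/ e i <= q} ->
  (boxsum [seq (e i, nakano_norm p (\1_(D i) \* f)%R) | i <- J] <=
    (2 - q^-1)%:E * nakano_norm p f)%E.
Proof.
move=> q1 pe eq.
have c0 : 0 < 2 - q^-1 by have : q^-1 <= 1 by [rewrite invf_le1// (lt_le_trans ltr01)]; lra.
rewrite -lee_pdivrMl//; apply: le_nakano_norm => l l0 mod1.
rewrite lee_pdivrMl//.
apply: (boxsum_nakano_le (pp := fun=> p) (fun _ => p1) q1 (fun=> mp)
  measurable_indic_f (fun i _ => e1 i) eq (supp pe) l0).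
apply: le_trans mod1; rewrite nakano_modular.unlock -integral01_sum.
- apply: le_integral01.
  + by apply: (@measurable_sum _ Leb R) => i; exact: mw.
  + exact: measurable_modular.
  + by move=> t t01; apply: sumr_ge0 => i _; exact: w0.
  + by move=> t; exact: w0.
  + apply: aeW => t t01; apply: (sum_disjoint_le (P := fun i => D i t) uJ).
    * by move=> i j iJ jJ; exact: disj.
    * by move=> i iJ; apply: weight_out; exact: p1.
    * by move=> i iJ Dt; rewrite weight_in.
    * exact: w0.
- by move=> i; exact: mw.
- by move=> i t; exact: w0.
Qed.

(** By Young's inequality the modulars for the constant exponents at [l] add up to at most 1 + 1, so
    at 2 l to at most 1; the second factor 2 bounds 2 - 1/q. *)
Lemma boxsum_cst_le_nakano_norm (q : R) : 1 <= q ->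
  {in J, forall i, {ae @leb R, forall t, I01 t -> D i t -> e i <= p t}} ->
  {in J, forall i, nakano_norm (cst (e i)) (\1_(D i) \* f) = 0%E \/ e i <= q} ->
  (boxsum [seq (e i, nakano_norm (cst (e i)) (\1_(D i) \* f)%R) | i <- J] <=
    4%:E * nakano_norm p f)%E.
Proof.
move=> q1 ep eq.
have qc : 2 - q^-1 <= 2 by rewrite lerBlDr lerDl invr_ge0 (le_trans ler01).
rewrite -lee_pdivrMl//; apply: le_nakano_norm => l l0 mod1.
rewrite lee_pdivrMl//.
have l20 : 0 < 2 * l by rewrite mulr_gt0.
apply: (@le_trans _ _ ((2 - q^-1) * (2 * l))%:E); last first.
  by rewrite -EFinM lee_fin mulrA ler_pM2r//; lra.
apply: (boxsum_nakano_le (pp := fun i => cst (e i)) e1c q1 mec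
  measurable_indic_f (fun i _ => e1 i) eq
  (fun i _ => aeW _ (fun t _ _ => lexx _)) l20).
apply: (@le_trans _ _ (\sum_(i <- J) (2^-1%:E *
    nakano_modular (cst (e i)) (\1_(D i) \* f)%R l))%E).
  apply: lee_sum => i _.
  apply: (nakano_modular_scale (@e1c i) (mec i) (measurable_indic_f i)) => //.
  apply: aeW => t _ _; have -> : l / (2 * l) = 2^-1 by field; rewrite gt_eqF.
  by apply: ge1r_powR; [rewrite invr_gt0 ltr0n/= invf_le1 ?ler1n|exact: e1].
rewrite -ge0_sume_distrr; last by move=> i _; apply: nakano_modular_ge0; exact: e1c.
rewrite lee_pdivrMl ?ltr0n// mule1; have -> : 2%:E = (1 + 1)%E :> \bar R by rewrite -EFinD.
apply: (@le_trans _ _ (nakano_modular p f l + 1)%E); last by rewrite leeD2r.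
rewrite nakano_modular.unlock -integral01_sum; last 2 first.
- by move=> i; exact: mwc.
- by move=> i t; apply: w0; exact: e1c.
have mwf := measurable_modular p1 mp mf l.
have wf0 t : I01 t -> 0 <= ode_weight p (fun s => f s / l) t by exact: w0.
rewrite -[leRHS]mul1e -(integral01_affine ler01 mwf wf0).
apply: le_integral01.
- by apply: (@measurable_sum _ Leb R) => i; exact: mwc.
- apply: (@measurable_funM _ Leb R); first exact: measurable_cst.
  apply: (@measurable_funD _ Leb R); [exact: mwf|exact: measurable_cst].
- by move=> t t01; apply: sumr_ge0 => i _; apply: w0 t01; exact: e1c.
- by move=> t t01; rewrite mul1r addr_ge0// wf0.
apply: filterS (ae_leb_in ep) => t H t01; rewrite mul1r.
apply: (sum_disjoint_le (P := fun i => D i t) uJ).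
- by move=> i j iJ jJ; exact: disj.
- by move=> i iJ; apply: weight_out; exact: e1.
- move=> i iJ Dt; rewrite weight_in// /ode_weight.
  apply: le_trans (powR_young _ (e1 i) (H i iJ t01 Dt)) _; first exact: normr_ge0.
  by rewrite lerD2l invf_le1// (lt_le_trans ltr01).
- by rewrite addr_ge0// wf0.
Qed.

End lower.
End nakano_decomposition.

(** * Essential bounds and null pieces *)

Section essential_bounds_theory.
Context {R : realType}.
Local Notation Leb := (lebesgueType R).

Lemma ae_mrestr (D : set R) (mD : measurable (D : set Leb)) (P : R -> Prop) :
  {ae mrestr (@leb R) mD, forall t, P t} <-> {ae @leb R, forall t, D t -> P t}.
Proof.
split=> [[A [mA A0 PA]]|[A [mA A0 PA]]].
  exists (A `&` D); split; [exact: measurableI|exact: A0|].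
  by move=> t /= H; split; [apply: PA => /= Pt; apply: H|apply: contrapT => Dt; apply: H].
exists (A `|` ~` D); split.
- by apply: measurableU; [exact: mA|exact: measurableC].
- rewrite /mrestr setIUl setICl setU0; apply/eqP; rewrite eq_le measure_ge0 andbT.
  rewrite -[X in (_ <= X)%E]A0.
  by apply: le_measure; rewrite ?inE//; exact: measurableI.
move=> t /= nP; case: (pselect (D t)) => Dt; last by right.
by left; apply: PA => /= H; apply: nP; exact: H.
Qed.

Lemma ess_sup_on_ae (D : set R) (mD : measurable (D : set Leb)) (p : R -> R) (s : R) :
  ess_sup_on mD p = s%:E -> {ae @leb R, forall t, D t -> p t <= s}.
Proof.
move=> sE; apply/(ae_mrestr mD).
have := ess_sup_ge (mrestr (@leb R) mD) (EFin \o p).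
rewrite -/(ess_sup_on mD p) sE; exact.
Qed.

Lemma ess_inf_on_ae (D : set R) (mD : measurable (D : set Leb)) (p : R -> R) (r : R) :
  ess_inf_on mD p = r%:E -> {ae @leb R, forall t, D t -> r <= p t}.
Proof.
move=> rE; apply/(ae_mrestr mD).
have := ess_inf_le (mrestr (@leb R) mD) (EFin \o p).
rewrite -/(ess_inf_on mD p) rE; exact.
Qed.

Lemma ae_null (D : set R) : measurable (D : set Leb) -> leb D = 0%E ->
  {ae @leb R, forall t, ~ D t}.
Proof. by move=> mD D0; exists D; split => // t /= /contrapT. Qed.

Lemma ae_nonnull (D : set R) (P : Prop) : measurable (D : set Leb) ->
  leb D != 0%E -> {ae @leb R, forall t, D t -> P} -> P.
Proof.
move=> mD D0 [A [mA A0 PA]]; apply: contrapT => nP.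
move/eqP : D0; apply; apply/eqP; rewrite eq_le measure_ge0 andbT -A0.
by apply: le_measure; rewrite ?inE// => t Dt; apply: PA => /= H; apply: nP; exact: H.
Qed.

Lemma nakano_norm_null (p g : R -> R) : (forall t, I01 t -> 1 <= p t) ->
  measurable_fun (I01 : set Leb) p -> measurable_fun (I01 : set Leb) g ->
  {ae @leb R, forall t, I01 t -> g t = 0} -> nakano_norm p g = 0%E.
Proof.
move=> p1 mp mg g0; apply/eqP; rewrite eq_le nakano_norm_ge0 andbT.
apply/lee_addgt0Pr => l l0; rewrite add0e; apply: (nakano_norm_le l0).
apply: (@le_trans _ _ (0%:E * nakano_modular p g l)%E); last by rewrite mul0e.
apply: (nakano_modular_scale p1 mp mg) => //.
by apply: filterS g0 => t + t01 => /(_ t01) ->; rewrite eqxx.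
Qed.

Lemma le_scale (k K : R) (x y : \bar R) : k <= K -> (0 <= y)%E ->
  (x <= k%:E * y)%E -> (x <= K%:E * y)%E.
Proof. by move=> kK y0 xy; apply: le_trans xy _; rewrite lee_wpmul2r// lee_fin. Qed.

Lemma scale_inv_le (k K : R) (x y : \bar R) : k <= K -> 0 < K -> (0 <= y)%E ->
  (x <= k%:E * y)%E -> ((K^-1)%:E * x <= y)%E.
Proof. by move=> kK K0 y0 xy; rewrite lee_pdivrMl//; exact: le_scale xy. Qed.

Lemma powR_self_eq_expR1 (a : R) : 0 < a -> a `^ a = expR 1 -> 1 <= a.
Proof.
move=> a0 aE; rewrite leNgt; apply/negP => a1.
have : expR 1 <= 1 :> R by rewrite -aE; apply: powR_le1; exact: ltW.
by rewrite leNgt expR_gt1 ltr01.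
Qed.

Lemma increasing_le (n : nat) (r : nat -> R) i j :
  (forall k, (1 <= k < n)%N -> r k < r k.+1) ->
  (1 <= i)%N -> (i <= j)%N -> (j <= n)%N -> r i <= r j.
Proof.
move=> r_lt i1; elim: j => [|j IH]; first by rewrite leqn0 => /eqP ->.
rewrite leq_eqVlt => /predU1P[->//|ij] jn.
apply: le_trans (IH ij (ltnW jn)) _; apply/ltW/r_lt.
by rewrite jn (leq_trans i1).
Qed.

Lemma locate_step (r : nat -> R) y m : (1 <= m)%N -> r 1%N <= y -> y < r m ->
  exists2 i, (1 <= i < m)%N & r i <= y < r i.+1.
Proof.
elim: m => // m IH _ ry ym.
case: m => [|m] in IH ym *; first by move: (le_lt_trans ry ym); rewrite ltxx.
have [ym'|ym'] := ltP y (r m.+1).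
  have [i /andP[i1 im] H] := IH isT ry ym'.
  by exists i => //; rewrite i1 leqW.
by exists m.+1; rewrite ?ltnSn// ym' ym.
Qed.

End essential_bounds_theory.

Theorem theorem4p1 (R : realType) (a b pbar : R) (p f : R -> R)
  (a_gt0 : 0 < a) (aE : a `^ a = expR 1)
  (p_ge1 : forall t, I01 t -> 1 <= p t)
  (mp : measurable_fun (I01 : set (lebesgueType R)) p)
  (pbarE : ess_sup_on (@lebesgue_measurable_I01 R) p = pbar%:E)
  (bE : is_b pbar b)
  (fL : L_ode p f) :
  let C := 2 * (1 + a * expR 1) in
  (forall (n : nat) (r : nat -> R),
     (2 <= n)%N -> r 1%N = 1 -> r n = pbar ->
     (forall i, (1 <= i < n)%N -> r i < r i.+1) ->
     let lo i := p @^-1` (if i == 1%N then `[r i, r i.+1]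
                          else `]r i, r i.+1])%classic in
     let up i := p @^-1` (if i == n.-1 then `[r i, r i.+1]
                          else `[r i, r i.+1[)%classic in
     ((C^-1)%:E * boxsum [seq (r i, nakano_norm (cst (r i)) (\1_(lo i) \* f)%R)
                         | i <- rev (iota 1 n.-1)]
       <= nakano_norm p f)%E /\
     (nakano_norm p f <=
       C%:E * boxsum [seq (r i.+1, nakano_norm (cst (r i.+1)) (\1_(up i) \* f)%R)
                     | i <- iota 1 n.-1])%E) /\
  (forall (n : nat) (D : 'I_n -> set R)
     (mD : forall i, measurable (D i : set (lebesgueType R)))
     (r s : 'I_n -> R),
     trivIset [set: 'I_n] D -> \bigcup_i D i = I01 ->
     (forall i, 1 <= r i /\ 1 <= s i) ->
     (forall i, leb (D i) != 0%E ->
        ess_inf_on (mD i) p = (r i)%:E /\ ess_sup_on (mD i) p = (s i)%:E) ->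
     [/\ ((C^-1)%:E * boxsum [seq (r i, nakano_norm (cst (r i)) (\1_(D i) \* f)%R)
                             | i <- enum 'I_n] <= nakano_norm p f)%E /\
         (nakano_norm p f <=
           C%:E * boxsum [seq (s i, nakano_norm (cst (s i)) (\1_(D i) \* f)%R)
                         | i <- enum 'I_n])%E,
         ((b^-1)%:E * boxsum [seq (s i, ode_norm p (\1_(D i) \* f)%R)
                             | i <- enum 'I_n] <= ode_norm p f)%E /\
         (ode_norm p f <=
           b%:E * boxsum [seq (r i, ode_norm p (\1_(D i) \* f)%R)
                         | i <- enum 'I_n])%E &
         ((b^-1)%:E * boxsum [seq (s i, nakano_norm p (\1_(D i) \* f)%R)
                             | i <- enum 'I_n] <= nakano_norm p f)%E /\
         (nakano_norm p f <=
           b%:E * boxsum [seq (r i, nakano_norm p (\1_(D i) \* f)%R)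
                         | i <- enum 'I_n])%E]).
Proof.
move=> C; have [pb1 b1 bq] := is_b_ge bE.
have a1 := powR_self_eq_expR1 a_gt0 aE.
have C4 : 4 <= C.
  have e1 : 1 <= expR 1 :> R by rewrite -expR0 ler_expR.
  have : 1 * 1 <= a * expR 1 by apply: ler_pM.
  rewrite /C; lra.
have C0 : 0 < C by lra.
have b0 : 0 < b by lra.
have ppb := ess_sup_on_ae pbarE.
have [mf _] := fL.
have f0 := nakano_norm_ge0 p f.
split.
  move=> n r n2 r1 rn r_lt lo up.
  have r_le i j : (1 <= i)%N -> (i <= j)%N -> (j <= n)%N -> r i <= r j.
    exact: increasing_le r_lt.
  have loP i t : lo i t -> r i <= p t <= r i.+1.
    rewrite /lo/=; case: ifP => _; rewrite /= in_itv//= => /andP[H1 ->].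
    by rewrite (ltW H1).
  have upP i t : up i t -> r i <= p t <= r i.+1.
    rewrite /up/=; case: ifP => _; rewrite /= in_itv//= => /andP[-> H1].
    by rewrite (ltW H1).
  have mlo i : measurable (I01 `&` lo i : set (lebesgueType R)).
    by apply: mp; [exact: lebesgue_measurable_I01|case: ifP => _; exact: measurable_itv].
  have mup i : measurable (I01 `&` up i : set (lebesgueType R)).
    by apply: mp; [exact: lebesgue_measurable_I01|case: ifP => _; exact: measurable_itv].
  (* The estimates ask for exponents at least 1 at every index, but nothing is known about [r]
     outside 1, ..., n; the maximum with 1 changes nothing inside that range. *)
  have maxE i : (1 <= i)%N -> (i <= n)%N -> Num.max 1 (r i) = r i.
    by move=> i1 i2; apply/max_idPr; rewrite -r1; exact: r_le.
  have max1 i : 1 <= Num.max 1 (r i) by rewrite le_max lexx.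
  have iotaP i : i \in iota 1 n.-1 -> (1 <= i < n)%N.
    by rewrite mem_iota add1n prednK// (leq_trans _ n2).
  have n0 : (0 < n)%N by rewrite (leq_trans _ n2).
  split.
    apply: (scale_inv_le C4 C0 f0).
    have -> : [seq (r i, nakano_norm (cst (r i)) (\1_(lo i) \* f)%R) | i <- rev (iota 1 n.-1)] =
      [seq (Num.max 1 (r i), nakano_norm (cst (Num.max 1 (r i))) (\1_(lo i) \* f)%R) | i <- rev (iota 1 n.-1)].
      apply/eq_in_map => i; rewrite mem_rev => /iotaP/andP[i1 i2].
      by rewrite maxE// ltnW.
    have ulo : uniq (rev (iota 1 n.-1)) by rewrite rev_uniq iota_uniq.
    (* Only the first piece is closed on the left, so the later of two pieces forces p > r_j
       strictly, while the earlier one gives p <= r_(i+1) <= r_j. *)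
    have lo_lt i j t : (1 <= i)%N -> (j < n)%N -> (i < j)%N -> lo i t -> lo j t -> False.
      move=> i1 jn ij /loP/andP[_ pi]; rewrite /lo/=.
      rewrite gtn_eqF ?(leq_ltn_trans i1 ij)//= in_itv/= => /andP[pj _].
      have := r_le i.+1 j isT ij (ltnW jn).
      by rewrite leNgt (lt_le_trans pj pi).
    have disj i j t : i \in rev (iota 1 n.-1) -> j \in rev (iota 1 n.-1) ->
        lo i t -> lo j t -> i = j.
      rewrite !mem_rev => /iotaP/andP[i1 i2] /iotaP/andP[j1 j2] li lj.
      by case: (ltngtP i j) => // ij; exfalso; [apply: (lo_lt i j t)|apply: (lo_lt j i t)].
    apply: (boxsum_cst_le_nakano_norm p_ge1 mp mf mlo max1 ulo disj pb1).
    - move=> i; rewrite mem_rev => /iotaP/andP[i1 i2].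
      by apply: aeW => t _ /loP/andP[H _]; rewrite maxE// ltnW.
    - move=> i; rewrite mem_rev => /iotaP/andP[i1 i2]; right.
      by rewrite maxE ?(ltnW i2)// -rn; apply: r_le => //; exact: ltnW.
  have -> : [seq (r i.+1, nakano_norm (cst (r i.+1)) (\1_(up i) \* f)%R) | i <- iota 1 n.-1] =
    [seq (Num.max 1 (r i.+1), nakano_norm (cst (Num.max 1 (r i.+1))) (\1_(up i) \* f)%R) | i <- iota 1 n.-1].
    by apply/eq_in_map => i /iotaP/andP[i1 i2]; rewrite maxE.
  apply: (le_scale C4).
    by apply: boxsum_ge0 => [i _|i]; [exact: max1|exact: nakano_norm_ge0].
  apply: (nakano_norm_le_boxsum_cst p_ge1 mp mf mup (fun i => max1 i.+1) _ pb1).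
    - apply: filterS ppb => t H t01; have pt := p_ge1 _ t01; have {}H := H t01.
      have [ptn|ptn] := ltP (p t) (r n).
        have r1t : r 1%N <= p t by rewrite r1.
        have [i /andP[i1 i2] /andP[H1 H2]] := locate_step n0 r1t ptn.
        exists i; first by rewrite mem_iota i1 add1n prednK.
        by rewrite /up/=; case: ifP => _; rewrite /= in_itv/= H1 ?(ltW H2).
      (* Points with p = pbar lie in no half-open piece; the last piece is closed and takes them. *)
      have n10 : (0 < n.-1)%N by rewrite -ltnS prednK.
      exists n.-1; first by rewrite mem_iota n10 add1n ltnSn.
      rewrite /up eqxx/= in_itv/= prednK// rn H andbT.
      by apply: le_trans ptn; apply: r_le; rewrite ?leq_pred.
    - move=> i /iotaP/andP[i1 i2]; apply: aeW => t _ /upP/andP[_ H].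
      by rewrite maxE.
    - move=> i /iotaP/andP[i1 i2]; right; rewrite maxE// -rn.
      exact: r_le.
move=> n D mD r s triv cov rs1 rsE.
have r1 i : 1 <= r i by have [] := rs1 i.
have s1 i : 1 <= s i by have [] := rs1 i.
have DI i : D i `<=` I01 by move=> t Dt; rewrite -cov; exists i.
have mID i : measurable (I01 `&` D i : set (lebesgueType R)).
  by apply: measurableI; [exact: lebesgue_measurable_I01|exact: mD].
have disj (i j : 'I_n) t : i \in enum 'I_n -> j \in enum 'I_n -> D i t -> D j t -> i = j.
  by move=> _ _ Dit Djt; apply: triv => //; exists t.
have cover t : I01 t -> exists2 j, j \in enum 'I_n & D j t.
  by rewrite -{1}cov => -[j _ Djt]; exists j => //; rewrite mem_enum.
have cover_ae : {ae @leb R, forall t, I01 t -> exists2 j, j \in enum 'I_n & D j t}.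
  by apply: aeW => t; exact: cover.
have uJ := enum_uniq 'I_n.
have rp : {in enum 'I_n, forall i, {ae @leb R, forall t, I01 t -> D i t -> r i <= p t}}.
  move=> i _; have [D0|D0] := eqVneq (leb (D i)) 0%E.
    by apply: filterS (ae_null (mD i) D0) => t H _ /H.
  by have [/ess_inf_on_ae + _] := rsE i D0; apply: filterS => t H _ /H.
have ps : {in enum 'I_n, forall i, {ae @leb R, forall t, I01 t -> D i t -> p t <= s i}}.
  move=> i _; have [D0|D0] := eqVneq (leb (D i)) 0%E.
    by apply: filterS (ae_null (mD i) D0) => t H _ /H.
  by have [_ /ess_sup_on_ae +] := rsE i D0; apply: filterS => t H _ /H.
(* A piece of positive measure has a point at which both r i <= p and p <= pbar hold. *)
have rpb i : leb (D i) != 0%E -> r i <= pbar.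
  move=> D0; apply: (ae_nonnull (mD i) D0).
  have [/ess_inf_on_ae + _] := rsE i D0; move: ppb.
  by apply: filterS2 => t H1 H2 Dt; apply: le_trans (H2 Dt) (H1 (DI _ _ Dt)).
have spb i : leb (D i) != 0%E -> s i <= pbar.
  move=> D0; have [_ sE] := rsE i D0.
  rewrite -lee_fin -sE; apply/ess_supP; apply/(ae_mrestr (mD i)).
  by apply: filterS ppb => t H Dt; rewrite lee_fin H//; exact: DI Dt.
have null i : leb (D i) = 0%E -> {ae @leb R, forall t, I01 t -> (\1_(D i) \* f) t = 0 :> R}.
  move=> D0; apply: filterS (ae_null (mD i) D0) => t Dt _.
  by rewrite /= indicE memNset// mul0r.
have mDf i : measurable_fun (I01 : set (lebesgueType R)) (\1_(D i) \* f).
  apply: (@measurable_funM _ (lebesgueType R) R); last exact: mf.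
  exact: (@measurable_indic _ (lebesgueType R) R).
have nakc e i : 1 <= e -> leb (D i) = 0%E -> nakano_norm (cst e) (\1_(D i) \* f) = 0%E.
  move=> e1 D0; apply: nakano_norm_null; last exact: null.
  - by move=> t _.
  - exact: measurable_cst.
  - exact: mDf.
have nakp i : leb (D i) = 0%E -> nakano_norm p (\1_(D i) \* f) = 0%E.
  move=> D0; apply: nakano_norm_null; [exact: p_ge1|exact: mp|exact: mDf|exact: null].
have odep i : leb (D i) = 0%E -> ode_norm p (\1_(D i) \* f) = 0%E.
  move=> D0; apply: (ode_norm_null p_ge1); last exact: null.
  exact: (L_ode_indic pb1 p_ge1 mp ppb (mD i) fL).
have [N [Phi [NE N0 _ _ _]]] := ode_normP p_ge1 fL.
split; split.
- apply: (scale_inv_le C4 C0 f0).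
  apply: (boxsum_cst_le_nakano_norm p_ge1 mp mf mID r1 uJ disj pb1 rp) => i _.
  by have [/nakc H|/rpb] := eqVneq (leb (D i)) 0%E; [left; exact: H|right].
- apply: (le_scale C4).
    by apply: boxsum_ge0 => [i _|i]; [exact: s1|exact: nakano_norm_ge0].
  apply: (nakano_norm_le_boxsum_cst p_ge1 mp mf mID s1 cover_ae pb1 ps) => i _.
  by have [/nakc H|/spb] := eqVneq (leb (D i)) 0%E; [left; exact: H|right].
- apply: (scale_inv_le bq b0); first by rewrite NE lee_fin.
  apply: (boxsum_le_ode_norm pb1 p_ge1 mp ppb uJ mD cover disj fL (fun i _ => s1 i) ps) => i _.
  by have [/odep H|/spb] := eqVneq (leb (D i)) 0%E; [left|right].
- apply: le_scale bq _ (ode_norm_le_boxsum pb1 p_ge1 mp ppb uJ mD cover disj fL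
    (fun i _ => r1 i) rp).
  apply: boxsum_ge0 => [i _|i]; first exact: r1.
  have [Ni [_ [-> Ni0 _ _ _]]] := ode_normP p_ge1 (L_ode_indic pb1 p_ge1 mp ppb (mD i) fL).
  by rewrite lee_fin.
- apply: (scale_inv_le bq b0 f0).
  apply: (boxsum_le_nakano_norm p_ge1 mp mf mID s1 uJ disj pb1 ps) => i _.
  by have [/nakp H|/spb] := eqVneq (leb (D i)) 0%E; [left|right].
- apply: (nakano_norm_le_boxsum p_ge1 mp mf mID r1 cover_ae pb1 bq rp) => i _.
  by have [/nakp H|/rpb] := eqVneq (leb (D i)) 0%E; [left|right].
Qed.
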